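(* Let $2<p<\infty$ and let $X=(X_j)_{j\ge 0}$ be any sequence of analytic polynomials. For every $K\ge1$, $$\mathscr C_K(X)^2=\sup_{\lambda\in\Lambda}A_\lambda\gamma_K(\lambda),\qquad \mathscr C_\infty(X)^2=\sup_{\lambda\in\Lambda}A_\lambda .$$ There is a constant $c_p>0$ depending only on $p$ such that, for every $K\ge1$ and every $\lambda\in\Lambda$ with $A_\lambda>0$, $$c_p\,\delta_K(\lambda)^2\le1-\gamma_K(\lambda)\le\delta_K(\lambda)^\alpha .$$ Consequently $\mathscr C_K(X)\uparrow\mathscr C_\infty(X)$ as $K\to\infty$, including the case of an infinite limit. All these statements remain valid for coordinate tails, i.e. with $(X_j)_{j\ge0}$ replaced by $(X_j)_{j>N}$ for any $N$.
   Context: $\mathbb T$ is the unit circle with normalized Haar measure $m$, $\mathbb D$ the open unit disc, $H^u$ the Hardy space identified with boundary functions, $\|\cdot\|_u$ the norm of $L^u(\mathbb T,m)$. Exponents: $r=p/2$, $t=2p/(p-2)$, $\alpha=2/t=(p-2)/p$. For $a\in\mathbb D$, $P_a(\zeta)=\frac{1-|a|^2}{|1-\overline a\zeta|^2}$. $\mathcal A_K$ is the set of outer $h\in H^t$ with $|h|^t=\sum_{\nu=1}^Kc_\nu P_{a_\nu}$ a.e. on $\mathbb T$, for some $a_\nu\in\mathbb D$, $c_\nu\ge0$, $\sum_\nu c_\nu=1$. $\mathcal P_K$ is the set of probability densities $\sum_{\nu=1}^Kc_\nu P_{a_\nu}$ of this form (convex combinations of at most $K$ Poisson kernels). $\mathscr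 C_K(X)=\sup_{h\in\mathcal A_K}\bigl(\sum_j\|X_jh\|_2^t\bigr)^{1/t}$, and $\mathscr C_\infty(X)=\sup_{\|h\|_{H^t}\le1}\bigl(\sum_j\|X_jh\|_2^t\bigr)^{1/t}$ is the norm of $h\mapsto(X_jh)_j$ from $H^t$ to $\ell^t(H^2)$; both take values in $[0,\infty]$. $\Lambda$ is the set of finitely supported nonnegative sequences $\lambda=(\lambda_j)$ with $\|\lambda\|_{\ell^r}=1$. For $\lambda\in\Lambda$: $S_\lambda=\sum_j\lambda_j|X_j|^2$ on $\mathbb T$, $A_\lambda=\|S_\lambda\|_r$, and, if $A_\lambda>0$, $W_\lambda=S_\lambda^r/A_\lambda^r$ (a probability density), $$\delta_K(\lambda)=\inf_{Q\in\mathcal P_K}\|W_\lambda-Q\|_1,\qquad \gamma_K(\lambda)=\sup_{Q\in\mathcal P_K}\int_{\mathbb T}W_\lambda^{1-\alpha}Q^\alpha\,dm .$$ Those $\lambda$ with $A_\lambda=0$ are omitted from the suprema (an empty supremum being $0$). *)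

(* Defs.v *)
From HB Require Import structures.
From mathcomp Require Import all_boot all_order all_algebra.
From mathcomp Require Import complex.
From mathcomp Require Import all_classical all_reals all_analysis.

Set Implicit Arguments.
Unset Strict Implicit.
Unset Printing Implicit Defensive.

Import Order.TTheory GRing.Theory Num.Theory.
Import numFieldNormedType.Exports.

Local Open Scope classical_set_scope.
Local Open Scope ring_scope.
Local Open Scope complex_scope.

(* A function on the unit circle is represented by a function of the angle
   theta, the point of the circle being [expi theta].  Only the angles in
   [0, 2 pi] are seen by the normalized Haar measure [haar]. *)

Section circle.
Context {R : realType}.

Definition cmod (z : R[i]) : R := ComplexField.Normc.normc z.

Definition expi (theta : R) : R[i] := cos theta +i* sin theta.

Definition cexp (z : R[i]) : R[i] :=
  (expR (complex.Re z))%:C * expi (complex.Im z).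

Lemma twopi_gt0 : 0 < 2 * pi :> R.
Proof. by rewrite mulr_gt0 ?pi_gt0. Qed.

Definition haar : probability (measurableTypeR R) R := uniform_prob twopi_gt0.

Definition cintegral (f : R -> R[i]) : R[i] :=
  (\int[haar]_theta complex.Re (f theta)) +i*
  (\int[haar]_theta complex.Im (f theta)).

Definition cmeasurable (f : R -> R[i]) : Prop :=
  measurable_fun setT (fun theta => complex.Re (f theta)) /\
  measurable_fun setT (fun theta => complex.Im (f theta)).

Definition cLnorm (u : R) (f : R -> R[i]) : \bar R :=
  ('N[haar]_(u%:E)[EFin \o (cmod \o f)])%E.

Definition fourier (f : R -> R[i]) (k : int) : R[i] :=
  cintegral (fun theta => f theta * expi theta ^ (- k)).

(* Boundary functions of H^u: the f in L^u whose Fourier coefficients of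
   negative index vanish (used for u >= 1 only). *)
Definition hardy (u : R) : set (R -> R[i]) :=
  [set f | [/\ cmeasurable f, (cLnorm u f < +oo)%E &
               forall k : int, k < 0 -> fourier f k = 0]].

Definition disc : set R[i] := [set z | cmod z < 1].

Definition poisson (a : R[i]) (theta : R) : R :=
  (1 - cmod a ^+ 2) / cmod (1 - a^* * expi theta) ^+ 2.

(* The analytic function on the disc identified with the boundary function f
   of H^u. *)
Definition disc_ext (f : R -> R[i]) (z : R[i]) : R[i] :=
  cintegral (fun theta => (poisson z theta)%:C * f theta).

Definition outer (f : R -> R[i]) : Prop :=
  (* [lne 0 = -oo], so that integrability forces f to be nonzero a.e. *)
  haar.-integrable setT (fun theta => lne (cmod (f theta))%:E) /\
  exists2 c : R[i], cmod c = 1 &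
    forall z, disc z ->
      disc_ext f z =
      c * cexp (cintegral (fun theta =>
        (expi theta + z) / (expi theta - z) * (ln (cmod (f theta)))%:C)).

Definition poisson_mix (K : nat) : set (R -> R) :=
  [set Q | exists a : 'I_K -> R[i], exists c : 'I_K -> R,
    [/\ forall nu, disc (a nu), forall nu, 0 <= c nu, \sum_nu c nu = 1 &
        Q = fun theta => \sum_nu c nu * poisson (a nu) theta]].

End circle.

Section exponents.
Context {R : realType}.
Variable p : R.

Definition rexp : R := p / 2.
Definition texp : R := 2 * p / (p - 2).
Definition aexp : R := (p - 2) / p.

End exponents.

(* Supremum in [0, +oo]: that of the empty set is 0. *)
Definition sup_nonneg {R : realType} (S : set (\bar R)) : \bar R :=
  ereal_sup (S `|` [set 0%E]).

Section multipliers.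
Context {R : realType}.
Variables (p : R) (X : nat -> {poly R[i]}).

Definition poly_mul (j : nat) (h : R -> R[i]) : R -> R[i] :=
  fun theta => (X j).[expi theta] * h theta.

(* The value of (sum_j ||X_j h||_2^t)^(1/t), in [0, +oo]. *)
Definition mult_norm (h : R -> R[i]) : \bar R :=
  ('N[counting]_((texp p)%:E)[(fun j : nat => cLnorm 2 (poly_mul j h))])%E.

Definition outer_mix (K : nat) : set (R -> R[i]) :=
  [set h | [/\ hardy (texp p) h, outer h &
    exists2 Q : R -> R, poisson_mix K Q &
      {ae haar, forall theta, cmod (h theta) `^ texp p = Q theta}]].

Definition CK (K : nat) : \bar R :=
  ereal_sup [set mult_norm h | h in outer_mix K].

Definition Coo : \bar R :=
  ereal_sup [set mult_norm h |
    h in [set h | hardy (texp p) h /\ (cLnorm (texp p) h <= 1)%E]].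

Definition Lam : set (nat -> R) :=
  [set lam | [/\ forall j : nat, 0 <= lam j,
                 finite_set [set j | lam j != 0] &
                 ('N[counting]_((rexp p)%:E)[EFin \o lam] = 1)%E]].

Definition Slam (lam : nat -> R) (theta : R) : R :=
  \sum_(j \in [set: nat]) lam j * cmod (X j).[expi theta] ^+ 2.

Definition Alam (lam : nat -> R) : \bar R :=
  ('N[haar]_((rexp p)%:E)[EFin \o Slam lam])%E.

(* [Alam lam] is finite, [Slam lam] being a trigonometric polynomial. *)
Definition Wlam (lam : nat -> R) (theta : R) : R :=
  Slam lam theta `^ rexp p / fine (Alam lam) `^ rexp p.

Definition deltaK (K : nat) (lam : nat -> R) : \bar R :=
  ereal_inf [set ('N[haar]_1[EFin \o (Wlam lam \- Q)%R])%E |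
    Q in poisson_mix K].

Definition gammaK (K : nat) (lam : nat -> R) : \bar R :=
  ereal_sup [set (\int[haar]_theta
      (Wlam lam theta `^ (1 - aexp p) * Q theta `^ aexp p)%:E)%E |
    Q in poisson_mix K].

End multipliers.

Definition coord_tail {R : realType} (X : nat -> {poly R[i]}) (N : nat) :
    nat -> {poly R[i]} :=
  fun j => X (N.+1 + j)%N.

(* Main.v *)
Require Import Defs.
From HB Require Import structures.
From mathcomp Require Import all_boot all_order all_algebra.
From mathcomp Require Import complex.
From mathcomp Require Import all_classical all_reals all_analysis measurable_realfun.
From mathcomp Require Import ring lra.

(** Write S, A, W for [Slam], [Alam], [Wlam], and r, t, alpha for the exponents;
    r and t/2 = 1/alpha are conjugate, and S = A W^(1-alpha).

    Duality between l^r and l^(t/2) says that the square of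
    [mult_norm p X h] is the supremum over the weights lambda of the integral
    of S |h|^2 ([mult_norm_ge], [mult_norm_le]).  If |h|^t = Q is a mixture of
    Poisson kernels, this integral is A times the affinity
    int W^(1-alpha) Q^alpha, so exchanging the suprema over h and lambda gives
    the formula for [CK], as soon as every mixture Q is |h|^t for an outer h.
    For h in the unit ball of H^t, Hoelder's inequality bounds the integral by
    A ([integral_Slam_le]), which is one half of the formula for [Coo].

    The outer functions are exponentials of elements of the disc algebra, taken
    as the uniform limits of polynomials on the closed disc ([disc_alg]).  The
    mean value property passes to such limits; it yields the vanishing of the
    negative Fourier coefficients, the Poisson formula and the Schwarz formula
    ([cintegral_schwarz]), hence [outer_cexp].  On the circle a mixture Q is a
    quotient of polynomials without zeros there, and each linear factor has, up
    to a constant, the modulus of some 1 - b zeta with |b| < 1, that is, of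
    the exponential of log (1 - b zeta), which lies in the disc algebra.  So Q,
    and each of its real powers, is the modulus of an exponential
    ([log_modulus_poisson_mix]).

    The two-sided estimate of 1 - gamma compares pointwise: from above,
    |x^alpha - y^alpha| <= |x - y|^alpha and Hoelder's inequality; from below,
    the arithmetic-geometric inequality with a Hellinger remainder
    ([young_hellinger_min]).

    Finally W is Lipschitz for the chordal distance, so that it is uniformly
    approximated by its Poisson integral, and this integral by mixtures with
    many poles ([poisson_mix_approx]).  Hence the affinities tend to 1, and
    A is the supremum of the A gamma_K.  As [CK] is at most [Coo], this gives
    both the other half of the formula for [Coo] and the convergence of [CK]
    to [Coo].  A tail of a sequence of polynomials is again such a sequence. *)

Set Implicit Arguments.
Unset Strict Implicit.
Unset Printing Implicit Defensive.

Import Order.TTheory GRing.Theory Num.Theory.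
Import numFieldNormedType.Exports.

Local Open Scope classical_set_scope.
Local Open Scope complex_scope.
Local Open Scope ring_scope.

(** * Modulus and exponential of complex numbers *)

Section complex_numbers.
Context {R : realType}.
Implicit Types (z w : R[i]) (x y : R).

Lemma cmodE z : (cmod z)%:C = `|z|.
Proof. by rewrite normc_def; case: z. Qed.

Lemma cmod_ge0 z : 0 <= cmod z.
Proof. by case: z => a b; exact: sqrtr_ge0. Qed.

Lemma cmod_sqr z : cmod z ^+ 2 = complex.Re z ^+ 2 + complex.Im z ^+ 2.
Proof. by case: z => a b; rewrite sqr_sqrtr// addr_ge0// sqr_ge0. Qed.

Lemma cmodM z w : cmod (z * w) = cmod z * cmod w.
Proof. exact: ComplexField.Normc.normcM. Qed.

Lemma cmodV z : cmod z^-1 = (cmod z)^-1.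
Proof. exact: ComplexField.Normc.normcV. Qed.

Lemma cmodN z : cmod (- z) = cmod z.
Proof. exact: normcN. Qed.

Lemma cmodD z w : cmod (z + w) <= cmod z + cmod w.
Proof. exact: le_normcD. Qed.

Lemma cmodBC z w : cmod (z - w) = cmod (w - z).
Proof. by rewrite -cmodN opprB. Qed.

(** [^*] is the conjugation of the numeric structure of [R[i]]; unfolding it
    to [conjc] lets it compute on real and imaginary parts. *)
Lemma conjcE z : z^* = conjc z. Proof. by []. Qed.

Lemma ler_dist_cmod z w : `|cmod z - cmod w| <= cmod (z - w).
Proof.
have h (a b : R[i]) : cmod a - cmod b <= cmod (a - b).
  by have := cmodD (a - b) b; rewrite subrK -lerBlDr.
have := h z w; have := h w z; rewrite [cmod (w - z)]cmodBC => h1 h2.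
by rewrite ler_norml h2 andbT lerNl opprB.
Qed.

Lemma cmodJ z : cmod z^* = cmod z.
Proof. by rewrite conjcE; case: z => a b; rewrite /cmod/= sqrrN. Qed.

Lemma cmodR x : cmod x%:C = `|x|.
Proof. by rewrite /cmod/= expr0n addr0 sqrtr_sqr. Qed.

Lemma cmod0 : cmod (0 : R[i]) = 0. Proof. exact: ComplexField.Normc.normc0. Qed.
Lemma cmod1 : cmod (1 : R[i]) = 1. Proof. exact: ComplexField.Normc.normc1. Qed.

Lemma cmod_eq0 z : (cmod z == 0) = (z == 0).
Proof.
apply/eqP/eqP => [|->]; [exact: ComplexField.Normc.eq0_normc|exact: cmod0].
Qed.

Lemma cmod_gt0 z : (0 < cmod z) = (z != 0).
Proof. by rewrite lt_neqAle cmod_ge0 andbT eq_sym cmod_eq0. Qed.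

Lemma cmodX z n : cmod (z ^+ n) = cmod z ^+ n.
Proof. by elim: n => [|n ih]; rewrite ?cmod1// !exprS cmodM ih. Qed.


Lemma cmod_sum (I : Type) (r : seq I) (F : I -> R[i]) :
  cmod (\sum_(i <- r) F i) <= \sum_(i <- r) cmod (F i).
Proof.
elim/big_rec2: _ => [|i y1 y2 _ h]; first by rewrite cmod0.
by apply: le_trans (cmodD _ _) _; rewrite lerD2l.
Qed.

Lemma ler_Re_cmod z : `|complex.Re z| <= cmod z.
Proof. by rewrite -lecR cmodE; exact: normc_ge_Re. Qed.

Lemma ler_Im_cmod z : `|complex.Im z| <= cmod z.
Proof.
by case: z => a b; rewrite -sqrtr_sqr; apply: ler_wsqrtr; rewrite /= lerDr sqr_ge0.
Qed.

Lemma cmod_le_ReIm z : cmod z <= `|complex.Re z| + `|complex.Im z|.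
Proof.
rewrite -(ler_pXn2r (ltn0Sn 1)) ?nnegrE ?cmod_ge0 ?addr_ge0//.
rewrite cmod_sqr sqrrD !real_normK ?num_real//.
by rewrite addrAC lerDl mulrn_wge0// mulr_ge0.
Qed.

Lemma mul_conj_cmod z : z * z^* = (cmod z ^+ 2)%:C.
Proof. by rewrite rmorphXn/= cmodE normCK. Qed.


Lemma cmod_expi x : cmod (expi x) = 1.
Proof. by rewrite /cmod/= cos2Dsin2 sqrtr1. Qed.

Lemma expi_neq0 x : expi x != 0.
Proof. by rewrite -cmod_gt0 cmod_expi. Qed.

Lemma expiD x y : expi (x + y) = expi x * expi y.
Proof.
rewrite /expi cosD sinD; simpc; congr (_ +i* _).
by rewrite addrC [cos x * _]mulrC [sin x * _]mulrC addrC.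
Qed.

Lemma expi0 : expi (0 : R) = 1.
Proof. by rewrite /expi cos0 sin0. Qed.

Lemma expiX x n : expi x ^+ n = expi (x *+ n).
Proof. by elim: n => [|n ih]; rewrite ?expi0// exprS ih mulrS expiD. Qed.

Lemma expiV x : (expi x)^-1 = (expi x)^*.
Proof.
apply: (mulfI (expi_neq0 x)); rewrite mulfV ?expi_neq0// mul_conj_cmod cmod_expi.
by rewrite expr1n.
Qed.

Lemma cexpD z w : cexp (z + w) = cexp z * cexp w.
Proof.
case: z w => a b [c d]; rewrite /cexp/= expRD expiD rmorphM/=.
by rewrite mulrACA.
Qed.

Lemma cexp0 : cexp (0 : R[i]) = 1.
Proof. by rewrite /cexp/= expR0 expi0 mulr1. Qed.

Lemma cmod_cexp z : cmod (cexp z) = expR (complex.Re z).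
Proof. by rewrite /cexp cmodM cmodR cmod_expi mulr1 ger0_norm ?expR_ge0. Qed.

Lemma cexpX z n : cexp (z *+ n) = cexp z ^+ n.
Proof. by elim: n => [|n ih]; rewrite ?cexp0// exprS -ih mulrS cexpD. Qed.

Lemma cReD z w : complex.Re (z + w) = complex.Re z + complex.Re w.
Proof. by case: z; case: w. Qed.
Lemma cImD z w : complex.Im (z + w) = complex.Im z + complex.Im w.
Proof. by case: z; case: w. Qed.
Lemma cReM z w : complex.Re (z * w) =
  complex.Re z * complex.Re w - complex.Im z * complex.Im w.
Proof. by case: z; case: w. Qed.
Lemma cImM z w : complex.Im (z * w) =
  complex.Re z * complex.Im w + complex.Im z * complex.Re w.
Proof. by case: z => a b; case: w => c d /=; rewrite [b * c]mulrC. Qed.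
Lemma cReN z : complex.Re (- z) = - complex.Re z. Proof. by case: z. Qed.
Lemma cImN z : complex.Im (- z) = - complex.Im z. Proof. by case: z. Qed.

Lemma cRe_sum (I : Type) (r : seq I) (F : I -> R[i]) :
  complex.Re (\sum_(i <- r) F i) = \sum_(i <- r) complex.Re (F i).
Proof. by elim/big_rec2: _ => // i y1 y2 _ <-; rewrite cReD. Qed.
Lemma cIm_sum (I : Type) (r : seq I) (F : I -> R[i]) :
  complex.Im (\sum_(i <- r) F i) = \sum_(i <- r) complex.Im (F i).
Proof. by elim/big_rec2: _ => // i y1 y2 _ <-; rewrite cImD. Qed.
Lemma cReZ x z : complex.Re (x%:C * z) = x * complex.Re z.
Proof. by rewrite cReM /= mul0r subr0. Qed.
Lemma cImZ x z : complex.Im (x%:C * z) = x * complex.Im z.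
Proof. by rewrite cImM /= mul0r addr0. Qed.

Lemma one_sub_neq0 z : cmod z < 1 -> 1 - z != 0.
Proof.
by move=> z1; apply/eqP => /subr0_eq h; move: z1; rewrite -h cmod1 ltxx.
Qed.

End complex_numbers.

(** * Integrals of bounded measurable functions on the circle *)

Section bounded_measurable.
Context {R : realType}.
Implicit Types (f g : R -> R) (u v : R -> R[i]).

(** Boundedness is asked everywhere, not almost everywhere, so that all the
    integrals below are finite and linear without side conditions. *)
Definition bmeas f :=
  measurable_fun setT f /\ exists M, forall x, `|f x| <= M.

Lemma bmeas_cst (c : R) : bmeas (fun=> c).
Proof. by split; [exact: measurable_cst|exists `|c|]. Qed.

Lemma bmeasD f g : bmeas f -> bmeas g -> bmeas (fun x => f x + g x).
Proof.
move=> [mf [M fM]] [mg [N gN]]; split; first exact: measurable_funD.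
by exists (M + N) => x; apply: le_trans (ler_normD _ _) _; exact: lerD.
Qed.

Lemma bmeasM f g : bmeas f -> bmeas g -> bmeas (fun x => f x * g x).
Proof.
move=> [mf [M fM]] [mg [N gN]]; split; first exact: measurable_funM.
by exists (M * N) => x; rewrite normrM; exact: ler_pM.
Qed.

Lemma bmeasZ (c : R) f : bmeas f -> bmeas (fun x => c * f x).
Proof. by move=> bf; exact: (bmeasM (bmeas_cst c)). Qed.

Lemma bmeasN f : bmeas f -> bmeas (fun x => - f x).
Proof.
move=> bf; have := bmeasZ (-1) bf; congr bmeas; apply/funext => x.
by rewrite mulN1r.
Qed.

Lemma bmeasB f g : bmeas f -> bmeas g -> bmeas (fun x => f x - g x).
Proof. by move=> bf bg; apply: bmeasD => //; exact: bmeasN. Qed.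

Lemma bmeas_norm f : bmeas f -> bmeas (fun x => `|f x|).
Proof.
move=> [mf [M fM]]; split; first exact: measurableT_comp.
by exists M => x; rewrite normr_id.
Qed.

Lemma bmeasX f n : bmeas f -> bmeas (fun x => f x ^+ n).
Proof.
move=> bf; elim: n => [|n ih]; first exact: bmeas_cst.
have := bmeasM bf ih; congr bmeas; apply/funext => x; by rewrite exprS.
Qed.

Lemma bmeas_sum (I : Type) (r : seq I) (F : I -> R -> R) :
  (forall i, bmeas (F i)) -> bmeas (fun x => \sum_(i <- r) F i x).
Proof.
move=> bF; elim: r => [|i r ih].
  have := bmeas_cst 0; congr bmeas; apply/funext => x; by rewrite big_nil.
have := bmeasD (bF i) ih; congr bmeas; apply/funext => x; by rewrite big_cons.
Qed.

Lemma bmeas_powR f s : (forall x, 0 <= f x) -> 0 <= s -> bmeas f ->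
  bmeas (fun x => f x `^ s).
Proof.
move=> f0 s0 [mf [M fM]]; split.
  exact: (measurableT_comp (measurable_powR s) mf).
exists (M `^ s) => x; rewrite ger0_norm ?powR_ge0//.
have fxM : f x <= M by apply: le_trans (fM x); exact: ler_norm.
by apply: ge0_ler_powR => //; rewrite nnegrE ?(le_trans (f0 x)).
Qed.

Lemma haarT : haar [set: R] = 1%E.
Proof. exact: probability_setT. Qed.

Lemma bmeas_integrable f : bmeas f -> haar.-integrable setT (EFin \o f).
Proof.
move=> [mf [M fM]]; apply: measurable_bounded_integrable => //.
  by rewrite [X in (X < _)%E]haarT ltry.
exists M; split; first exact: num_real.
by move=> y My x _; apply: le_trans (fM x) (ltW My).
Qed.

Local Notation I f := (\int[haar]_x f x).

Lemma haar_EFin f : bmeas f ->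
  (\int[haar]_x (f x)%:E = (I f)%:E)%E.
Proof.
move=> bf; rewrite /Rintegral fineK//.
exact: (integrable_fin_num measurableT (bmeas_integrable bf)).
Qed.

Lemma haar_cst (c : R) : \int[haar]_x c = c.
Proof. by rewrite Rintegral_cst// [X in fine X]haarT mulr1. Qed.

Lemma haarD f g : bmeas f -> bmeas g ->
  \int[haar]_x (f x + g x) = I f + I g.
Proof. by move=> bf bg; rewrite RintegralD//; exact: bmeas_integrable. Qed.

Lemma haarB f g : bmeas f -> bmeas g ->
  \int[haar]_x (f x - g x) = I f - I g.
Proof. by move=> bf bg; rewrite RintegralB//; exact: bmeas_integrable. Qed.

Lemma haarZ (c : R) f : bmeas f -> \int[haar]_x (c * f x) = c * I f.
Proof. by move=> bf; rewrite RintegralZl//; exact: bmeas_integrable. Qed.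

Lemma haarN f : bmeas f -> \int[haar]_x (- f x) = - I f.
Proof.
move=> bf; rewrite -mulN1r -haarZ//; congr (Rintegral _ _ _).
by apply/funext => x; rewrite mulN1r.
Qed.

Lemma haar_le f g : bmeas f -> bmeas g -> (forall x, f x <= g x) -> I f <= I g.
Proof.
by move=> bf bg fg; apply: le_Rintegral => //; exact: bmeas_integrable.
Qed.

Lemma haar_norm f : bmeas f -> `|I f| <= \int[haar]_x `|f x|.
Proof. by move=> bf; apply: le_normr_Rintegral => //; exact: bmeas_integrable. Qed.

Lemma haar_bound f M : bmeas f -> (forall x, `|f x| <= M) -> `|I f| <= M.
Proof.
move=> bf fM; apply: le_trans (haar_norm bf) _; rewrite -(haar_cst M).
by apply: haar_le => //; [exact: bmeas_norm|exact: bmeas_cst].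
Qed.

Lemma haar_sum (J : Type) (r : seq J) (F : J -> R -> R) :
  (forall i, bmeas (F i)) ->
  \int[haar]_x (\sum_(i <- r) F i x) = \sum_(i <- r) I (F i).
Proof.
move=> bF; elim: r => [|i r ih].
  rewrite big_nil -[RHS](haar_cst 0); congr (Rintegral _ _ _).
  by apply/funext => x; rewrite big_nil.
rewrite big_cons -ih -haarD//; last exact: bmeas_sum.
by congr (Rintegral _ _ _); apply/funext => x; rewrite big_cons.
Qed.

Definition cbmeas u :=
  bmeas (fun x => complex.Re (u x)) /\ bmeas (fun x => complex.Im (u x)).

Lemma cbmeas_cst (c : R[i]) : cbmeas (fun=> c).
Proof. by split; exact: bmeas_cst. Qed.

Lemma cbmeasD u v : cbmeas u -> cbmeas v -> cbmeas (fun x => u x + v x).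
Proof.
move=> [u1 u2] [v1 v2]; split.
  by have := bmeasD u1 v1; congr bmeas; apply/funext => x; rewrite cReD.
by have := bmeasD u2 v2; congr bmeas; apply/funext => x; rewrite cImD.
Qed.

Lemma cbmeasM u v : cbmeas u -> cbmeas v -> cbmeas (fun x => u x * v x).
Proof.
move=> [u1 u2] [v1 v2]; split.
  have := bmeasB (bmeasM u1 v1) (bmeasM u2 v2).
  by congr bmeas; apply/funext => x; rewrite cReM.
have := bmeasD (bmeasM u1 v2) (bmeasM u2 v1).
by congr bmeas; apply/funext => x; rewrite cImM.
Qed.

Lemma cbmeasB u v : cbmeas u -> cbmeas v -> cbmeas (fun x => u x - v x).
Proof.
move=> bu bv; have := cbmeasD bu (cbmeasM (cbmeas_cst (-1)) bv).
by congr cbmeas; apply/funext => x; rewrite mulN1r.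
Qed.

Lemma cbmeasJ u : cbmeas u -> cbmeas (fun x => (u x)^*).
Proof.
move=> [u1 u2]; split.
  by move: u1; congr bmeas; apply/funext => x; case: (u x).
by have := bmeasN u2; congr bmeas; apply/funext => x; case: (u x).
Qed.

Lemma cbmeasR f : bmeas f -> cbmeas (fun x => (f x)%:C).
Proof. by move=> bf; split => //=; exact: bmeas_cst. Qed.

Lemma cbmeas_cmod u : cbmeas u -> bmeas (fun x => cmod (u x)).
Proof.
move=> [u1 u2].
have : bmeas (fun x => (complex.Re (u x) ^+ 2 + complex.Im (u x) ^+ 2) `^ 2^-1).
  apply: bmeas_powR; last exact: bmeasD (bmeasX 2 u1) (bmeasX 2 u2).
    by move=> x; rewrite addr_ge0// sqr_ge0.
  by rewrite invr_ge0.
congr bmeas; apply/funext => x; rewrite powR12_sqrt ?addr_ge0 ?sqr_ge0//.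
by rewrite -cmod_sqr sqrtr_sqr ger0_norm ?cmod_ge0.
Qed.

Lemma cbmeas_expi : cbmeas (@expi R).
Proof.
split; split.
- by apply: continuous_measurable_fun; exact: continuous_cos.
- by exists 1 => x; rewrite -(cmod_expi x); exact: ler_Re_cmod.
- by apply: continuous_measurable_fun; exact: continuous_sin.
- by exists 1 => x; rewrite -(cmod_expi x); exact: ler_Im_cmod.
Qed.

Lemma cbmeas_horner (P : {poly R[i]}) : cbmeas (fun x => P.[expi x]).
Proof.
elim/poly_ind: P => [|P c ih].
  have := cbmeas_cst 0; congr cbmeas; apply/funext => x; by rewrite horner0.
have := cbmeasD (cbmeasM ih cbmeas_expi) (cbmeas_cst c).
by congr cbmeas; apply/funext => x; rewrite hornerMXaddC.
Qed.


Lemma cintegral_cst (c : R[i]) : cintegral (fun=> c) = c.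
Proof. by rewrite /cintegral !haar_cst; case: c. Qed.

Lemma cintegralR f : cintegral (fun x => (f x)%:C) = (I f)%:C.
Proof. by rewrite /cintegral /= haar_cst. Qed.

Lemma cintegralD u v : cbmeas u -> cbmeas v ->
  cintegral (fun x => u x + v x) = cintegral u + cintegral v.
Proof.
move=> [u1 u2] [v1 v2]; rewrite /cintegral.
under eq_Rintegral do rewrite cReD.
under [X in _ +i* X]eq_Rintegral do rewrite cImD.
by rewrite !haarD.
Qed.

Lemma cintegralZ (c : R[i]) u : cbmeas u ->
  cintegral (fun x => c * u x) = c * cintegral u.
Proof.
move=> [u1 u2]; rewrite /cintegral.
under eq_Rintegral do rewrite cReM.
under [X in _ +i* X]eq_Rintegral do rewrite cImM.
rewrite haarB ?haarD ?haarZ//; try exact: bmeasZ.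
by case: c => a b /=; simpc; congr (_ +i* _); rewrite addrC.
Qed.

Lemma cintegralJ u : cbmeas u ->
  cintegral (fun x => (u x)^*) = (cintegral u)^*.
Proof.
move=> [u1 u2]; rewrite conjcE /cintegral /= -haarN//; congr (_ +i* _).
  by congr (Rintegral _ _ _); apply/funext => x; case: (u x).
by congr (Rintegral _ _ _); apply/funext => x; case: (u x).
Qed.

Lemma cintegralB u v : cbmeas u -> cbmeas v ->
  cintegral (fun x => u x - v x) = cintegral u - cintegral v.
Proof.
move=> bu bv; rewrite -[in RHS]mulN1r -cintegralZ// -cintegralD//; last first.
  exact: cbmeasM (cbmeas_cst _) bv.
by congr cintegral; apply/funext => x; rewrite mulN1r.
Qed.

(** The factor 2 comes from bounding the real and the imaginary part
    separately; only the linear dependence on [M] matters for the passages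
    to the limit. *)
Lemma cintegral_bound u M : cbmeas u -> (forall x, cmod (u x) <= M) ->
  cmod (cintegral u) <= 2 * M.
Proof.
move=> [u1 u2] uM; rewrite mulrDl mul1r; apply: le_trans (cmod_le_ReIm _) _.
apply: lerD; apply: haar_bound => // x; apply: le_trans (uM x).
  exact: ler_Re_cmod.
exact: ler_Im_cmod.
Qed.

Lemma cbmeas_cmeasurable u : cbmeas u -> cmeasurable u.
Proof. by case=> [[? _] [? _]]; split. Qed.

(** Elements of the disc algebra are only known through approximations, so
    their measurability is that of a pointwise limit and their boundedness
    that of one approximation. *)
Lemma cbmeas_uniform_limit u :
  (forall e, 0 < e -> exists2 v, cbmeas v & forall x, cmod (u x - v x) <= e) ->
  cbmeas u.
Proof.
move=> happ.
have e0 n : 0 < n.+1%:R^-1 :> R by [].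
have /choice[v vP] : forall n, exists v : R -> R[i], cbmeas v /\
    forall x, cmod (u x - v x) <= n.+1%:R^-1.
  by move=> n; have [v ? ?] := happ _ (e0 n); exists v.
have cvgR (a : R) (b : nat -> R) : (forall n, `|a - b n| <= n.+1%:R^-1) ->
    b n @[n --> \oo] --> a.
  move=> ab; apply/cvgrPdist_le => e e1.
  have := @cvg_harmonic R; move=> /cvgrPdist_le/(_ e e1)[N _ HN].
  exists N => // n Nn; apply: le_trans (ab n) _.
  have := HN n Nn; by rewrite /= sub0r normrN ger0_norm.
have [[bM0 uM0] _] := vP 0%N.
split; split.
- apply: (@measurable_fun_cvg _ _ _ setT (fun n x => complex.Re (v n x))).
    by move=> n; case: (vP n) => -[[]].
  move=> x _; apply: cvgR => n; have [_ /(_ x)] := vP n.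
  by apply: le_trans; rewrite -cReN -cReD; exact: ler_Re_cmod.
- have [_ [B HB]] := bM0; exists (1 + B) => x.
  rewrite -[complex.Re (u x)](subrK (complex.Re (v 0%N x))).
  apply: le_trans (ler_normD _ _) (lerD _ (HB x)).
  rewrite -cReN -cReD; apply: le_trans (ler_Re_cmod _) _.
  by have [_ /(_ x)] := vP 0%N; rewrite invr1.
- apply: (@measurable_fun_cvg _ _ _ setT (fun n x => complex.Im (v n x))).
    by move=> n; case: (vP n) => -[_ []].
  move=> x _; apply: cvgR => n; have [_ /(_ x)] := vP n.
  by apply: le_trans; rewrite -cImN -cImD; exact: ler_Im_cmod.
- have [_ [B HB]] := uM0; exists (1 + B) => x.
  rewrite -[complex.Im (u x)](subrK (complex.Im (v 0%N x))).
  apply: le_trans (ler_normD _ _) (lerD _ (HB x)).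
  rewrite -cImN -cImD; apply: le_trans (ler_Im_cmod _) _.
  by have [_ /(_ x)] := vP 0%N; rewrite invr1.
Qed.

(** A derivative of a periodic function has integral zero. The integral of a
    uniform law is computed for nonnegative functions, whence the shift by
    [m]. *)
Lemma haar_derivative (F f : R -> R) (m : R) : bmeas f -> (forall x, -m <= f x) ->
  (forall x : R, is_derive x (1 : R) F (f x)) -> continuous f ->
  F (2 * pi) = F 0 -> I f = 0.
Proof.
move=> bf f0 dF cf Fp.
have bfm : bmeas (fun x => f x + m) by exact: bmeasD bf (bmeas_cst m).
suff : \int[haar]_x (f x + m) = m.
  rewrite haarD// ?haar_cst; last exact: bmeas_cst.
  by move/eqP; rewrite addrC -subr_eq0 addrAC subrr add0r => /eqP.
apply: EFin_inj; rewrite -haar_EFin//.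
rewrite [LHS](integral_uniform (twopi_gt0 (R := R))); last 2 first.
  by apply/measurable_EFinP; case: bfm.
  by move=> x; rewrite lee_fin -lerBlDr sub0r.
have dG (x : R) : is_derive x 1 (fun x => F x + m * x) (f x + m).
  apply: is_deriveD; apply: is_derive_eq; by rewrite -[RHS]mulr1.
rewrite (continuous_FTC2 (F := fun x => F x + m * x)).
- rewrite Fp -EFinB -EFinM; congr EFin.
  have : 2 * pi != 0 :> R by rewrite gt_eqF// twopi_gt0.
  rewrite !subr0 mulr0 addr0 [F 0 + _]addrC addrK => p0.
  by rewrite mulrC -mulrA mulfV// mulr1.
- exact: twopi_gt0.
- apply: continuous_subspaceT => x; apply: cvgD; first exact: cf.
  exact: cvg_cst.
- have cG : continuous (fun x => F x + m * x).
    by move=> x; apply: differentiable_continuous; apply/derivable1_diffP; case: (dG x).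
  split.
  + by move=> x _; case: (dG x).
  + by apply: cvg_at_right_filter; exact: cG.
  + by apply: cvg_at_left_filter; exact: cG.
- by move=> x _; rewrite derive1E; case: (dG x).
Qed.

End bounded_measurable.

(** * The disc algebra: mean value, Poisson and Schwarz formulas *)

Section disc_algebra.
Context {R : realType}.
Implicit Types (F G : R[i] -> R[i]) (z w b : R[i]).

(** Derivatives come out of the calculus as expressions that agree with the
    wanted ones only up to extensional equality and algebra. *)
Lemma is_derive_congr (f g : R -> R) (x a b : R) :
  is_derive x 1 f a -> f =1 g -> a = b -> is_derive x 1 g b.
Proof. by move=> df fg <-; rewrite -(_ : f = g)//; exact/funext. Qed.

(** The disc algebra, as the uniform closure of the polynomials on the closed
    disc. *)
Definition disc_alg F := forall e : R, 0 < e ->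
  exists P : {poly R[i]}, forall z, cmod z <= 1 -> cmod (F z - P.[z]) <= e.

Lemma disc_alg_poly (P : {poly R[i]}) : disc_alg (fun z => P.[z]).
Proof. by move=> e e0; exists P => z _; rewrite subrr cmod0 ltW. Qed.

Lemma disc_alg_cst (c : R[i]) : disc_alg (fun=> c).
Proof.
have := disc_alg_poly c%:P; congr disc_alg; apply/funext => z.
by rewrite hornerC.
Qed.

Lemma disc_alg_id : disc_alg id.
Proof.
have := disc_alg_poly 'X; congr disc_alg; apply/funext => z.
by rewrite hornerX.
Qed.

Lemma poly_disc_bounded (P : {poly R[i]}) :
  exists2 M : R, 0 <= M & forall z, cmod z <= 1 -> cmod P.[z] <= M.
Proof.
elim/poly_ind: P => [|P c [M M0 PM]].
  by exists 0 => // z _; rewrite horner0 cmod0.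
exists (M + cmod c); first by rewrite addr_ge0 ?cmod_ge0.
move=> z z1; rewrite hornerMXaddC; apply: le_trans (cmodD _ _) _.
rewrite lerD2r cmodM -[M]mulr1; apply: ler_pM => //; try exact: cmod_ge0.
exact: PM.
Qed.

Lemma disc_alg_bounded F : disc_alg F ->
  exists2 M : R, 0 <= M & forall z, cmod z <= 1 -> cmod (F z) <= M.
Proof.
move=> /(_ 1 ltr01)[P FP]; have [M M0 PM] := poly_disc_bounded P.
exists (1 + M); first by rewrite addr_ge0.
move=> z z1; rewrite -(subrK P.[z] (F z)).
by apply: le_trans (cmodD _ _) (lerD (FP z z1) (PM z z1)).
Qed.

Lemma disc_alg_lim F :
  (forall e, 0 < e -> exists2 G, disc_alg G &
    forall z, cmod z <= 1 -> cmod (F z - G z) <= e) -> disc_alg F.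
Proof.
move=> h e e0; have e2 : 0 < e / 2 by rewrite divr_gt0.
have [G dG FG] := h _ e2; have [P GP] := dG _ e2.
exists P => z z1; have -> : F z - P.[z] = (F z - G z) + (G z - P.[z]).
  by rewrite addrA subrK.
by apply: le_trans (cmodD _ _) _; rewrite [leRHS]splitr lerD ?FG ?GP.
Qed.

Lemma disc_alg_ext F G : (forall z, cmod z <= 1 -> F z = G z) ->
  disc_alg F -> disc_alg G.
Proof.
move=> FG dF e e0; have [P FP] := dF e e0.
by exists P => z z1; rewrite -FG// FP.
Qed.

Lemma disc_algD F G : disc_alg F -> disc_alg G ->
  disc_alg (fun z => F z + G z).
Proof.
move=> dF dG e e0; have e2 : 0 < e / 2 by rewrite divr_gt0.
have [P FP] := dF _ e2; have [Q GQ] := dG _ e2.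
exists (P + Q) => z z1; rewrite hornerD opprD addrACA.
by apply: le_trans (cmodD _ _) _; rewrite [leRHS]splitr lerD ?FP ?GQ.
Qed.

(** The second function is approximated first, by [Q] within a tolerance
    that depends on the bound [M] of the first function; the tolerance for
    the first function then depends on the bound [N] of [Q]. *)
Lemma disc_algM F G : disc_alg F -> disc_alg G ->
  disc_alg (fun z => F z * G z).
Proof.
move=> dF dG e e0; have [M M0 FM] := disc_alg_bounded dF.
have e1 : 0 < e / 2 / (M + 1) by rewrite !divr_gt0// ltr_wpDl.
have [Q GQ] := dG _ e1; have [N N0 QN] := poly_disc_bounded Q.
have e2 : 0 < e / 2 / (N + 1) by rewrite !divr_gt0// ltr_wpDl.
have [P FP] := dF _ e2.
exists (P * Q) => z z1.
have -> : F z * G z - (P * Q).[z] = F z * (G z - Q.[z]) + (F z - P.[z]) * Q.[z].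
  by rewrite hornerM; ring.
apply: le_trans (cmodD _ _) _; rewrite [leRHS]splitr !cmodM; apply: lerD.
  apply: le_trans (_ : (M + 1) * (e / 2 / (M + 1)) <= _).
    apply: ler_pM; rewrite ?cmod_ge0 ?GQ//.
    by apply: le_trans (FM z z1) _; rewrite lerDl.
  by rewrite mulrC divfK// gt_eqF// ltr_wpDl.
apply: le_trans (_ : (e / 2 / (N + 1)) * (N + 1) <= _).
  apply: ler_pM; rewrite ?cmod_ge0 ?FP//.
  by apply: le_trans (QN z z1) _; rewrite lerDl.
by rewrite divfK// gt_eqF// ltr_wpDl.
Qed.

Lemma disc_algZ (c : R[i]) F : disc_alg F -> disc_alg (fun z => c * F z).
Proof. by move=> dF; apply: disc_algM => //; exact: disc_alg_cst. Qed.

Lemma disc_algX F n : disc_alg F -> disc_alg (fun z => F z ^+ n).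
Proof.
move=> dF; elim: n => [|n ih]; first exact: disc_alg_cst.
by apply: disc_alg_ext (disc_algM dF ih) => z _; rewrite exprS.
Qed.

Lemma disc_alg_sum (J : Type) (r : seq J) (F : J -> R[i] -> R[i]) :
  (forall j, disc_alg (F j)) -> disc_alg (fun z => \sum_(j <- r) F j z).
Proof.
move=> dF; elim: r => [|i r ih].
  by apply: disc_alg_ext (disc_alg_cst 0) => z _; rewrite big_nil.
by apply: disc_alg_ext (disc_algD (dF i) ih) => z _; rewrite big_cons.
Qed.

Lemma cmod_le1M b z : cmod z <= 1 -> cmod (b * z) <= cmod b.
Proof. by move=> z1; rewrite cmodM ler_piMr// cmod_ge0. Qed.

Lemma expr_mul_le (rho C : R) : 0 <= rho < 1 -> forall e, 0 < e ->
  exists n, rho ^+ n * C <= e.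
Proof.
move=> /andP[r0 r1] e e0.
have : rho ^+ n * C @[n --> \oo] --> 0 * C.
  by apply: cvgMl; apply: cvg_expr; rewrite ger0_norm.
rewrite mul0r => /cvgrPdist_le/(_ e e0)[N _ HN]; exists N.
have := HN N (leqnn N); rewrite /= sub0r normrN; apply: le_trans.
exact: ler_norm.
Qed.

(** The geometric series converges uniformly, because [cmod (b * z)] stays
    below [cmod b] on the closed disc. *)
Lemma disc_alg_inv b : cmod b < 1 -> disc_alg (fun z => (1 - b * z)^-1).
Proof.
move=> b1; apply: disc_alg_lim => e e0.
have b01 : 0 <= cmod b < 1 by rewrite cmod_ge0.
have [n Hn] := expr_mul_le (1 - cmod b)^-1 b01 e0.
exists (fun z => \sum_(k < n) (b * z) ^+ k).
  apply: disc_alg_sum => k; apply: disc_algX; apply: disc_algZ.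
  exact: disc_alg_id.
move=> z z1; apply: le_trans Hn.
have bz : cmod (b * z) <= cmod b by exact: cmod_le1M.
have nz : 1 - b * z != 0 by apply: one_sub_neq0; exact: le_lt_trans bz b1.
have -> : (1 - b * z)^-1 - \sum_(k < n) (b * z) ^+ k = (b * z) ^+ n / (1 - b * z).
  apply: (mulIf nz); rewrite mulrBl mulVf// divfK//.
  rewrite -(subrK 1 ((b * z) ^+ n)) subrX1; ring.
rewrite cmodM cmodV cmodX; apply: ler_pM; rewrite ?invr_ge0 ?cmod_ge0 ?exprn_ge0 ?cmod_ge0//.
  by apply: lerXn2r; rewrite ?nnegrE ?cmod_ge0.
rewrite lef_pV2 ?posrE ?subr_gt0 ?cmod_gt0//.
rewrite lerBlDr; apply: le_trans (lerD (lexx _) bz).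
by rewrite -{1}cmod1 -{1}(subrK (b * z) 1) cmodD.
Qed.

Lemma cbmeas_disc_alg F : disc_alg F -> cbmeas (fun x => F (expi x)).
Proof.
move=> dF; apply: cbmeas_uniform_limit => e e0.
have [P FP] := dF e e0; exists (fun x => P.[expi x]).
  exact: cbmeas_horner.
by move=> x; apply: FP; rewrite cmod_expi.
Qed.

Lemma cintegral_expiX n : cintegral (fun x => expi x ^+ n.+1 : R[i]) = 0.
Proof.
have n0 : n.+1%:R != 0 :> R by [].
have e2pi : expi (2 * pi) ^+ n.+1 = 1 :> R[i].
  by rewrite mulr_natl /expi cos2pi sin2pi expr1n.
have bX : cbmeas (fun x => expi x ^+ n.+1 : R[i]).
  have := cbmeas_horner ('X^(n.+1) : {poly R[i]}); congr cbmeas.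
  by apply/funext => x; rewrite hornerXn.
have nE (x : R) : x *+ n.+1 = n.+1%:R * x by rewrite mulr_natl.
have dn (x : R) : is_derive x 1 (fun x => x *+ n.+1 : R) n.+1%:R.
  rewrite (_ : (fun x => _) = (fun x => n.+1%:R * x)); last first.
    by apply/funext => y; rewrite nE.
  by apply: is_derive_eq; rewrite -[RHS]mulr1.
have cn : continuous (fun x : R => x *+ n.+1).
  move=> x; apply: differentiable_continuous; apply/derivable1_diffP.
  by case: (dn x).
have [bc bs] := bX.
have cE (x : R) : complex.Re (expi x ^+ n.+1) = cos (x *+ n.+1) by rewrite expiX.
have sE (x : R) : complex.Im (expi x ^+ n.+1) = sin (x *+ n.+1) by rewrite expiX.
rewrite /cintegral; congr (_ +i* _).
  under eq_Rintegral do rewrite cE.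
  apply: (@haar_derivative _ (fun x => n.+1%:R^-1 * sin (x *+ n.+1)) _ 1).
  - by move: bc; congr bmeas; apply/funext => x; rewrite cE.
  - by move=> x; exact: cos_geN1.
  - move=> x; have := @is_derive1_comp _ sin (fun x : R => x *+ n.+1) x _ _ (is_derive_sin _) (dn x).
    move=> /(is_deriveZ n.+1%:R^-1)/is_derive_congr; apply => //.
    by rewrite -[LHS]/(n.+1%:R^-1 * (_ * _)) mulrCA mulVf// mulr1.
  - by move=> x; apply: (continuous_comp (cn x)); exact: continuous_cos.
  - by rewrite mul0rn sin0 -sE e2pi.
under eq_Rintegral do rewrite sE.
apply: (@haar_derivative _ (fun x => - n.+1%:R^-1 * cos (x *+ n.+1)) _ 1).
- by move: bs; congr bmeas; apply/funext => x; rewrite sE.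
- by move=> x; exact: sin_geN1.
- move=> x; have := @is_derive1_comp _ cos (fun x : R => x *+ n.+1) x _ _ (is_derive_cos _) (dn x).
  move=> /(is_deriveZ (- n.+1%:R^-1))/is_derive_congr; apply => //.
  rewrite -[LHS]/(- n.+1%:R^-1 * (- _ * _)); by field.
- by move=> x; apply: (continuous_comp (cn x)); exact: continuous_sin.
- by rewrite mul0rn cos0 -cE e2pi.
Qed.

(** Mean value property: a polynomial minus its constant term is a multiple
    of the variable, hence orthogonal to the constants. The induction needs
    orthogonality to all the negative characters at once. *)
Lemma cintegral_horner (P : {poly R[i]}) :
  cintegral (fun x => P.[expi x]) = P.[0].
Proof.
have H : forall (P : {poly R[i]}) k, cintegral (fun x => P.[expi x] * expi x ^+ k.+1) = 0.
  elim/poly_ind => [k|Q c ih k].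
    under eq_fun do rewrite horner0 mul0r.
    exact: cintegral_cst.
  under eq_fun do rewrite hornerMXaddC mulrDl -mulrA -exprS.
  have bX m : cbmeas (fun x => expi x ^+ m : R[i]).
    have := cbmeas_horner ('X^m : {poly R[i]}); congr cbmeas.
    by apply/funext => x; rewrite hornerXn.
  rewrite cintegralD ?cintegralZ ?ih ?cintegral_expiX ?mulr0 ?addr0//.
    by apply: cbmeasM => //; exact: cbmeas_horner.
  by apply: cbmeasM => //; exact: cbmeas_cst.
elim/poly_ind: P => [|P c _].
  under eq_fun do rewrite horner0.
  by rewrite cintegral_cst horner0.
under eq_fun do rewrite hornerMXaddC.
rewrite cintegralD; last 2 first.
  by apply: cbmeasM; [exact: cbmeas_horner|exact: cbmeas_expi].
  exact: cbmeas_cst.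
rewrite cintegral_cst hornerMXaddC mulr0; congr (_ + _).
by rewrite -[RHS](H P 0%N); congr cintegral; apply/funext => x; rewrite expr1.
Qed.

(** Integral formulas are extended from polynomials to the disc algebra up
    to an error that is arbitrarily small. *)
Lemma eq_cmod_le z w : (forall e, 0 < e -> cmod (z - w) <= e) -> z = w.
Proof.
move=> h; apply/eqP; rewrite -subr_eq0 -cmod_eq0 eq_le cmod_ge0 andbT.
by apply/ler_addgt0Pr => e e0; rewrite add0r h.
Qed.

Lemma disc_alg_mean F : disc_alg F -> cintegral (fun x => F (expi x)) = F 0.
Proof.
move=> dF; apply: eq_cmod_le => e e0.
have e3 : 0 < e / 3 by rewrite divr_gt0.
have [P FP] := dF _ e3.
have bF := cbmeas_disc_alg dF.
have -> : cintegral (fun x => F (expi x)) - F 0 =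
    cintegral (fun x => F (expi x) - P.[expi x]) - (F 0 - P.[0]).
  rewrite cintegralB//; last exact: cbmeas_horner.
  by rewrite cintegral_horner; ring.
apply: le_trans (cmodD _ _) _; rewrite cmodN.
have -> : e = 2 * (e / 3) + e / 3 by field.
apply: lerD; last by apply: FP; rewrite cmod0.
apply: cintegral_bound => [|x].
  by apply: cbmeasB => //; exact: cbmeas_horner.
by apply: FP; rewrite cmod_expi.
Qed.

(** On the circle the kernel is a rational function of the variable, since
    conjugation is inversion there. *)
Lemma poissonE z x : cmod z < 1 -> (poisson z x)%:C =
  (1 - (cmod z ^+ 2)%:C) / ((1 - z^* * expi x) * (1 - z * (expi x)^-1)) :> R[i].
Proof.
move=> z1; rewrite /poisson rmorphM rmorphB rmorph1 fmorphV; congr (_ * _^-1).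
rewrite -[LHS]/((cmod _ ^+ 2)%:C) -mul_conj_cmod expiV; congr (_ * _).
by rewrite rmorphB rmorph1 rmorphM/= conjCK.
Qed.

Lemma poisson_factor_neq0 z x : cmod z < 1 -> 1 - z^* * expi x != 0.
Proof. by move=> z1; apply: one_sub_neq0; rewrite cmodM cmod_expi cmodJ mulr1. Qed.

Lemma poisson_gt0 z x : cmod z < 1 -> 0 < poisson z x.
Proof.
move=> z1; rewrite divr_gt0 ?exprn_gt0 ?cmod_gt0 ?poisson_factor_neq0//.
by rewrite subr_gt0 expr_lt1 ?cmod_ge0.
Qed.

(** The function of the disc algebra whose real part is the Poisson kernel
    on the circle. *)
Definition herglotz z w := (1 + z^* * w) / (1 - z^* * w).

Lemma disc_alg_herglotz z : cmod z < 1 -> disc_alg (herglotz z).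
Proof.
move=> z1; apply: disc_algM; last by apply: disc_alg_inv; rewrite cmodJ.
apply: disc_algD; first exact: disc_alg_cst.
by apply: disc_algZ; exact: disc_alg_id.
Qed.

Lemma expi_sub_neq0 z x : cmod z < 1 -> expi x - z != 0.
Proof.
move=> z1; apply/eqP => /subr0_eq h.
by move: z1; rewrite -h cmod_expi ltxx.
Qed.

(** The kernel in the definition of outer functions is antianalytic on the
    circle. *)
Lemma herglotzJ z x : cmod z < 1 ->
  (herglotz z (expi x))^* = (expi x + z) / (expi x - z).
Proof.
move=> z1; have e0 := expi_neq0 x.
rewrite /herglotz rmorphM rmorphD rmorph1 rmorphM/= conjCK -expiV fmorphV.
rewrite rmorphB rmorph1 rmorphM/= conjCK -expiV.
have h' := expi_sub_neq0 x z1.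
by field; rewrite e0 h'.
Qed.

Lemma poisson_herglotz z x : cmod z < 1 ->
  herglotz z (expi x) + (herglotz z (expi x))^* = 2 * (poisson z x)%:C.
Proof.
move=> z1; rewrite herglotzJ// poissonE// /herglotz.
have e0 := expi_neq0 x.
have h := poisson_factor_neq0 x z1.
have h' := expi_sub_neq0 x z1.
rewrite -mul_conj_cmod; field; rewrite ?h ?h' ?e0//.
Qed.

Lemma poisson_Re_herglotz z x : cmod z < 1 ->
  poisson z x = complex.Re (herglotz z (expi x)).
Proof.
move=> z1; have := poisson_herglotz x z1.
case: (herglotz _ _) => a b; rewrite /= -complexr0; simpc.
move=> [/eqP]; rewrite -mulr2n -mulr_natl => /eqP /mulfI -> //.
Qed.

Lemma bmeas_poisson z : cmod z < 1 -> bmeas (poisson z).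
Proof.
move=> z1; have [] := cbmeas_disc_alg (disc_alg_herglotz z1).
by move=> + _; congr bmeas; apply/funext => x; rewrite poisson_Re_herglotz.
Qed.

Lemma haar_poisson z : cmod z < 1 -> \int[haar]_x poisson z x = 1.
Proof.
move=> z1; under eq_Rintegral do rewrite poisson_Re_herglotz//.
have := disc_alg_mean (disc_alg_herglotz z1).
by rewrite /herglotz mulr0 addr0 subr0 divr1 => -[].
Qed.

(** For a polynomial [P], write [P - P.[z]] as [('X - z) q]. The kernel
    times [expi x - z] is a multiple of [expi x / (1 - z^* * expi x)], so
    the Poisson integral of [P - P.[z]] is the mean of an element of the
    disc algebra that vanishes at [0]. *)
Lemma disc_ext_disc_alg F z : disc_alg F -> cmod z < 1 ->
  disc_ext (fun x => F (expi x)) z = F z.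
Proof.
move=> dF z1; rewrite /disc_ext; apply: eq_cmod_le => e e0.
have [_ [M PM]] := bmeas_poisson z1.
have M0 : 0 <= M by apply: le_trans (PM 0).
have bP := cbmeasR (bmeas_poisson z1).
pose d := e / (2 * M + 1).
have d0 : 0 < d by rewrite divr_gt0// ltr_wpDl// mulr_ge0.
have [P FP] := dF d d0.
have [q Pq] : exists q, P - P.[z]%:P = q * ('X - z%:P).
  by apply/factor_theorem; rewrite /root hornerD hornerN hornerC subrr.
have Pext : cintegral (fun x => (poisson z x)%:C * P.[expi x]) = P.[z].
  have /= := disc_alg_mean (disc_algM (disc_algZ (1 - (cmod z ^+ 2)%:C)
    (disc_algM disc_alg_id (disc_alg_poly q))) (disc_alg_inv (b := z^*) _)).
  rewrite cmodJ => /(_ z1); rewrite mul0r mulr0 mul0r => h.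
  have := cintegralD (cbmeasM bP (cbmeas_horner (P - P.[z]%:P)))
     (cbmeasM bP (cbmeas_cst P.[z])).
  under [in X in _ = _ + X]eq_fun do rewrite mulrC.
  rewrite (cintegralZ _ bP) cintegralR haar_poisson// mulr1.
  rewrite [X in _ = X + _](_ : _ = 0) ?add0r; last first.
    rewrite -[RHS]h; congr cintegral; apply/funext => x.
    rewrite Pq hornerM hornerXsubC poissonE//.
    have e1 := expi_neq0 x.
    have h1 := poisson_factor_neq0 x z1.
    have h' := expi_sub_neq0 x z1.
    by field; rewrite ?h1 ?h' ?e1.
  move=> <-; congr cintegral; apply/funext => x.
  by rewrite -mulrDr hornerD hornerN hornerC subrK.
have bF := cbmeas_disc_alg dF.
have bFP : cbmeas (fun x => F (expi x) - P.[expi x]).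
  by apply: cbmeasB => //; exact: cbmeas_horner.
have -> : cintegral (fun x => (poisson z x)%:C * F (expi x)) - F z =
    cintegral (fun x => (poisson z x)%:C * (F (expi x) - P.[expi x]))
    - (F z - P.[z]).
  suff -> : cintegral (fun x => (poisson z x)%:C * F (expi x)) =
      cintegral (fun x => (poisson z x)%:C * (F (expi x) - P.[expi x])) + P.[z].
    by ring.
  rewrite -[in RHS]Pext -cintegralD.
  - by congr cintegral; apply/funext => x; rewrite -mulrDr subrK.
  - exact: cbmeasM.
  - by apply: cbmeasM => //; exact: cbmeas_horner.
apply: le_trans (cmodD _ _) _; rewrite cmodN.
apply: le_trans (_ : 2 * (M * d) + d <= _); last first.
  by rewrite mulrA -[X in _ + X]mul1r -mulrDl mulrC divfK// gt_eqF// ltr_wpDl// mulr_ge0.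
apply: lerD; last by apply: FP; exact: ltW.
apply: cintegral_bound; first exact: cbmeasM.
move=> x; rewrite cmodM cmodR; apply: ler_pM => //; first exact: cmod_ge0.
by apply: FP; rewrite cmod_expi.
Qed.

(** With k the Herglotz function of [z], the kernel is the conjugate of k,
    and conj(k) 2 Re G = conj(k) G + conj(k G) = (2 Re k) G - k G + conj(k
    G). The Poisson formula integrates the first term, the mean value
    property the other two. *)
Lemma cintegral_schwarz G z : disc_alg G -> cmod z < 1 ->
  cintegral (fun x => (expi x + z) / (expi x - z) * (complex.Re (G (expi x)))%:C)
  = G z - (0 +i* complex.Im (G 0)).
Proof.
move=> dG z1.
have bG := cbmeas_disc_alg dG.
have dk := disc_alg_herglotz z1.
have bk := cbmeas_disc_alg dk.
have bP := cbmeasR (bmeas_poisson z1).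
have dkG := disc_algM dk dG.
have two0 : 2 != 0 :> R[i] by rewrite pnatr_eq0.
have ReJ w : w + w^* = 2 * (complex.Re w)%:C.
  by case: w => a b; rewrite conjcE /=; simpc; congr (_ +i* _); rewrite -mulr2n -mulr_natl; simpc.
have ImJ w : w - w^* = 2 * (0 +i* complex.Im w).
  by case: w => a b; rewrite conjcE /=; simpc; congr (_ +i* _); rewrite -mulr2n -mulr_natl; simpc.
apply: (mulfI two0); rewrite -cintegralZ; last first.
  have := cbmeasM (cbmeasJ bk) (cbmeasR (bG.1)).
  by congr cbmeas; apply/funext => x; rewrite herglotzJ.
transitivity (2 * cintegral (fun x => (poisson z x)%:C * G (expi x)) -
  (cintegral (fun x => herglotz z (expi x) * G (expi x)) -
   (cintegral (fun x => herglotz z (expi x) * G (expi x)))^*)).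
  rewrite -cintegralJ; last exact: cbmeas_disc_alg dkG.
  rewrite -cintegralZ; last exact: cbmeasM.
  rewrite -cintegralB; last 2 first.
    exact: cbmeas_disc_alg dkG.
    by apply: cbmeasJ; exact: cbmeas_disc_alg dkG.
  rewrite -cintegralB; last 2 first.
    by apply: cbmeasM; [exact: cbmeas_cst|exact: cbmeasM].
    by apply: cbmeasB; [|apply: cbmeasJ]; exact: cbmeas_disc_alg dkG.
  congr cintegral; apply/funext => x.
  rewrite [X in _ - (_ - X)]rmorphM/= -herglotzJ// mulrCA -ReJ.
  by rewrite [2 * (_ * _)]mulrA -poisson_herglotz//; ring.
rewrite (disc_alg_mean dkG) -/(disc_ext (fun x => G (expi x)) z).
rewrite disc_ext_disc_alg//.
rewrite /herglotz mulr0 addr0 subr0 divr1 mul1r ImJ; ring.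
Qed.

End disc_algebra.

(** * Exponentials in the disc algebra *)

Section exp_log.
Context {R : realType}.
Implicit Types (F G : R[i] -> R[i]) (z w b : R[i]).

(** All the estimates of exponentials and logarithms are made along the
    segment from [0] to a point, parametrized by the unit interval. *)
Lemma le_MVT01 (f df : R -> R) (M : R) :
  (forall s : R, 0 <= s <= 1 -> is_derive s (1 : R) f (df s)) ->
  (forall s, 0 <= s <= 1 -> `|df s| <= M) -> `|f 1 - f 0| <= M.
Proof.
move=> fd dM.
have [c|c|c c01 ->] := @MVT _ f df 0 1 ltr01.
- by rewrite in_itv/= => /andP[c0 c1]; apply: fd; rewrite !ltW.
- apply: derivable_within_continuous => s; rewrite in_itv/= => s01.
  by case: (fd s s01).
- rewrite subr0 mulr1; apply: dM.
  by move: c01; rewrite in_itv/= => /andP[c0 c1]; rewrite !ltW.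
Qed.

Lemma is_derive_scale (a s : R) : is_derive s (1 : R) (fun s : R => s * a) a.
Proof.
have := is_deriveZ a (is_derive_id s (1 : R)).
move/is_derive_congr; apply => [t|]; first exact: mulrC.
exact: mulr1.
Qed.

Lemma ler_norm_sin (y : R) : `|sin y| <= `|y|.
Proof.
have := @le_MVT01 (fun s => sin (s * y)) (fun s => cos (s * y) * y) `|y|.
rewrite mul1r mul0r sin0 subr0; apply => s _.
  exact: (@is_derive1_comp _ sin (fun s : R => s * y) _ _ _ (is_derive_sin _)
    (is_derive_scale y s)).
by rewrite normrM ler_piMl// ler_norml cos_geN1 cos_le1.
Qed.

Lemma norm_cosB1 (y : R) : `|cos y - 1| <= y ^+ 2.
Proof.
have := @le_MVT01 (fun s => cos (s * y)) (fun s => - sin (s * y) * y) (y ^+ 2).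
rewrite mul1r mul0r cos0; apply => s s01.
  exact: (@is_derive1_comp _ cos (fun s : R => s * y) _ _ _ (is_derive_cos _)
    (is_derive_scale y s)).
rewrite normrM normrN -real_normK ?num_real// expr2; apply: ler_pM => //.
apply: le_trans (ler_norm_sin _) _; rewrite normrM.
by case/andP: s01 => s0 s1; rewrite ger0_norm// ler_piMl.
Qed.

Lemma norm_sinB (y : R) : `|y| <= 1 -> `|sin y - y| <= y ^+ 2.
Proof.
move=> y1; have := @le_MVT01 (fun s => sin (s * y) - s * y)
  (fun s => cos (s * y) * y - y) (y ^+ 2).
rewrite mul1r mul0r sin0 subrr subr0; apply => s s01.
  have := is_deriveB (@is_derive1_comp _ sin (fun s : R => s * y) _ _ _
    (is_derive_sin _) (is_derive_scale y s)) (is_derive_scale y s).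
  exact.
rewrite -{3}[y]mul1r -mulrBl normrM -real_normK ?num_real// expr2.
apply: ler_pM => //; apply: le_trans (norm_cosB1 _) _.
case/andP: s01 => s0 s1; rewrite exprMn -[y ^+ 2]real_normK ?num_real//.
apply: le_trans (_ : `|y| ^+ 2 <= _).
  by rewrite ler_piMl ?exprn_ile1 ?sqr_ge0 ?exprn_ge0.
by rewrite expr2 ler_piMl.
Qed.

Lemma expR_approx (x : R) : `|x| <= 2^-1 -> `|expR x - 1 - x| <= 2 * x ^+ 2.
Proof.
move=> x2; have x2' := x2; move: x2'; rewrite ler_norml => /andP[xl xr].
have x1 : 0 < 1 - x by lra.
have h : expR x * (1 - x) <= 1.
  have := expR_ge1Dx (- x); rewrite -(ler_pM2l (expR_gt0 x)) expRN.
  by rewrite mulfV// gt_eqF// expR_gt0.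
have := expR_ge1Dx x; move: h; set E := expR x => h h1.
by rewrite ger0_norm; nra.
Qed.

Lemma expR_le2 (x : R) : `|x| <= 2^-1 -> expR x <= 2.
Proof.
move=> x2; have ex := le_trans (ler_norm _) (expR_approx x2).
have xr := le_trans (ler_norm x) x2.
have := ler_norm (- x); rewrite normrN => /le_trans/(_ x2) xl.
have h1 : 0 <= 1 - 2 * x by lra.
have h2 : 0 <= 1 + 2 * x by lra.
have xx := mulr_ge0 h1 h2.
lra.
Qed.

Lemma cexp_approx w : cmod w <= 2^-1 ->
  cmod (cexp w - 1 - w) <= 10 * cmod w ^+ 2.
Proof.
move=> w2; have x2 := le_trans (ler_Re_cmod w) w2.
have y2 := le_trans (ler_Im_cmod w) w2.
have := cmod_sqr w.
case: w w2 x2 y2 => x y w2 x2 y2 ->.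
rewrite [complex.Re _]/= in x2 *; rewrite [complex.Im _]/= in y2 *.
have {}x2 : `|x| <= 2^-1 := x2.
have {}y2 : `|y| <= 2^-1 := y2.
have ex := expR_approx x2.
have cy := norm_cosB1 y.
have sy : `|sin y - y| <= y ^+ 2 by apply: norm_sinB; lra.
have sy' := ler_norm_sin y.
have -> : cexp (x +i* y) - 1 - (x +i* y) =
    (expR x * cos y - 1 - x) +i* (expR x * sin y - y).
  by rewrite /cexp /expi; apply/eqP; rewrite eq_complex /=; apply/andP; split;
    apply/eqP; ring.
apply: le_trans (cmod_le_ReIm _) _; rewrite [complex.Re _]/= [complex.Im _]/=.
have -> : expR x * cos y - 1 - x = (expR x - 1 - x) + expR x * (cos y - 1) by ring.
have -> : expR x * sin y - y =
  ((expR x - 1 - x) + x) * sin y + (sin y - y) by ring.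
have e2 : expR x <= 2.
  exact: expR_le2.
have hx : `|expR x - 1 - x + x| <= 2 * `|x|.
  apply: le_trans (ler_normD _ _) _.
  have := ler_wpM2r (normr_ge0 x) x2.
  by move: ex; rewrite -[x ^+ 2]real_normK ?num_real// expr2; lra.
have h1 : `|expR x * (cos y - 1)| <= 2 * y ^+ 2.
  by rewrite normrM ger0_norm ?expR_ge0//; apply: ler_pM; rewrite ?expR_ge0.
have h2 : `|(expR x - 1 - x + x) * sin y| <= 2 * `|x| * `|y|.
  by rewrite normrM; apply: ler_pM.
have h3 : 2 * (`|x| * `|y|) <= x ^+ 2 + y ^+ 2.
  rewrite -[x ^+ 2]real_normK ?num_real// -[y ^+ 2]real_normK ?num_real//.
  have := sqr_ge0 (`|x| - `|y|); nra.
apply: le_trans (lerD (ler_normD _ _) (ler_normD _ _)) _.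
have := sqr_ge0 x; have := sqr_ge0 y; lra.
Qed.

(** [z ^+ n - w ^+ n] is [z - w] times a sum of products of powers. *)
Lemma cmodBX z w (n : nat) (m : R) : cmod z <= m -> cmod w <= m ->
  cmod (z ^+ n.+1 - w ^+ n.+1) <= cmod (z - w) * (n.+1%:R * m ^+ n).
Proof.
move=> zm wm; have m0 : 0 <= m by apply: le_trans zm; exact: cmod_ge0.
rewrite subrXX cmodM ler_wpM2l ?cmod_ge0//.
apply: le_trans (cmod_sum _ _) _.
apply: (le_trans (ler_sum (G := fun=> m ^+ n) _ _)) => [i _|]; last first.
  by rewrite sumr_const card_ord mulr_natl.
rewrite cmodM !cmodX.
have -> : m ^+ n = m ^+ (n - i) * m ^+ i by rewrite -exprD subnK// -ltnS.
by apply: ler_pM; rewrite ?exprn_ge0 ?cmod_ge0// lerXn2r// nnegrE cmod_ge0.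
Qed.

(** [(1 + F / n) ^+ n] tends to [cexp F] uniformly where [F] is bounded:
    [cexp F] is the [n]-th power of [cexp (F / n)], which differs from [1 +
    F / n] by a multiple of [1 / n ^+ 2]. *)
Lemma disc_alg_exp F : disc_alg F -> disc_alg (fun z => cexp (F z)).
Proof.
move=> dF; have [M M0 FM] := disc_alg_bounded dF.
apply: disc_alg_lim => e e0.
(* The first term makes [cmod (F z / n)] at most 1/2; 10 is the constant of
   [cexp_approx], and the power of the bases is at most [expR M]. *)
pose B := 2 * M + 10 * M ^+ 2 * expR M / e.
have [n Bn] : exists n : nat, B <= n.+1%:R.
  exists (Num.truncn B); exact/ltW/truncnS_gt.
have n0 : 0 < n.+1%:R :> R by [].
exists (fun z => (1 + (n.+1%:R^-1)%:C * F z) ^+ n.+1).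
  apply: disc_algX; apply: disc_algD; first exact: disc_alg_cst.
  exact: disc_algZ.
move=> z z1; set w := (n.+1%:R^-1)%:C * F z.
have FwE : F z = w *+ n.+1.
  rewrite /w -mulr_natl mulrA -[n.+1%:R](rmorph_nat (real_complex R)).
  by rewrite -rmorphM mulfV ?gt_eqF// rmorph1 mul1r.
have wM : cmod w <= M / n.+1%:R.
  rewrite /w cmodM cmodR ger0_norm ?invr_ge0// mulrC ler_pM2r ?invr_gt0//.
  exact: FM.
have B2 : 2 * M <= n.+1%:R.
  apply: le_trans Bn; rewrite lerDl divr_ge0 ?mulr_ge0 ?expR_ge0 ?sqr_ge0//.
  exact: ltW.
have B3 : 10 * M ^+ 2 * expR M <= e * n.+1%:R.
  rewrite [leRHS]mulrC -ler_pdivrMr//; apply: le_trans Bn.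
  by rewrite lerDr mulr_ge0.
have w2 : cmod w <= 2^-1.
  by apply: le_trans wM _; rewrite ler_pdivrMr//; lra.
rewrite FwE cexpX.
have a1 : cmod (cexp w) <= expR (M / n.+1%:R).
  rewrite cmod_cexp ler_expR; apply: le_trans wM.
  by apply: le_trans (ler_Re_cmod w); exact: ler_norm.
have b1 : cmod (1 + w) <= expR (M / n.+1%:R).
  apply: le_trans (cmodD _ _) _; rewrite cmod1.
  by apply: le_trans (expR_ge1Dx _); rewrite lerD2l.
apply: le_trans (cmodBX n a1 b1) _; rewrite opprD addrA.
have ->: expR (M / n.+1%:R) ^+ n = expR (M / n.+1%:R *+ n) by rewrite -[X in _ = expR X]mulr_natr expRM_natr.
have en : expR (M / n.+1%:R *+ n) <= expR M.
  rewrite ler_expR -mulrnAr -[leRHS]mulr1 ler_wpM2l//.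
  by rewrite -mulr_natr mulrC ler_pdivrMr// mul1r ler_nat.
apply: le_trans (_ : 10 * (M / n.+1%:R) ^+ 2 * (n.+1%:R * expR M) <= _).
  apply: ler_pM; rewrite ?cmod_ge0 ?mulr_ge0 ?expR_ge0//; last first.
    by rewrite ler_wpM2l.
  apply: le_trans (cexp_approx w2) _; rewrite ler_wpM2l// lerXn2r// nnegrE ?cmod_ge0//.
  by rewrite divr_ge0.
rewrite -(ler_pM2r n0); apply: le_trans B3.
rewrite le_eqVlt; apply/orP; left; apply/eqP; field; rewrite ?gt_eqF//.
Qed.

End exp_log.

(** * Logarithms in the disc algebra *)

Section logarithm.
Context {R : realType}.
Implicit Types (F G : R[i] -> R[i]) (z w b : R[i]).

(** The principal logarithm of [1 - w] for [w] in the disc. There [1 - w]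
    has positive real part, so its argument is an arctangent. *)
Definition clog1 w : R[i] :=
  ln (cmod (1 - w)) +i* (- atan (complex.Im w / (1 - complex.Re w))).

Let is_derive_powsum (c : nat -> R) n (s : R) :
  is_derive s (1 : R) (fun s => \sum_(k < n) s ^+ k.+1 * (c k / k.+1%:R))
    (\sum_(k < n) s ^+ k * c k).
Proof.
elim: n => [|n ih].
  have := is_derive_cst (0 : R) s (1 : R).
  by move/is_derive_congr; apply => [t|]; rewrite big_ord0.
have := is_deriveD ih (is_deriveM (is_deriveX n.+1 (is_derive_id s (1:R)))
   (is_derive_cst (c n / n.+1%:R) s (1 : R))).
move/is_derive_congr; apply => [t|]; first by rewrite big_ord_recr/= -[LHS]/(_ + (id ^+ n.+1) t * _) exprfctE.
rewrite big_ord_recr/=; congr (_ + _); rewrite scaler0 add0r.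
have n0 : n.+1%:R != 0 :> R by [].
rewrite -[LHS]/((c n / n.+1%:R) * ((n.+1)%:R * s ^+ n * 1)); by field.
Qed.

Lemma Re_lt1 w : cmod w < 1 -> 0 < 1 - complex.Re w.
Proof.
by move=> w1; rewrite subr_gt0; apply: le_lt_trans w1;
  apply: le_trans (ler_Re_cmod w); exact: ler_norm.
Qed.

Lemma ln_cmod1B w : cmod w < 1 -> ln (cmod (1 - w)) =
  2^-1 * ln ((1 - complex.Re w) ^+ 2 + complex.Im w ^+ 2).
Proof.
move=> w1; have nz := one_sub_neq0 w1.
have -> : (1 - complex.Re w) ^+ 2 + complex.Im w ^+ 2 = cmod (1 - w) ^+ 2.
  by rewrite cmod_sqr; case: w {w1 nz} => x y /=; rewrite sub0r sqrrN.
by rewrite lnXn ?cmod_gt0// mulr2n; field.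
Qed.

(** The partial sums of the logarithmic series. Along [s * w] the logarithm
    has derivative [- w / (1 - s * w)], and adding the derivative of the
    partial sum leaves the remainder of a geometric series, which is small
    uniformly in [s]. *)
Lemma clog1_approx w n (rho : R) : cmod w <= rho -> rho < 1 ->
  cmod (clog1 w + \sum_(k < n) w ^+ k.+1 / k.+1%:R) <= 2 * (rho ^+ n / (1 - rho)).
Proof.
move=> wr r1; have w1 := le_lt_trans wr r1.
have r0 : 0 <= rho := le_trans (cmod_ge0 w) wr.
pose D (s : R) := (1 - s * complex.Re w) ^+ 2 + (s * complex.Im w) ^+ 2.
have sw1 s : 0 <= s <= 1 -> cmod (s%:C * w) <= rho.
  case/andP=> s0 s1; rewrite cmodM cmodR ger0_norm//.
  by apply: le_trans wr; rewrite ler_piMl ?cmod_ge0.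
have px s : 0 <= s <= 1 -> 0 < 1 - s * complex.Re w.
  move=> s01; have := Re_lt1 (le_lt_trans (sw1 s s01) r1).
  by rewrite cReM /= mul0r subr0.
have D0 s : 0 <= s <= 1 -> 0 < D s.
  by move=> /px s01; rewrite /D ltr_pwDl ?exprn_gt0 ?sqr_ge0.
have main (s : R) : 0 <= s <= 1 ->
    cmod (- (w / (1 - s%:C * w)) + \sum_(k < n) (s ^+ k)%:C * w ^+ k.+1) <=
    rho ^+ n / (1 - rho).
  move=> s01; have sw := sw1 s s01.
  have nz := one_sub_neq0 (le_lt_trans sw r1).
  have -> : - (w / (1 - s%:C * w)) + \sum_(k < n) (s ^+ k)%:C * w ^+ k.+1 =
      - (w * (s%:C * w) ^+ n / (1 - s%:C * w)).
    have -> : \sum_(k < n) (s ^+ k)%:C * w ^+ k.+1 =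
        w * \sum_(k < n) (s%:C * w) ^+ k.
      rewrite mulr_sumr; apply: eq_bigr => k _.
      by rewrite exprMn rmorphXn exprS; ring.
    rewrite -[X in w * X / _](subrK 1) subrX1; by field.
  rewrite cmodN !cmodM cmodV cmodX; apply: ler_pM.
  - by rewrite mulr_ge0 ?exprn_ge0 ?cmod_ge0.
  - by rewrite invr_ge0 cmod_ge0.
  - rewrite -[leRHS]mul1r; apply: ler_pM; rewrite ?exprn_ge0 ?cmod_ge0 ?(ltW w1)//.
    by rewrite lerXn2r ?nnegrE ?cmod_ge0// (sw1 s s01).
  - rewrite lef_pV2 ?posrE ?subr_gt0 ?cmod_gt0// lerBlDr.
    apply: le_trans (lerD (lexx _) sw).
    by rewrite -{1}cmod1 -{1}(subrK (s%:C * w) 1) cmodD.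
have divE (s : R) : 0 <= s <= 1 -> w / (1 - s%:C * w) =
   ((complex.Re w - s * cmod w ^+ 2) / D s) +i* (complex.Im w / D s).
  move=> s01; have nz := one_sub_neq0 (le_lt_trans (sw1 s s01) r1).
  apply: (mulIf nz); rewrite divfK// cmod_sqr; have := D0 s s01.
  rewrite /D; case: w {wr w1 D sw1 px D0 main nz} => x y /= /gt_eqF/negbT d0.
  apply/eqP; rewrite eq_complex /=; apply/andP; split; apply/eqP; field; exact: d0.
have dRe (s : R) : 0 <= s <= 1 -> is_derive s (1 : R)
    (fun s => 2^-1 * ln (D s) + \sum_(k < n) s ^+ k.+1 * (complex.Re (w ^+ k.+1) / k.+1%:R))
    (complex.Re (- (w / (1 - s%:C * w)) + \sum_(k < n) (s ^+ k)%:C * w ^+ k.+1)).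
  move=> s01; have Ds := D0 s s01.
  have dD : is_derive s (1 : R) D
      (2 * (1 - s * complex.Re w) * (- complex.Re w) +
       2 * (s * complex.Im w) * complex.Im w).
    have d1 := is_deriveX 2 (is_deriveB (is_derive_cst (1 : R) s (1 : R))
                 (is_derive_scale (complex.Re w) s)).
    have d2 := is_deriveX 2 (is_derive_scale (complex.Im w) s).
    apply: is_derive_congr (is_deriveD d1 d2) _ _ => [t|] //=.
    rewrite -[LHS]/(2 * (1 - s * complex.Re w) ^+ 1 * (0 - complex.Re w) +
      2 * (s * complex.Im w) ^+ 1 * complex.Im w); ring.
  apply: is_derive_congr (is_deriveD (is_deriveZ 2^-1
    (is_derive1_comp (is_derive1_ln Ds) dD))
    (is_derive_powsum (fun k => complex.Re (w ^+ k.+1)) n s)) _ _ => [t|] //=.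
  rewrite divE// cReD cReN; congr (_ + _).
    rewrite cmod_sqr -[LHS]/(2^-1 * ((D s)^-1 *
      (2 * (1 - s * complex.Re w) * - complex.Re w +
       2 * (s * complex.Im w) * complex.Im w))) /=.
    by move: Ds; rewrite /D => /gt_eqF/negbT d0; field.
  by rewrite cRe_sum; apply: eq_bigr => k _; rewrite cReZ.
have dIm (s : R) : 0 <= s <= 1 -> is_derive s (1 : R)
    (fun s => - atan (s * complex.Im w / (1 - s * complex.Re w)) +
       \sum_(k < n) s ^+ k.+1 * (complex.Im (w ^+ k.+1) / k.+1%:R))
    (complex.Im (- (w / (1 - s%:C * w)) + \sum_(k < n) (s ^+ k)%:C * w ^+ k.+1)).
  move=> s01; have Ds := D0 s s01; have px0 := px s s01.
  have dq : is_derive s (1 : R) (fun s => s * complex.Im w / (1 - s * complex.Re w))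
      (complex.Im w / (1 - s * complex.Re w) ^+ 2).
    have d1 := is_deriveB (is_derive_cst (1 : R) s (1 : R))
                 (is_derive_scale (complex.Re w) s).
    have d2 := is_deriveM (is_derive_scale (complex.Im w) s)
      (@is_deriveV _ (fun s => 1 - s * complex.Re w) _ _ _ (lt0r_neq0 px0) d1).
    apply: is_derive_congr d2 _ _ => [t|] //=.
    rewrite -[LHS]/((s * complex.Im w) *
      (- (1 - s * complex.Re w) ^- 2 * (0 - complex.Re w)) +
      (1 - s * complex.Re w)^-1 * complex.Im w).
    by field; exact: lt0r_neq0.
  apply: is_derive_congr (is_deriveD (is_deriveN
    (is_derive1_comp (is_derive1_atan _) dq))
    (is_derive_powsum (fun k => complex.Im (w ^+ k.+1)) n s)) _ _ => [t|] //=.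
  rewrite divE// cImD cImN; congr (_ + _).
    congr (- _) => /=; rewrite /D in Ds *; have {}px0 := lt0r_neq0 px0.
    have {}Ds := lt0r_neq0 Ds.
    by field; apply/andP; split; [exact: Ds|exact: px0].
  by rewrite cIm_sum; apply: eq_bigr => k _; rewrite cImZ.
(* The functions of s at the two ends of the unit interval. *)
have z0 (c : nat -> R) : \sum_(k < n) 0 ^+ k.+1 * (c k / k.+1%:R) = 0.
  by apply: big1 => k _; rewrite expr0n mul0r.
have z1 (c : nat -> R) : \sum_(k < n) 1 ^+ k.+1 * (c k / k.+1%:R) =
    \sum_(k < n) c k / k.+1%:R.
  by apply: eq_bigr => k _; rewrite expr1n mul1r.
have hR : `|ln (cmod (1 - w)) + \sum_(k < n) complex.Re (w ^+ k.+1) / k.+1%:R|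
    <= rho ^+ n / (1 - rho).
  have := le_MVT01 dRe (fun s s01 => le_trans (ler_Re_cmod _) (main s s01)).
  congr (`|_| <= _); rewrite -(z1 (fun k => complex.Re (w ^+ k.+1))) ln_cmod1B//.
  rewrite /D !mul1r !mul0r subr0 expr1n expr0n addr0 ln1 mulr0 add0r.
  by rewrite (z0 (fun k => complex.Re (w ^+ k.+1))) subr0.
have hI : `|- atan (complex.Im w / (1 - complex.Re w)) +
     \sum_(k < n) complex.Im (w ^+ k.+1) / k.+1%:R| <= rho ^+ n / (1 - rho).
  have := le_MVT01 dIm (fun s s01 => le_trans (ler_Im_cmod _) (main s s01)).
  congr (`|_| <= _); rewrite -(z1 (fun k => complex.Im (w ^+ k.+1))).
  rewrite !mul1r !mul0r atan0 oppr0 add0r.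
  by rewrite (z0 (fun k => complex.Im (w ^+ k.+1))) subr0.
apply: le_trans (cmod_le_ReIm _) _; rewrite mulrDl !mul1r cReD cImD cRe_sum cIm_sum.
have kE (k : nat) : w ^+ k.+1 / k.+1%:R = (k.+1%:R^-1)%:C * w ^+ k.+1.
  by rewrite mulrC fmorphV rmorph_nat.
apply: lerD.
  apply: le_trans hR; rewrite le_eqVlt; apply/orP; left; apply/eqP.
  congr (`|_ + _|); apply: eq_bigr => k _.
  by rewrite kE cReZ mulrC.
apply: le_trans hI; rewrite le_eqVlt; apply/orP; left; apply/eqP.
congr (`|_ + _|); apply: eq_bigr => k _.
by rewrite kE cImZ mulrC.
Qed.

Lemma disc_alg_log b : cmod b < 1 -> disc_alg (fun z => clog1 (b * z)).
Proof.
move=> b1; apply: disc_alg_lim => e e0.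
have b01 : 0 <= cmod b < 1 by rewrite cmod_ge0.
have [n Hn] := expr_mul_le (2 / (1 - cmod b)) b01 e0.
exists (fun z => - \sum_(k < n) (k.+1%:R^-1) * (b * z) ^+ k.+1).
  apply: disc_alg_ext (disc_algZ (-1) (disc_alg_sum (index_enum 'I_n)
    (F := fun (k : 'I_n) z => k.+1%:R^-1 * (b * z) ^+ k.+1) _)).
    by move=> z _; rewrite mulN1r.
  move=> k; apply: disc_algZ; apply: disc_algX; apply: disc_algZ.
  exact: disc_alg_id.
move=> z z1; rewrite opprK; apply: le_trans Hn.
under eq_bigr do rewrite mulrC.
apply: le_trans (clog1_approx n (cmod_le1M b z1) b1) _.
by rewrite mulrCA.
Qed.

End logarithm.

(** * Outer functions with prescribed modulus *)

Section outer_functions.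
Context {R : realType}.
Implicit Types (F G : R[i] -> R[i]) (z w b : R[i]).

Lemma Lnorm_bmeas (f : R -> R) (u : R) : (forall x, 0 <= f x) -> 0 <= u ->
  bmeas f -> ('N[haar]_(u%:E)[EFin \o f])%E =
    ((\int[haar]_x (f x `^ u)) `^ u^-1)%:E.
Proof.
move=> f0 u0 bf; rewrite unlock -poweR_EFin; congr (_ `^ _)%E.
rewrite -haar_EFin; last exact: bmeas_powR.
by apply: eq_integral => x _ /=; rewrite ger0_norm.
Qed.

Lemma cLnorm_cbmeas (f : R -> R[i]) (u : R) : 0 <= u -> cbmeas f ->
  cLnorm u f = ((\int[haar]_x (cmod (f x) `^ u)) `^ u^-1)%:E.
Proof.
move=> u0 bf; rewrite /cLnorm Lnorm_bmeas//.
  by move=> x; exact: cmod_ge0.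
exact: cbmeas_cmod.
Qed.

Lemma hardy_disc_alg F (u : R) : 0 <= u -> disc_alg F ->
  hardy u (fun x => F (expi x)).
Proof.
move=> u0 dF; have bF := cbmeas_disc_alg dF; split.
- exact: cbmeas_cmeasurable.
- by rewrite cLnorm_cbmeas// ltry.
- case=> [//|n] _; rewrite /fourier.
  have := disc_alg_mean (disc_algM dF (disc_algX n.+1 disc_alg_id)).
  by rewrite expr0n mulr0 => <-.
Qed.

(** The Schwarz formula recovers [G] from its real part on the circle up to
    the imaginary constant at [0], whose exponential is the unimodular
    factor. *)
Lemma outer_cexp G : disc_alg G -> outer (fun x => cexp (G (expi x))).
Proof.
move=> dG; have bG := cbmeas_disc_alg dG; split.
  have := bmeas_integrable bG.1; congr (_.-integrable _ _).
  by apply/funext => x; rewrite cmod_cexp lne_EFin ?expR_gt0// expRK.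
exists (expi (complex.Im (G 0))); first exact: cmod_expi.
move=> z z1; rewrite (disc_ext_disc_alg (disc_alg_exp dG))//.
rewrite (_ : (fun x => _) = fun x =>
    (expi x + z) / (expi x - z) * (complex.Re (G (expi x)))%:C); last first.
  by apply/funext => x; rewrite cmod_cexp expRK.
rewrite cintegral_schwarz// cexpD mulrCA.
have -> : cexp (- (0 +i* complex.Im (G 0))) = (expi (complex.Im (G 0)))^-1.
  rewrite /cexp /= oppr0 expR0 mul1r expiV conjcE /expi cosN sinN.
  by [].
by rewrite mulfV ?mulr1// expi_neq0.
Qed.

(** The moduli of the invertible outer functions at hand. The definition
    asks for the logarithm, so that all real powers are available. *)
Definition log_modulus (u : R -> R) :=
  exists2 G, disc_alg G & forall x, u x = expR (complex.Re (G (expi x))).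

Lemma log_modulus_cst (c : R) : 0 < c -> log_modulus (fun=> c).
Proof.
move=> c0; exists (fun=> (ln c)%:C); first exact: disc_alg_cst.
by move=> x; rewrite /= lnK.
Qed.

Lemma log_modulusM u v : log_modulus u -> log_modulus v ->
  log_modulus (fun x => u x * v x).
Proof.
move=> [F dF uF] [G dG vG]; exists (fun z => F z + G z); first exact: disc_algD.
by move=> x; rewrite uF vG cReD expRD.
Qed.

Lemma log_modulus_powR u (s : R) : log_modulus u -> log_modulus (fun x => u x `^ s).
Proof.
move=> [F dF uF]; exists (fun z => s%:C * F z); first exact: disc_algZ.
by move=> x; rewrite uF cReZ /powR gt_eqF ?expR_gt0// expRK.
Qed.

Lemma log_modulus_ext u v : u =1 v -> log_modulus u -> log_modulus v.
Proof. by move=> uv [F dF uF]; exists F => // x; rewrite -uv. Qed.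

Lemma log_modulusV u : log_modulus u -> log_modulus (fun x => (u x)^-1).
Proof.
move=> [F dF uF]; exists (fun z => - F z).
  by apply: disc_alg_ext (disc_algZ (-1) dF) => z _; rewrite mulN1r.
by move=> x; rewrite uF cReN expRN.
Qed.

Lemma log_modulus_1B b : cmod b < 1 -> log_modulus (fun x => cmod (1 - b * expi x)).
Proof.
move=> b1; exists (fun z => clog1 (b * z)); first exact: disc_alg_log.
move=> x; rewrite /= lnK// posrE cmod_gt0.
by apply: one_sub_neq0; rewrite cmodM cmod_expi mulr1.
Qed.

(** A point [z] inside of the disc is moved outside by [cmod (expi x - z) =
    cmod (1 - z^* * expi x)]; a point outside is factored out. *)
Lemma log_modulus_XB z : cmod z != 1 -> log_modulus (fun x => cmod (expi x - z)).
Proof.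
move=> z1; have [zl|zg|/eqP] := ltgtP (cmod z) 1; last by rewrite (negbTE z1).
  apply: log_modulus_ext (log_modulus_1B (b := z^*) _) => [x|]; last by rewrite cmodJ.
  rewrite -[LHS]cmodJ rmorphB rmorph1 rmorphM/= conjCK -expiV.
  rewrite -[LHS]mulr1 -[X in _ * X = _](cmod_expi x) -cmodM mulrBl mul1r.
  by rewrite -mulrA mulVf ?expi_neq0// mulr1.
have z0 : z != 0 by rewrite -cmod_gt0 (lt_trans ltr01).
apply: log_modulus_ext (log_modulusM (log_modulus_cst (lt_trans ltr01 zg))
  (log_modulus_1B (b := z^-1) _)) => [x|].
  by rewrite -cmodM mulrBr mulr1 mulrA mulfV// mul1r cmodBC.
by rewrite cmodV invf_lt1// (lt_trans ltr01).
Qed.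

(** A root of modulus one is a zero on the parametrized circle. *)
Lemma expi_surj w : cmod w = 1 -> exists x, w = expi x.
Proof.
move=> w1; have := cmod_sqr w; rewrite w1 expr1n.
case: w w1 => a b w1 /= ab.
have a1 : -1 <= a <= 1 by rewrite -ler_norml -w1; exact: (ler_Re_cmod (a +i* b)).
have b2 : Num.sqrt (1 - a ^+ 2) = `|b| by rewrite ab addrC addKr sqrtr_sqr.
have [b0|b0] := leP 0 b.
  by exists (acos a); rewrite /expi acosK// sin_acos// b2 ger0_norm.
exists (- acos a); rewrite /expi cosN sinN acosK// sin_acos// b2.
by rewrite ltr0_norm// opprK.
Qed.

(** The polynomial is split into linear factors over the closed field
    [R[i]]; roots inside and outside of the disc are treated one by one. *)
Lemma log_modulus_horner (P : {poly R[i]}) : (forall x, P.[expi x] != 0) ->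
  log_modulus (fun x => cmod P.[expi x]).
Proof.
move=> P0; have [r Pr] := closed_field_poly_normal P.
have l0 : 0 < cmod (lead_coef P).
  rewrite cmod_gt0 lead_coef_eq0; apply/eqP => P00.
  by have := P0 0; rewrite P00 horner0 eqxx.
have rP z : z \in r -> cmod z != 1.
  move=> zr; apply/eqP => /expi_surj[x zx]; have := P0 x.
  rewrite Pr hornerZ -zx; apply/negP; rewrite negbK mulf_eq0; apply/orP; right.
  by rewrite -/(root _ _) root_prod_XsubC.
apply: log_modulus_ext (log_modulusM (log_modulus_cst l0) (_ : log_modulus
    (fun x => cmod (\prod_(z <- r) ('X - z%:P)).[expi x]))) => [x|].
  by rewrite [in RHS]Pr hornerZ cmodM.
elim: r {Pr} rP => [|z r ih] rP.
  by apply: log_modulus_ext (log_modulus_cst ltr01) => x; rewrite big_nil hornerC cmod1.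
apply: log_modulus_ext (log_modulusM (log_modulus_XB (rP z _)) (ih _)) => [x||].
- by rewrite big_cons hornerM hornerXsubC cmodM.
- by rewrite inE eqxx.
- by move=> y yr; apply: rP; rewrite inE yr orbT.
Qed.

(** Unlike [log_modulus], this class is visibly stable under sums, which is
    what mixtures of Poisson kernels require. *)
Definition trig_ratio (u : R -> R) := exists P D : {poly R[i]},
  forall x, D.[expi x] != 0 /\ (u x)%:C = P.[expi x] / D.[expi x].

Lemma trig_ratio_sum (J : Type) (r : seq J) (u : J -> R -> R) :
  (forall j, trig_ratio (u j)) -> trig_ratio (fun x => \sum_(j <- r) u j x).
Proof.
move=> hu; elim: r => [|j r [P [D PD]]].
  by exists 0, 1 => x; rewrite big_nil horner0 mul0r hornerC oner_neq0.
have [P1 [D1 PD1]] := hu j.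
exists (P1 * D + P * D1), (D1 * D) => x; have [D0 e0] := PD x.
have [D10 e1] := PD1 x; rewrite big_cons hornerD !hornerM mulf_neq0//; split => //.
by rewrite rmorphD/= e0 e1; field; rewrite D0 D10.
Qed.

Lemma trig_ratio_poisson (c : R) a : cmod a < 1 -> trig_ratio (fun x => c * poisson a x).
Proof.
move=> a1; exists ((c%:C * (1 - (cmod a ^+ 2)%:C)) *: 'X),
  ((1 - a^* *: 'X) * ('X - a%:P)) => x.
have e0 := expi_neq0 x.
have h1 := poisson_factor_neq0 x a1.
have h' := expi_sub_neq0 x a1.
rewrite hornerM hornerXsubC hornerD hornerN hornerC !hornerZ !hornerX.
split; first by rewrite mulf_neq0.
rewrite rmorphM/= poissonE//; field; rewrite ?h1 ?h' ?e0//.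
Qed.

(** Positivity of [u] excludes zeros of the numerator on the circle. *)
Lemma log_modulus_ratio u : trig_ratio u -> (forall x, 0 < u x) -> log_modulus u.
Proof.
move=> [P [D PD]] u0.
have P0 x : P.[expi x] != 0.
  have [D0 uE] := PD x; apply/eqP => P0; move: uE; rewrite P0 mul0r.
  by case=> /eqP; rewrite gt_eqF.
apply: log_modulus_ext (log_modulusM (log_modulus_horner P0)
  (log_modulusV (log_modulus_horner (fun x => (PD x).1)))) => x.
have [D0 uE] := PD x.
by rewrite -cmodV -cmodM -uE cmodR gtr0_norm.
Qed.

Lemma poisson_mix_gt0 K Q : poisson_mix K Q -> forall x : R, 0 < Q x.
Proof.
move=> [a [c [a1 c0 c1 ->]]] x.
have {}a1 nu : cmod (a nu) < 1 := a1 nu.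
have [nu cnu] : exists nu, 0 < c nu.
  apply: contrapT => /forallNP h; have : \sum_nu c nu = 0.
    apply: big1 => nu _; apply/eqP; rewrite eq_le c0 andbT leNgt.
    by apply/negP/h.
  by rewrite c1; move/eqP; rewrite oner_eq0.
rewrite (bigD1 nu)//=; apply: ltr_wpDr; last by rewrite mulr_gt0// poisson_gt0.
by apply: sumr_ge0 => mu _; rewrite mulr_ge0// ltW// poisson_gt0.
Qed.

Lemma bmeas_poisson_mix K Q : poisson_mix K Q -> bmeas (Q : R -> R).
Proof.
move=> [a [c [a1 c0 c1 ->]]]; apply: bmeas_sum => nu; apply: bmeasZ.
exact: bmeas_poisson (a1 nu).
Qed.

Lemma haar_poisson_mix K Q : poisson_mix K Q -> \int[haar]_x (Q x : R) = 1.
Proof.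
move=> [a [c [a1 c0 c1 ->]]]; rewrite haar_sum => [|nu]; last first.
  by apply: bmeasZ; exact: bmeas_poisson (a1 nu).
rewrite -[RHS]c1; apply: eq_bigr => nu _.
rewrite haarZ; last exact: bmeas_poisson (a1 nu).
by rewrite (haar_poisson (a1 nu)) mulr1.
Qed.

Lemma log_modulus_poisson_mix K Q : poisson_mix K Q -> log_modulus Q.
Proof.
move=> PQ; apply: log_modulus_ratio; last exact: poisson_mix_gt0 PQ.
case: PQ => a [c [a1 c0 c1 ->]]; apply: trig_ratio_sum => nu.
exact: trig_ratio_poisson (a1 nu).
Qed.

(** [h] is the exponential whose modulus is [Q `^ t^-1]. *)
Lemma outer_of_poisson_mix K Q (t : R) : 0 < t -> poisson_mix K Q ->
  exists h : R -> R[i], [/\ hardy t h, outer h, cbmeas h &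
    forall x, cmod (h x) `^ t = Q x].
Proof.
move=> t0 PQ; have [G dG QG] := log_modulus_powR t^-1 (log_modulus_poisson_mix PQ).
exists (fun x => cexp (G (expi x))); split.
- apply: (hardy_disc_alg (ltW t0) (disc_alg_exp dG)).
- exact: outer_cexp.
- exact: cbmeas_disc_alg (disc_alg_exp dG).
- move=> x; rewrite cmod_cexp -QG -powRrM mulVf ?gt_eqF// powRr1//.
  by rewrite ltW// (poisson_mix_gt0 PQ).
Qed.

End outer_functions.

(** * Approximation by mixtures of Poisson kernels *)

Section poisson_approximation.
Context {R : realType}.
Implicit Types (f g W : R -> R) (z w b : R[i]).

(** The measure only charges one period, so inequalities are needed there
    only. This matters for the arcs below, which cover one period only. *)
Lemma haar_le_on f g : bmeas f -> bmeas g ->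
  (forall x, 0 <= x <= 2 * pi -> f x <= g x) ->
  \int[haar]_x f x <= \int[haar]_x g x.
Proof.
move=> bf bg fg; have [_ [M fM]] := bf; have [_ [N gN]] := bg.
have M0 x : 0 <= f x + (M + N).
  have := fM x; have := le_trans (normr_ge0 _) (gN x).
  by rewrite ler_norml => ? /andP[? ?]; lra.
have N0 x : 0 <= g x + (M + N).
  have := gN x; have := le_trans (normr_ge0 _) (fM x).
  by rewrite ler_norml => ? /andP[? ?]; lra.
have bc := bmeas_cst (M + N).
rewrite -(lerD2r (M + N)) -[X in _ + X <= _](haar_cst (M + N)).
rewrite -[X in _ <= _ + X](haar_cst (M + N)) -!haarD// -lee_fin -!haar_EFin//; last 2 first.
  exact: bmeasD.
  exact: bmeasD.
have [mf _] := bmeasD bf bc; have [mg _] := bmeasD bg bc.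
rewrite !(integral_uniform (twopi_gt0 (R := R))); last 4 first.
- exact/measurable_EFinP.
- by move=> x; rewrite lee_fin.
- exact/measurable_EFinP.
- by move=> x; rewrite lee_fin.
apply: lee_wpmul2l; first by rewrite lee_fin invr_ge0 subr0 ltW// twopi_gt0.
apply: ge0_le_integral => //.
- by move=> x _; rewrite lee_fin.
- by apply/measurable_EFinP; apply: measurable_funTS.
- by apply/measurable_EFinP; apply: measurable_funTS.
- by move=> x /=; rewrite in_itv/= => x01; rewrite lee_fin lerD2r fg.
Qed.

Lemma haar_eq_on f g : bmeas f -> bmeas g ->
  (forall x, 0 <= x <= 2 * pi -> f x = g x) ->
  \int[haar]_x f x = \int[haar]_x g x.
Proof.
move=> bf bg fg; apply: le_anti; apply/andP.
by split; apply: haar_le_on => // x /fg ->.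
Qed.

Lemma expi_lip (x y : R) : cmod (expi x - expi y) <= 2 * `|x - y|.
Proof.
have -> : expi x - expi y = expi y * (expi (x - y) - 1).
  by rewrite mulrBr mulr1 -expiD [y + _]addrC subrK.
rewrite cmodM cmod_expi mul1r; set d := x - y.
apply: le_trans (cmod_le_ReIm _) _; rewrite mulrDl mul1r /expi /= subr0.
apply: lerD; last exact: ler_norm_sin.
have := @le_MVT01 _ (fun s => cos (s * d)) (fun s => - sin (s * d) * d) `|d|.
rewrite mul1r mul0r cos0; apply => s s01.
  exact: (@is_derive1_comp _ cos (fun s : R => s * d) _ _ _ (is_derive_cos _)
    (is_derive_scale d s)).
by rewrite normrM normrN ler_piMl// ler_norml sin_geN1 sin_le1.
Qed.

(** The kernel is the real part of [2 / (1 - a^* * w) - 1], and the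
    difference of two such fractions has [(a - b)^*] as a factor. *)
Lemma poisson_lip a b x (rho : R) : cmod a <= rho -> cmod b <= rho -> rho < 1 ->
  `|poisson a x - poisson b x| <= 2 * cmod (a - b) / (1 - rho) ^+ 2.
Proof.
move=> ar br r1; have a1 := le_lt_trans ar r1; have b1 := le_lt_trans br r1.
rewrite !poisson_Re_herglotz// -cReN -cReD.
apply: le_trans (ler_Re_cmod _) _.
have ha := poisson_factor_neq0 x a1.
have hb := poisson_factor_neq0 x b1.
have -> : herglotz a (expi x) - herglotz b (expi x) =
    2 * (a - b)^* * expi x / ((1 - a^* * expi x) * (1 - b^* * expi x)).
  by rewrite /herglotz rmorphB/=; field; rewrite ha hb.
have low (c : R[i]) : cmod c <= rho -> 1 - rho <= cmod (1 - c^* * expi x).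
  move=> cr; rewrite lerBlDr; apply: le_trans (lerD (lexx _) cr).
  rewrite -{1}cmod1 -[cmod c]cmodJ -[cmod c^*]mulr1 -(cmod_expi x) -cmodM.
  by rewrite -{1}(subrK (c^* * expi x) 1) cmodD.
have r0 : 0 < 1 - rho by rewrite subr_gt0.
rewrite cmodM cmodV !cmodM cmod_expi mulr1 cmodJ.
have -> : cmod (2 : R[i]) = 2.
  by rewrite -[2 : R[i]](rmorph_nat (real_complex R)) cmodR ger0_norm.
apply: ler_pM; rewrite ?mulr_ge0 ?cmod_ge0// ?invr_ge0 ?mulr_ge0 ?cmod_ge0//.
rewrite lef_pV2 ?posrE ?mulr_gt0 ?exprn_gt0 ?cmod_gt0//.
by rewrite expr2; apply: ler_pM; rewrite ?(ltW r0) ?low.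
Qed.

(** For poles at the same distance from the origin the kernel depends on the
    distance of the two angles only. *)
Lemma poisson_sym (rho x y : R) :
  poisson (rho%:C * expi x) y = poisson (rho%:C * expi y) x.
Proof.
rewrite /poisson !cmodM !cmod_expi; congr (_ / _ ^+ 2).
rewrite -[LHS]cmodJ; congr cmod; rewrite rmorphB rmorph1; congr (1 - _).
have rJ : (rho%:C)^* = rho%:C by rewrite conjcE conjc_real.
by rewrite rmorphM/= conjCK rmorphM/= rJ mulrAC.
Qed.

(** [cmod (expi y - expi x) ^+ 2] is [2] minus twice the real part of an
    analytic function of [expi y], whose Poisson integral at the pole is
    [rho]. *)
Lemma poisson_second_moment (rho x : R) : 0 <= rho < 1 ->
  \int[haar]_y (poisson (rho%:C * expi x) y * cmod (expi y - expi x) ^+ 2) = 2 - 2 * rho.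
Proof.
move=> /andP[r0 r1]; set z := rho%:C * expi x.
have z1 : cmod z < 1 by rewrite cmodM cmodR cmod_expi mulr1 ger0_norm.
have bP := bmeas_poisson z1.
have h : cintegral (fun y => (poisson z y)%:C * ((expi x)^* * expi y)) = rho%:C.
  have := disc_ext_disc_alg (disc_algZ (expi x)^* disc_alg_id) z1.
  rewrite /disc_ext => ->; rewrite mulrCA [_^* * _]mulrC mul_conj_cmod cmod_expi.
  by rewrite expr1n mulr1.
have bR : bmeas (fun y => complex.Re ((poisson z y)%:C * ((expi x)^* * expi y))).
  apply: (proj1 (cbmeasM (cbmeasR bP) (cbmeasM (cbmeas_cst _) cbmeas_expi))).
have -> : \int[haar]_y (poisson z y * cmod (expi y - expi x) ^+ 2) =
    2 * \int[haar]_y poisson z y -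
    2 * \int[haar]_y complex.Re ((poisson z y)%:C * ((expi x)^* * expi y)).
  rewrite -!haarZ// -haarB; [|exact: bmeasZ|exact: bmeasZ].
  apply: eq_Rintegral => y _; rewrite cReZ.
  rewrite cmod_sqr conjcE /=; set P := poisson z y .
  transitivity (P * ((cos y ^+ 2 + sin y ^+ 2) + (cos x ^+ 2 + sin x ^+ 2) -
    2 * (cos x * cos y + sin x * sin y))); first by ring.
  by rewrite !cos2Dsin2; ring.
rewrite haar_poisson// mulr1; congr (2 - 2 * _).
by have := congr1 (@complex.Re R) h.
Qed.

(** The radius is chosen so that the second moment of the kernel is [eta ^+
    2]; its first moment is then at most [eta], by the inequality between
    arithmetic and geometric means. *)
Lemma poisson_integral_approx W (L eta x : R) : bmeas W ->
  (forall y, `|W y - W x| <= L * cmod (expi y - expi x)) -> 0 <= L ->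
  0 < eta <= 1 ->
  `|\int[haar]_y (poisson ((1 - eta ^+ 2 / 2)%:C * expi x) y * W y) - W x| <=
  L * eta.
Proof.
move=> bW WL L0 /andP[eta0 eta1]; set rho := 1 - _.
have e2 : 0 < eta ^+ 2 <= 1 by rewrite exprn_gt0//= exprn_ile1// ltW.
have rho01 : 0 <= rho < 1 by rewrite /rho; lra.
set z := rho%:C * expi x.
have z1 : cmod z < 1.
  by rewrite cmodM cmodR cmod_expi mulr1 ger0_norm; case/andP: rho01.
have bP := bmeas_poisson z1.
have bd : bmeas (fun y => cmod (expi y - expi x) ^+ 2).
  by apply: bmeasX; apply: cbmeas_cmod; apply: cbmeasB; [exact: cbmeas_expi|exact: cbmeas_cst].
have -> : \int[haar]_y (poisson z y * W y) - W x =
    \int[haar]_y (poisson z y * (W y - W x)).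
  under [RHS]eq_Rintegral do rewrite mulrBr [_ * W x]mulrC.
  rewrite haarB; [|exact: bmeasM|exact: bmeasZ].
  by rewrite haarZ// haar_poisson// mulr1.
have bPW : bmeas (fun y => poisson z y * (W y - W x)).
  by apply: bmeasM => //; apply: bmeasB => //; exact: bmeas_cst.
apply: le_trans (haar_norm bPW) _.
apply: le_trans (_ : \int[haar]_y (L / 2 * (eta * poisson z y +
    eta^-1 * (poisson z y * cmod (expi y - expi x) ^+ 2))) <= _).
  apply: haar_le; first exact: bmeas_norm.
    apply: bmeasZ; apply: bmeasD; apply: bmeasZ => //; exact: bmeasM.
  move=> y; rewrite normrM (ger0_norm (ltW (poisson_gt0 y z1))).
  apply: le_trans (ler_wpM2l (ltW (poisson_gt0 _ z1)) (WL y)) _.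
  set P := poisson z y; set d := cmod _.
  have -> : L / 2 * (eta * P + eta^-1 * (P * d ^+ 2)) =
    P * (L * ((eta + eta^-1 * d ^+ 2) / 2)) by ring.
  apply: ler_wpM2l; first by rewrite ltW// poisson_gt0.
  apply: ler_wpM2l => //.
  have : 0 <= eta^-1 * (eta - d) ^+ 2 by rewrite mulr_ge0 ?invr_ge0 ?sqr_ge0 ?ltW.
  have -> : eta^-1 * (eta - d) ^+ 2 = eta - 2 * d + eta^-1 * d ^+ 2.
    by field; exact: lt0r_neq0.
  lra.
rewrite haarZ; last first.
  by apply: bmeasD; apply: bmeasZ => //; exact: bmeasM.
have bPd := bmeasM bP bd.
rewrite haarD; [|exact: bmeasZ|exact: bmeasZ].
rewrite (haarZ _ bP) (haarZ _ bPd).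
rewrite poisson_second_moment// haar_poisson// /rho le_eqVlt; apply/orP; left.
by apply/eqP; field; exact: lt0r_neq0.
Qed.

(** The Poisson integral of [W] is the mixture of the kernels with poles on
    a circle of radius [rho] < 1, weighted by [W]. Cutting the circle into
    arcs and moving the poles of each arc to its left end changes the
    kernels little and keeps the total weight [1]. *)
Lemma poisson_mix_approx W (L e : R) : bmeas W -> (forall x, 0 <= W x) ->
  \int[haar]_x W x = 1 -> 0 <= L ->
  (forall x y, `|W y - W x| <= L * cmod (expi y - expi x)) -> 0 < e ->
  exists K, exists2 Q, poisson_mix K.+1 Q & forall x, `|W x - Q x| <= e.
Proof.
move=> bW W0 W1 L0 WL e0.
(* Half of the tolerance goes to the Poisson integral, half to the arcs. *)
pose eta := Num.min 1 (e / 2 / (L + 1)).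
have L1 : 0 < L + 1 by rewrite ltr_wpDl.
have eta0 : 0 < eta <= 1.
  by rewrite /eta lt_min ltr01 !divr_gt0//= ge_min lexx.
have Leta : L * eta <= e / 2.
  apply: le_trans (_ : (L + 1) * (e / 2 / (L + 1)) <= _); last first.
    by rewrite mulrC divfK// gt_eqF.
  case/andP: eta0 => eta0 _; apply: ler_pM => //; rewrite ?lerDl ?(ltW eta0)//.
  by rewrite /eta ge_min lexx orbT.
pose rho := 1 - eta ^+ 2 / 2.
have rho01 : 0 <= rho < 1.
  have : 0 < eta ^+ 2 <= 1.
    by case/andP: eta0 => ? ?; rewrite exprn_gt0//= exprn_ile1// ltW.
  by rewrite /rho; lra.
have [r0 r1] := andP rho01.
pose C := 4 / (1 - rho) ^+ 2.
have C0 : 0 < C by rewrite divr_gt0// exprn_gt0// subr_gt0.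
have [K KP] : exists K : nat, C * (2 * pi) / (e / 2) <= K.+1%:R.
  exists (Num.truncn (C * (2 * pi) / (e / 2))); exact/ltW/truncnS_gt.
pose h : R := 2 * pi / K.+1%:R.
have h0 : 0 < h by rewrite divr_gt0// twopi_gt0.
have Ch : C * h <= e / 2.
  by rewrite /h mulrA ler_pdivrMr// [leRHS]mulrC -ler_pdivrMr ?divr_gt0.
(* K+2 arcs of length h, the last of which only contributes the point 2 pi. *)
pose chi (nu : nat) (t : R) : R :=
  if (nu%:R <= t / h) && (t / h < nu.+1%:R) then 1 else 0.
have bchi nu : bmeas (chi nu).
  split.
    apply: measurable_fun_ifT => //.
    apply: measurable_and; [apply: measurable_fun_ler => //|apply: measurable_fun_ltr => //];
    exact: measurable_funM.
  by exists 1 => t; rewrite /chi; case: ifP => _; rewrite ?normr1 ?normr0.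
pose a (nu : 'I_K.+2) := rho%:C * expi (nu%:R * h).
pose c (nu : 'I_K.+2) := \int[haar]_t (chi nu t * W t).
have am (x : R) : cmod (rho%:C * expi x) <= rho.
  by rewrite cmodM cmodR cmod_expi mulr1 ger0_norm.
have a1 nu : cmod (a nu) < 1 by exact: le_lt_trans (am _) r1.
(* Exactly one arc contains t. *)
have sel (t : R) (g : 'I_K.+2 -> R) : 0 <= t <= 2 * pi -> exists nu : 'I_K.+2,
    `|t - nu%:R * h| <= h /\ \sum_(mu < K.+2) chi mu t * g mu = g nu.
  move=> /andP[t0 t1]; have th0 : 0 <= t / h by rewrite divr_ge0// ltW.
  have /andP[ln nl] := truncn_itv th0; set n := Num.truncn _ in ln nl.
  have nK : (n < K.+2)%N.
    rewrite ltnS -(ler_nat R); apply: le_trans ln _.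
    rewrite ler_pdivrMr//; apply: le_trans t1 _.
    by rewrite /h [leRHS]mulrC divfK.
  exists (Ordinal nK); split => /=.
    have -> : t - n%:R * h = (t / h - n%:R) * h by rewrite mulrBl divfK ?gt_eqF.
    rewrite normrM (gtr0_norm h0) -[leRHS]mul1r ler_wpM2r ?(ltW h0)//.
    by rewrite ger0_norm ?subr_ge0// lerBlDr addrC -natr1 in nl *; exact: ltW.
  rewrite (bigD1 (Ordinal nK))//= {1}/chi ln nl mul1r big1 ?addr0// => mu mun.
  rewrite /chi; case: ifPn; rewrite ?mul0r// -truncn_eq// => /eqP tm.
  by move: mun; rewrite -val_eqE /= -tm eqxx.
have bcW nu : bmeas (fun t => chi nu t * W t).
  exact: bmeasM (bchi nu) bW.
exists K.+1; exists (fun x => \sum_nu c nu * poisson (a nu) x).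
  exists a, c; split => //.
  - move=> nu; apply: Rintegral_ge0 => t _; apply: mulr_ge0 => //.
    by rewrite /chi; case: ifP.
  - rewrite -haar_sum// -[RHS]W1; apply: haar_eq_on => //; first exact: bmeas_sum.
    by move=> t /(sel t (fun=> W t))[nu [_ ->]].
move=> x.
have bPx (nu : 'I_K.+2) : bmeas (fun t => chi nu t * (poisson (a nu) x * W t)).
  by apply: bmeasM => //; exact: bmeasZ.
have QE : \sum_nu c nu * poisson (a nu) x =
    \int[haar]_t \sum_(nu < K.+2) chi nu t * (poisson (a nu) x * W t).
  rewrite haar_sum//; apply: eq_bigr => nu _; rewrite mulrC -haarZ//.
  by apply: eq_Rintegral => t _; rewrite mulrCA.
have bQ : bmeas (fun t => \sum_(nu < K.+2) chi nu t * (poisson (a nu) x * W t)).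
  exact: bmeas_sum.
have z1 : cmod (rho%:C * expi x) < 1 by exact: le_lt_trans (am x) r1.
have bPW : bmeas (fun t => poisson (rho%:C * expi x) t * W t).
  by apply: bmeasM => //; exact: bmeas_poisson.
have A := poisson_integral_approx bW (WL x) L0 eta0.
rewrite -/rho in A.
rewrite QE (_ : W x - _ = (\int[haar]_t (poisson (rho%:C * expi x) t * W t) -
   \int[haar]_t \sum_(nu < K.+2) chi nu t * (poisson (a nu) x * W t)) -
   (\int[haar]_t (poisson (rho%:C * expi x) t * W t) - W x)); last by ring.
apply: le_trans (ler_normB _ _) _; rewrite [leRHS]splitr; apply: lerD; last first.
  exact: le_trans A Leta.
rewrite -haarB//; apply: le_trans (haar_norm (bmeasB bPW bQ)) _; apply: le_trans Ch.
rewrite -[leRHS]mulr1 -W1 -haarZ//; apply: haar_le_on; last first.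
- move=> t /(sel t (fun nu => poisson (a nu) x * W t))[nu [tnu ->]].
  rewrite -mulrBl normrM (ger0_norm (W0 t)).
  apply: ler_wpM2r => //; rewrite poisson_sym.
  apply: le_trans (poisson_lip x (am t) (am _) r1) _.
  rewrite [leRHS]mulrAC ler_wpM2r ?invr_ge0 ?exprn_ge0 ?subr_ge0 ?(ltW r1)//.
  rewrite /a -mulrBr cmodM cmodR ger0_norm//.
  have := le_trans (expi_lip t (nu%:R * h)) (ler_wpM2l (ler0n _ 2) tnu).
  have := cmod_ge0 (expi t - expi (nu%:R * h)).
  by set d := cmod _ => d0 dh; have := ler_piMl d0 (ltW r1); lra.
- exact: bmeasZ.
- by apply: bmeas_norm; exact: bmeasB.
Qed.

End poisson_approximation.

(** * The affinity of two densities and their distance *)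

Section affinity.
Context {R : realType}.
Implicit Types (x y a s : R).

(** Young's inequality for the conjugate exponents [1 / (1 - a)] and [1 /
    a]. *)
Lemma young_powR a x y : 0 <= x -> 0 <= y -> 0 < a < 1 ->
  x `^ (1 - a) * y `^ a <= (1 - a) * x + a * y.
Proof.
move=> x0 y0 /andP[a0 a1]; have a1' : 0 < 1 - a by rewrite subr_gt0.
have := @conjugate_powR _ (x `^ (1 - a)) (y `^ a) (1 - a)^-1 a^-1.
rewrite !powR_ge0 !invr_gt0 a0 a1' !invrK subrK -!powRrM !mulfV ?gt_eqF//.
by rewrite !powRr1// mulrC [y * a]mulrC [x * _]mulrC; apply.
Qed.

Lemma powRV x s : 0 <= x -> x^-1 `^ s = (x `^ s)^-1.
Proof. by move=> x0; rewrite -[x^-1]powR_inv1// -powRrM mulN1r powRN. Qed.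

(** A share [z / (x + y)] at most [1] is bounded by its power of exponent
    [a] at most [1]. *)
Lemma powR_subadd a x y : 0 <= x -> 0 <= y -> 0 < a <= 1 ->
  (x + y) `^ a <= x `^ a + y `^ a.
Proof.
move=> x0 y0 /andP[a0 a1]; have [s0|] := ltP 0 (x + y); last first.
  move=> s0; have -> : x = 0 by lra.
  have -> : y = 0 by lra.
  by rewrite addr0 powR0 ?gt_eqF// addr0.
have key z : 0 <= z -> z <= x + y -> z / (x + y) * (x + y) `^ a <= z `^ a.
  move=> z0 zs; have [->|zn] := eqVneq z 0.
    by rewrite !mul0r powR_ge0.
  have zp : 0 < z by rewrite lt_neqAle eq_sym zn.
  rewrite -{2}(divfK (lt0r_neq0 s0) z) powRM ?divr_ge0// ?(ltW s0)//.
  rewrite ler_wpM2r ?powR_ge0//; apply: ger1_powR => //.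
  by rewrite divr_gt0//= ler_pdivrMr// mul1r.
have := lerD (key x x0 _) (key y y0 _).
rewrite -mulrDl -mulrDl divff ?gt_eqF// mul1r; apply; lra.
Qed.

Lemma powR_dist a x y : 0 <= x -> 0 <= y -> 0 < a <= 1 ->
  x `^ a - y `^ a <= `|x - y| `^ a.
Proof.
move=> x0 y0 a01; rewrite lerBlDr; apply: le_trans (powR_subadd _ y0 a01) => //.
have xy : x <= `|x - y| + y by rewrite -lerBlDr ler_norm.
apply: ge0_ler_powR; rewrite ?nnegrE//; first by case/andP: a01 => /ltW.
by rewrite addr_ge0.
Qed.

(** [x `^ (1 - a) * y `^ a] is a weighted geometric mean of [x] and
    [Num.sqrt (x * y)], with weights [1 - 2 * a] and [2 * a]. *)
Lemma young_hellinger a x y : 0 <= x -> 0 <= y -> 0 < a <= 2^-1 ->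
  a * (Num.sqrt x - Num.sqrt y) ^+ 2 <= (1 - a) * x + a * y - x `^ (1 - a) * y `^ a.
Proof.
move=> x0 y0 /andP[a0 a1].
rewrite sqrrB !sqr_sqrtr//.
have [->|a2] := eqVneq a 2^-1.
  have -> : 1 - 2^-1 = 2^-1 :> R by field.
  by rewrite !powR12_sqrt//; lra.
have a3 : 0 < 2 * a < 1.
  have : a < 2^-1 by rewrite lt_neqAle a2.
  by move=> ?; lra.
have := young_powR x0 (mulr_ge0 (sqrtr_ge0 x) (sqrtr_ge0 y)) a3.
rewrite -!powR12_sqrt// -powRM// -powRrM mulrA mulVf ?pnatr_eq0// mul1r powRM//.
rewrite mulrA -powRD; last by apply/implyP => /eqP; lra.
have -> : 1 - 2 * a + a = 1 - a by ring.
rewrite powRM //; set u := x `^ 2^-1; set v := y `^ 2^-1; lra.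
Qed.

(** Exchanging [x] and [y] exchanges [a] and [1 - a]. *)
Lemma young_hellinger_min a x y : 0 <= x -> 0 <= y -> 0 < a < 1 ->
  Num.min a (1 - a) * (Num.sqrt x - Num.sqrt y) ^+ 2 <=
  (1 - a) * x + a * y - x `^ (1 - a) * y `^ a.
Proof.
move=> x0 y0 /andP[a0 a1]; have [a2|a2] := leP a 2^-1.
  rewrite min_l; last by lra.
  by apply: young_hellinger => //; rewrite a0.
rewrite min_r; last by lra.
have := @young_hellinger (1 - a) y x y0 x0.
have -> : 1 - (1 - a) = a by ring.
rewrite -[(Num.sqrt x - _) ^+ 2]sqrrN opprB [_ `^ a * _]mulrC [a * y + _]addrC.
by apply; rewrite subr_gt0 a1; lra.
Qed.

(** Factor the difference of squares and apply the inequality between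
    arithmetic and geometric means with the free parameter [eta]. *)
Lemma normB_sqrt x y eta : 0 <= x -> 0 <= y -> 0 < eta ->
  `|x - y| <= (2 * eta)^-1 * (Num.sqrt x - Num.sqrt y) ^+ 2 + eta * (x + y).
Proof.
move=> x0 y0 eta0; rewrite -{1 3}(sqr_sqrtr x0) -{1 3}(sqr_sqrtr y0).
set u := Num.sqrt x; set v := Num.sqrt y.
have u0 : 0 <= u := sqrtr_ge0 _; have v0 : 0 <= v := sqrtr_ge0 _.
rewrite subr_sqr normrM [`|u + v|]ger0_norm ?addr_ge0//.
rewrite -[(u - v) ^+ 2]real_normK ?num_real//; set d := `|u - v|.
have h : 0 <= (2 * eta)^-1 * (d - eta * (u + v)) ^+ 2.
  by rewrite mulr_ge0 ?sqr_ge0// invr_ge0 mulr_ge0 ?ltW.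
have -> : d * (u + v) = (2 * eta)^-1 * d ^+ 2 + eta / 2 * (u + v) ^+ 2 -
   (2 * eta)^-1 * (d - eta * (u + v)) ^+ 2 by field; exact: lt0r_neq0.
have : eta / 2 * (u + v) ^+ 2 <= eta * (u ^+ 2 + v ^+ 2).
  rewrite -mulrA ler_wpM2l ?(ltW eta0)//.
  have := sqr_ge0 (u - v); rewrite sqrrB sqrrD; lra.
lra.
Qed.

Lemma powR_gt0_le a x y : 0 < a -> 0 <= x -> 0 <= y ->
  (x `^ a^-1 <= y) -> x <= y `^ a.
Proof.
move=> a0 x0 y0 /(ge0_ler_powR (ltW a0)); rewrite !nnegrE powR_ge0 y0.
by rewrite -powRrM mulVf ?gt_eqF// powRr1//; apply.
Qed.

Variables (a : R) (W Q : R -> R).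
Hypotheses (a0 : 0 < a) (a1 : a < 1).
Hypotheses (bW : bmeas W) (bQ : bmeas Q).
Hypotheses (W0 : forall x, 0 <= W x) (Q0 : forall x, 0 <= Q x).
Hypotheses (W1 : \int[haar]_x W x = 1) (Q1 : \int[haar]_x Q x = 1).

Let a01 : 0 < a < 1. Proof. by rewrite a0. Qed.
Let a1' : 0 <= 1 - a. Proof. by rewrite subr_ge0 ltW. Qed.

Let D := \int[haar]_x `|W x - Q x|.
Let g := \int[haar]_x (W x `^ (1 - a) * Q x `^ a).

Let bg : bmeas (fun x => W x `^ (1 - a) * Q x `^ a).
Proof. by apply: bmeasM; apply: bmeas_powR => //; exact: ltW. Qed.

Let bD : bmeas (fun x => `|W x - Q x|).
Proof. by apply: bmeas_norm; exact: bmeasB. Qed.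

Lemma affinity_ge0 : 0 <= g.
Proof. by apply: Rintegral_ge0 => x _; rewrite mulr_ge0 ?powR_ge0. Qed.

Lemma affinity_le1 : g <= 1.
Proof.
have -> : 1 = \int[haar]_x ((1 - a) * W x + a * Q x).
  by rewrite haarD ?haarZ ?W1 ?Q1 ?mulr1 ?subrK//; exact: bmeasZ.
apply: haar_le => //; first by apply: bmeasD; exact: bmeasZ.
by move=> x; exact: young_powR.
Qed.

(** Since [W = W `^ (1 - a) * W `^ a], the deficit is at most the integral
    of [W `^ (1 - a) * `|W - Q| `^ a], and the claim is Hoelder's
    inequality. A bound [d] strictly above the distance allows division by
    [d] also for equal densities. *)
Lemma affinity_le_dist (d : R) : D < d -> 1 - g <= d `^ a.
Proof.
move=> Dd; have D0 : 0 <= D by apply: Rintegral_ge0 => x _.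
have d0 : 0 < d by exact: le_lt_trans Dd.
have -> : 1 - g = \int[haar]_x (W x - W x `^ (1 - a) * Q x `^ a).
  by rewrite haarB// W1.
apply: le_trans (_ : \int[haar]_x (d `^ a *
    ((1 - a) * W x + a * (d^-1 * `|W x - Q x|))) <= _).
  apply: haar_le; first exact: bmeasB.
    by apply: bmeasZ; apply: bmeasD; apply: bmeasZ => //; exact: bmeasZ.
  move=> x; have {1}-> : W x = W x `^ (1 - a) * W x `^ a.
    by rewrite -powRD ?subrK ?powRr1// oner_eq0.
  rewrite -mulrBr.
  apply: le_trans (_ : W x `^ (1 - a) * `|W x - Q x| `^ a <= _).
    by rewrite ler_wpM2l ?powR_ge0// powR_dist// a0 ltW.
  have -> : `|W x - Q x| = d * (d^-1 * `|W x - Q x|).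
    by rewrite mulrA mulfV ?mul1r// gt_eqF.
  have dn : 0 <= d^-1 * `|W x - Q x| by rewrite mulr_ge0// invr_ge0 ltW.
  rewrite [d * _ in X in X <= _]mulrC powRM//; last exact: ltW.
  rewrite mulrA mulrC ler_wpM2l ?powR_ge0//.
  by rewrite [d * _]mulrA mulfV ?gt_eqF// mul1r; exact: young_powR.
rewrite haarZ; last by apply: bmeasD; apply: bmeasZ => //; exact: bmeasZ.
rewrite haarD; [|exact: bmeasZ|by apply: bmeasZ; exact: bmeasZ].
rewrite !haarZ//; last exact: bmeasZ.
rewrite W1 mulr1 -[leRHS]mulr1 ler_wpM2l ?powR_ge0//.
have : d^-1 * D <= 1 by rewrite mulrC ler_pdivrMr// mul1r ltW.
by rewrite -/D => h; have := ler_wpM2l (ltW a0) h; lra.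
Qed.

(** The deficit dominates a multiple of the squared Hellinger distance [H], and the
    squared distance in L^1 is at most [4 * H]. *)
Lemma dist_le_affinity : Num.min a (1 - a) / 4 * D ^+ 2 <= 1 - g.
Proof.
have D0 : 0 <= D by apply: Rintegral_ge0 => x _.
pose H := \int[haar]_x ((Num.sqrt (W x) - Num.sqrt (Q x)) ^+ 2).
have bs (f : R -> R) : bmeas f -> (forall x, 0 <= f x) -> bmeas (fun x => Num.sqrt (f x)).
  move=> bf f0; have : bmeas (fun x => f x `^ 2^-1) by apply: bmeas_powR => //; rewrite invr_ge0.
  by congr bmeas; apply/funext => x; rewrite powR12_sqrt.
have bH : bmeas (fun x => (Num.sqrt (W x) - Num.sqrt (Q x)) ^+ 2).
  by apply: bmeasX; apply: bmeasB; exact: bs.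
have m0 : 0 < Num.min a (1 - a) by rewrite lt_min a0 subr_gt0.
have Hg : Num.min a (1 - a) * H <= 1 - g.
  have -> : 1 - g = \int[haar]_x ((1 - a) * W x + a * Q x - W x `^ (1 - a) * Q x `^ a).
    rewrite haarB//; last by apply: bmeasD; exact: bmeasZ.
    rewrite haarD ?haarZ ?W1 ?Q1 ?mulr1 ?subrK//; exact: bmeasZ.
  rewrite -haarZ//; apply: haar_le; first exact: bmeasZ.
    by apply: bmeasB => //; apply: bmeasD; exact: bmeasZ.
  by move=> x; exact: young_hellinger_min.
suff DH : D ^+ 2 <= 4 * H.
  apply: le_trans Hg; rewrite -mulrA ler_pM2l//; lra.
move: D0; rewrite le_eqVlt => /predU1P[<-|D0].
  rewrite expr0n mulr_ge0//; apply: Rintegral_ge0 => x _; exact: sqr_ge0.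
(* The two terms of [normB_sqrt] are balanced at this value of eta. *)
have eta0 : 0 < D / 4 by rewrite divr_gt0.
have : D <= (2 * (D / 4))^-1 * H + D / 4 * 2.
  apply: le_trans (_ : \int[haar]_x ((2 * (D / 4))^-1 *
    (Num.sqrt (W x) - Num.sqrt (Q x)) ^+ 2 + D / 4 * (W x + Q x)) <= _).
    apply: haar_le => //; last by move=> x; exact: normB_sqrt.
    by apply: bmeasD; apply: bmeasZ => //; exact: bmeasD.
  rewrite haarD; [|exact: bmeasZ|by apply: bmeasZ; exact: bmeasD].
  by rewrite !haarZ ?haarD ?W1 ?Q1//; exact: bmeasD.
have -> : (2 * (D / 4))^-1 = 2 / D by field; exact: lt0r_neq0.
move=> h; have {h} : D * D <= D * (2 / D * H + D / 4 * 2) by rewrite ler_pM2l.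
have -> : D * (2 / D * H + D / 4 * 2) = 2 * H + D * D / 2 by field; exact: lt0r_neq0.
rewrite expr2; lra.
Qed.

End affinity.

(** * The exponents *)

Section exponents.
Context {R : realType} (p : R).
Hypothesis hp : 2 < p.

Let p0 : p != 0. Proof. by rewrite gt_eqF// (lt_trans _ hp). Qed.
Let p2 : p - 2 != 0. Proof. by rewrite gt_eqF// subr_gt0. Qed.

Lemma rexp_gt1 : 1 < rexp p.
Proof. by rewrite /rexp ltr_pdivlMr// mul1r. Qed.

Lemma rexp_gt0 : 0 < rexp p.
Proof. exact: lt_trans ltr01 rexp_gt1. Qed.

Lemma texp_gt2 : 2 < texp p.
Proof.
have p20 : 0 < p - 2 by rewrite subr_gt0.
by rewrite /texp ltr_pdivlMr//; lra.
Qed.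

Lemma texp_gt0 : 0 < texp p.
Proof. by apply: lt_trans texp_gt2. Qed.

Lemma aexp_gt0 : 0 < aexp p.
Proof.
have p20 : 0 < p - 2 by rewrite subr_gt0.
by rewrite /aexp divr_gt0// (lt_trans _ hp).
Qed.

Lemma aexp_lt1 : aexp p < 1.
Proof.
have p0' : 0 < p by rewrite (lt_trans _ hp).
by rewrite /aexp ltr_pdivrMr//; lra.
Qed.

Lemma onem_aexp : 1 - aexp p = (rexp p)^-1.
Proof. by rewrite /aexp /rexp; field; rewrite ?p0 ?p2. Qed.

Lemma texp_aexp : texp p * aexp p = 2.
Proof. by rewrite /texp /aexp; field; rewrite ?p0 ?p2. Qed.


End exponents.

(** * Weights and the densities that they define *)

Section weights.
Context {R : realType} (p : R).
Hypothesis hp : 2 < p.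
Implicit Types (X : nat -> {poly R[i]}) (lam : nat -> R).

Lemma Lnorm_counting_fin (x : nat -> R) (s : R) n : 0 < s ->
  (forall j, 0 <= x j) -> (forall j, (n <= j)%N -> x j = 0) ->
  ('N[counting]_(s%:E)[EFin \o x])%E = ((\sum_(j < n) x j `^ s) `^ s^-1)%:E.
Proof.
move=> s0 x0 xn; rewrite Lnorm_counting// -poweR_EFin; congr (_ `^ _)%E.
rewrite (nneseries_split 0 n); last by move=> k _; exact: poweR_ge0.
rewrite add0n eseries0 ?adde0; last first.
  by move=> i ni _; rewrite /comp xn// abse0 poweR0r// gt_eqF.
rewrite big_mkord -sumEFin; apply: eq_bigr => i _ /=.
by rewrite ger0_norm// poweR_EFin.
Qed.

Lemma finite_support (f : nat -> R) : finite_set [set j | f j != 0] ->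
  exists n, forall j, (n <= j)%N -> f j = 0.
Proof.
move=> /finite_seqP[s sP]; exists (\max_(j <- s) j).+1 => j sj.
apply/eqP/negPn/negP => fj; have : [set` s] j by rewrite -sP.
move=> /= js; have := @leq_bigmax_seq _ s xpredT id j js isT.
by rewrite leqNgt sj.
Qed.

Lemma LamP lam : Lam p lam -> exists n, forall j, (n <= j)%N -> lam j = 0.
Proof. by case=> _ /finite_support. Qed.

Lemma Lam_sum lam n : Lam p lam -> (forall j, (n <= j)%N -> lam j = 0) ->
  \sum_(j < n) lam j `^ rexp p = 1.
Proof.
move=> [l0 _ + ln]; rewrite (@Lnorm_counting_fin _ _ n)// ?rexp_gt0// => -[].
set S := \sum_(_ < _) _ => S1; have S0 : 0 <= S.
  by apply: sumr_ge0 => j _; exact: powR_ge0.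
have := congr1 (fun u => u `^ rexp p) S1.
by rewrite -powRrM mulVf ?powRr1 ?powR1// gt_eqF ?rexp_gt0.
Qed.

Lemma Lam_intro lam n : (forall j, 0 <= lam j) -> (forall j, (n <= j)%N -> lam j = 0) ->
  \sum_(j < n) lam j `^ rexp p = 1 -> Lam p lam.
Proof.
move=> l0 ln l1; split => //.
  apply: (sub_finite_set (B := `I_n)) => // j /= lj.
  by rewrite ltnNge; apply: contra lj => /ln ->.
by rewrite (@Lnorm_counting_fin _ _ n)// ?rexp_gt0// l1 powR1.
Qed.

Lemma SlamE X lam n (x : R) : (forall j, (n <= j)%N -> lam j = 0) ->
  Slam X lam x = \sum_(j < n) lam j * cmod (X j).[expi x] ^+ 2.
Proof.
move=> ln; rewrite /Slam.
rewrite (fsbig_ord _ n (fun j => lam j * cmod (X j).[expi x] ^+ 2)).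
apply/esym/fsbig_widen => // j [_ /= /negP]; rewrite -leqNgt => /ln ->.
by rewrite mul0r.
Qed.

Lemma bmeas_horner2 (P : {poly R[i]}) : bmeas (fun x => cmod P.[expi x] ^+ 2).
Proof. by apply: bmeasX; apply: cbmeas_cmod; exact: cbmeas_horner. Qed.

(** Lipschitz continuity in the point of the circle, rather than in the
    angle, is what the second moment of the Poisson kernel controls. *)
Lemma horner_lip (P : {poly R[i]}) : exists2 L, 0 <= L & forall z w : R[i],
  cmod z <= 1 -> cmod w <= 1 -> cmod (P.[z] - P.[w]) <= L * cmod (z - w).
Proof.
elim/poly_ind: P => [|P c [L L0 PL]].
  by exists 0 => // z w _ _; rewrite !horner0 subrr cmod0 mul0r.
have [M M0 PM] := poly_disc_bounded P.
exists (L + M); first exact: addr_ge0.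
move=> z w z1 w1; rewrite !hornerMXaddC.
have -> : P.[z] * z + c - (P.[w] * w + c) = (P.[z] - P.[w]) * z + P.[w] * (z - w).
  by ring.
apply: le_trans (cmodD _ _) _; rewrite !cmodM mulrDl; apply: lerD.
  rewrite -[leRHS]mulr1; apply: ler_pM; rewrite ?cmod_ge0//; exact: PL.
by rewrite ler_wpM2r ?cmod_ge0// PM.
Qed.

Lemma horner2_lip (P : {poly R[i]}) : exists2 L, 0 <= L & forall x y : R,
  `|cmod P.[expi y] ^+ 2 - cmod P.[expi x] ^+ 2| <= L * cmod (expi y - expi x).
Proof.
have [L L0 PL] := horner_lip P; have [M M0 PM] := poly_disc_bounded P.
have e1 (x : R) : cmod (expi x) <= 1 by rewrite cmod_expi.
(* |P|^2 - |P'|^2 factors as (|P| - |P'|) (|P| + |P'|). *)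
exists (L * (M + M)); first by rewrite mulr_ge0// addr_ge0.
move=> x y; rewrite subr_sqr normrM mulrAC; apply: ler_pM => //.
  apply: le_trans (PL _ _ (e1 y) (e1 x)).
  exact: ler_dist_cmod.
by rewrite ger0_norm ?addr_ge0 ?cmod_ge0// lerD ?PM.
Qed.

Lemma Slam_ge0 X lam : (forall j, 0 <= lam j) -> forall x : R, 0 <= Slam X lam x.
Proof.
move=> l0 x; apply: fsumr_ge0 => j _.
by rewrite mulr_ge0// sqr_ge0.
Qed.

Lemma bmeas_Slam X lam : Lam p lam -> bmeas (Slam X lam).
Proof.
move=> /LamP[n ln].
have : bmeas (fun x => \sum_(j < n) lam j * cmod (X j).[expi x] ^+ 2).
  by apply: bmeas_sum => j; apply: bmeasZ; exact: bmeas_horner2.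
by congr bmeas; apply/funext => x; rewrite (SlamE _ _ ln).
Qed.

Lemma Slam_lip X lam : Lam p lam -> exists2 L, 0 <= L & forall x y : R,
  `|Slam X lam y - Slam X lam x| <= L * cmod (expi y - expi x).
Proof.
move=> Ll; have [n ln] := LamP Ll; have [l0 _ _] := Ll.
have /choice[L LP] : forall j, exists L, 0 <= L /\ forall x y : R,
  `|cmod (X j).[expi y] ^+ 2 - cmod (X j).[expi x] ^+ 2| <= L * cmod (expi y - expi x).
  by move=> j; have [L ? ?] := horner2_lip (X j); exists L.
exists (\sum_(j < n) lam j * L j).
  by apply: sumr_ge0 => j _; rewrite mulr_ge0//; case: (LP j).
move=> x y; rewrite !(SlamE _ _ ln) -sumrB mulr_suml.
apply: le_trans (ler_norm_sum _ _ _) _; apply: ler_sum => j _.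
rewrite -mulrBr normrM ger0_norm// -mulrA ler_wpM2l//.
by have [_] := LP j.
Qed.

(** The graph of the convex function [_ `^ r] lies above its tangent at the
    larger of the two points, which is an instance of Young's inequality. *)
Lemma powR_lip (r M x y : R) : 1 < r -> 0 <= x <= M -> 0 <= y <= M ->
  `|x `^ r - y `^ r| <= r * M `^ (r - 1) * `|x - y|.
Proof.
move=> r1.
suff H x' y' : 0 <= x' <= M -> 0 <= y' <= M -> y' <= x' ->
    x' `^ r - y' `^ r <= r * M `^ (r - 1) * (x' - y').
  move=> xM yM; have [x0 _] := andP xM; have [y0 _] := andP yM.
  have r0 : 0 <= r by rewrite ltW// (lt_trans ltr01).
  have [yx|/ltW xy] := leP y x.
    rewrite [leLHS]ger0_norm; last by rewrite subr_ge0 ge0_ler_powR.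
    by rewrite [`|x - y|]ger0_norm ?subr_ge0// H.
  rewrite distrC [`|x - y|]distrC [leLHS]ger0_norm; last by rewrite subr_ge0 ge0_ler_powR.
  by rewrite [`|y - x|]ger0_norm ?subr_ge0// H.
move=> /andP[x0 xM] /andP[y0 yM] yx.
have r0 : 0 < r := lt_trans ltr01 r1.
have ra : 0 < r^-1 < 1 by rewrite invr_gt0 r0 invf_lt1.
have := young_powR (powR_ge0 x' r) (powR_ge0 y' r) ra.
rewrite -!powRrM mulfV ?gt_eqF// [y' `^ 1]powRr1//.
have -> : r * (1 - r^-1) = r - 1 by field; exact: lt0r_neq0.
rewrite -(ler_pM2l r0) mulrDr !mulrA mulrBr mulr1 mulfV ?gt_eqF// mul1r => h.
have h2 : x' * x' `^ (r - 1) = x' `^ r by exact: mulr_powRB1.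
apply: le_trans (_ : r * x' `^ (r - 1) * (x' - y') <= _).
  by rewrite -h2 in h *; lra.
rewrite ler_wpM2r ?subr_ge0// ler_wpM2l ?(ltW r0)//.
by apply: ge0_ler_powR; rewrite ?nnegrE ?subr_ge0 ?(ltW r1)// (le_trans x0).
Qed.

Lemma AlamE X lam : Lam p lam -> Alam p X lam =
  ((\int[haar]_x (Slam X lam x `^ rexp p)) `^ (rexp p)^-1)%:E.
Proof.
move=> Ll; rewrite /Alam Lnorm_bmeas//.
- by apply: Slam_ge0; case: Ll.
- exact/ltW/rexp_gt0.
- exact: bmeas_Slam.
Qed.

Lemma Alam_powR X lam : Lam p lam ->
  fine (Alam p X lam) `^ rexp p = \int[haar]_x (Slam X lam x `^ rexp p).
Proof.
move=> Ll; rewrite AlamE//= -powRrM mulVf ?gt_eqF ?rexp_gt0// powRr1//.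
by apply: Rintegral_ge0 => x _; exact: powR_ge0.
Qed.

Lemma bmeas_Slam_powR X lam : Lam p lam -> bmeas (fun x => Slam X lam x `^ rexp p).
Proof.
move=> Ll; apply: bmeas_powR; [|exact/ltW/rexp_gt0|exact: bmeas_Slam].
by apply: Slam_ge0; case: Ll.
Qed.

Lemma Wlam_ge0 X lam (x : R) : 0 <= Wlam p X lam x.
Proof. by rewrite /Wlam divr_ge0// powR_ge0. Qed.

Lemma bmeas_Wlam X lam : Lam p lam -> bmeas (Wlam p X lam).
Proof.
by move=> Ll; apply: bmeasM; [exact: bmeas_Slam_powR|exact: bmeas_cst].
Qed.

Lemma fine_Alam_gt0 X lam : Lam p lam -> (0 < Alam p X lam)%E ->
  0 < fine (Alam p X lam).
Proof. by move=> Ll; rewrite AlamE. Qed.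

Lemma haar_Wlam X lam : Lam p lam -> (0 < Alam p X lam)%E ->
  \int[haar]_x Wlam p X lam x = 1.
Proof.
move=> Ll A0; have a0 := fine_Alam_gt0 Ll A0.
under eq_Rintegral do rewrite /Wlam mulrC.
rewrite haarZ; last exact: bmeas_Slam_powR.
by rewrite -Alam_powR// mulVf// gt_eqF// powR_gt0.
Qed.

Lemma Wlam_lip X lam : Lam p lam -> exists2 L, 0 <= L & forall x y : R,
  `|Wlam p X lam y - Wlam p X lam x| <= L * cmod (expi y - expi x).
Proof.
move=> Ll; have [L L0 SL] := Slam_lip X Ll.
have [l0 _ _] := Ll.
have [_ [M SM]] := bmeas_Slam X Ll.
have SM' x : 0 <= Slam X lam x <= M.
  by rewrite Slam_ge0//= (le_trans (ler_norm _) (SM x)).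
have M0 : 0 <= M by apply: le_trans (SM 0).
have rr : 0 <= rexp p := ltW (rexp_gt0 hp).
have rM : 0 <= rexp p * M `^ (rexp p - 1) := mulr_ge0 rr (powR_ge0 _ _).
have c0 : 0 <= (fine (Alam p X lam) `^ rexp p)^-1 by rewrite invr_ge0 powR_ge0.
exists ((fine (Alam p X lam) `^ rexp p)^-1 * (rexp p * M `^ (rexp p - 1) * L)).
  exact: mulr_ge0 c0 (mulr_ge0 rM L0).
move=> x y; rewrite /Wlam -mulrBl normrM (ger0_norm c0) [leLHS]mulrC -[leRHS]mulrA ler_wpM2l//.
apply: le_trans (powR_lip (rexp_gt1 hp) (SM' y) (SM' x)) _.
by rewrite -[leRHS]mulrA ler_wpM2l.
Qed.

(** This factorization turns the quadratic functional into an affinity. *)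
Lemma SlamW X lam (x : R) : Lam p lam -> (0 < Alam p X lam)%E ->
  Slam X lam x = fine (Alam p X lam) * Wlam p X lam x `^ (1 - aexp p).
Proof.
move=> Ll A0; have a0 := fine_Alam_gt0 Ll A0; have [l0 _ _] := Ll.
have S0 := Slam_ge0 X l0 x.
have rn : rexp p != 0 := lt0r_neq0 (rexp_gt0 hp).
have AV : ((fine (Alam p X lam) `^ rexp p)^-1) `^ (rexp p)^-1 =
    (fine (Alam p X lam))^-1.
  by rewrite powRV ?powR_ge0// -powRrM mulfV// powRr1// ltW.
rewrite onem_aexp// /Wlam powRM ?powR_ge0 ?invr_ge0 ?powR_ge0// AV.
by rewrite -powRrM mulfV// powRr1// mulrCA mulfV ?mulr1// gt_eqF.
Qed.

End weights.

(** * Duality *)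

Section duality.
Context {R : realType} (p : R).
Hypothesis hp : 2 < p.
Implicit Types (X : nat -> {poly R[i]}) (lam : nat -> R) (h : R -> R[i]).

Let r0 : 0 < rexp p := rexp_gt0 hp.
Let a0 : 0 < aexp p := aexp_gt0 hp.
Let a1 : aexp p < 1 := aexp_lt1 hp.
Let t0 : 0 < texp p := texp_gt0 hp.

(** Hoelder's inequality for finite sums, by Young's inequality for each
    term after normalizing [y]. *)
Lemma ell_holder (x y : nat -> R) n : (forall j, 0 <= x j) -> (forall j, 0 <= y j) ->
  \sum_(j < n) x j `^ rexp p = 1 ->
  \sum_(j < n) x j * y j <= (\sum_(j < n) y j `^ (aexp p)^-1) `^ aexp p.
Proof.
move=> x0 y0 x1; set T := \sum_(j < n) y j `^ _.
have T0 : 0 <= T by apply: sumr_ge0 => j _; exact: powR_ge0.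
move: T0; rewrite le_eqVlt => /predU1P[T0|T0].
  rewrite big1 ?powR_ge0// => j _.
  have : y j `^ (aexp p)^-1 <= 0.
    rewrite [leRHS]T0 /T (bigD1 j)//= lerDl; apply: sumr_ge0 => i _; exact: powR_ge0.
  rewrite le_eqVlt ltNge powR_ge0 orbF powR_eq0 => /andP[/eqP -> _].
  by rewrite mulr0.
have Ta : 0 < T `^ aexp p by rewrite powR_gt0.
rewrite -[leRHS]mulr1 -ler_pdivrMl//.
apply: le_trans (_ : \sum_(j < n) ((1 - aexp p) * x j `^ rexp p +
   aexp p * (T^-1 * y j `^ (aexp p)^-1)) <= _); last first.
  by rewrite big_split/= -!mulr_sumr x1 mulVf ?gt_eqF// !mulr1 subrK.
rewrite mulr_sumr; apply: ler_sum => j _.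
have a01 : 0 < aexp p < 1 by rewrite a0.
have := @young_powR _ (aexp p) (x j `^ rexp p) (T^-1 * y j `^ (aexp p)^-1).
rewrite mulr_ge0 ?powR_ge0 ?invr_ge0 ?(ltW T0)// => /(_ isT isT a01).
rewrite powRM ?powR_ge0 ?invr_ge0 ?(ltW T0)// -!powRrM mulVf ?gt_eqF//.
rewrite onem_aexp// mulfV ?gt_eqF// !powRr1//.
rewrite powRV ?(ltW T0)// => hh.
by rewrite mulrCA.
Qed.

(** The extremal weight in Hoelder's inequality is proportional to the power
    [1 / alpha - 1] of [y]. *)
Lemma ell_norming (y : nat -> R) n : (forall j, 0 <= y j) ->
  0 < \sum_(j < n) y j `^ (aexp p)^-1 -> exists lam, [/\ Lam p lam,
    forall j, (n <= j)%N -> lam j = 0 &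
    \sum_(j < n) lam j * y j = (\sum_(j < n) y j `^ (aexp p)^-1) `^ aexp p].
Proof.
move=> y0; set S := \sum_(j < n) _ => S0.
pose lam j := if (j < n)%N then y j `^ ((aexp p)^-1 - 1) / S `^ (1 - aexp p) else 0.
have lamn (j : 'I_n) : lam j = y j `^ ((aexp p)^-1 - 1) / S `^ (1 - aexp p).
  by rewrite /lam ltn_ord.
have ln j : (n <= j)%N -> lam j = 0 by rewrite /lam ltnNge => ->.
have ai : 0 < (aexp p)^-1 by rewrite invr_gt0.
exists lam; split => //.
  apply: (Lam_intro hp (n := n)) => //.
    by move=> j; rewrite /lam; case: ifP => // _; rewrite divr_ge0 ?powR_ge0.
  under eq_bigr => j _.
    rewrite lamn powRM ?powR_ge0 ?invr_ge0 ?powR_ge0// powRV ?powR_ge0//.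
    rewrite -!powRrM onem_aexp// mulVf ?gt_eqF// powRr1 ?(ltW S0)//.
    have -> : ((aexp p)^-1 - 1) * rexp p = (aexp p)^-1.
      have -> : rexp p = (1 - aexp p)^-1 by rewrite onem_aexp// invrK.
      by field; rewrite gt_eqF//= subr_eq0 gt_eqF.
    over.
  by rewrite -mulr_suml mulfV ?gt_eqF.
under eq_bigr => j _.
  rewrite lamn mulrAC [_ * y j]mulrC mulr_powRB1//; over.
rewrite -mulr_suml -/S -powRN -[X in X * _]powRr1 ?(ltW S0)// -powRD.
  by congr (_ `^ _); ring.
by rewrite (gt_eqF S0) implybT.
Qed.

Lemma ell_dual_ge (y : nat -> \bar R) lam n : (forall j, 0 <= y j)%E ->
  Lam p lam -> (forall j, (n <= j)%N -> lam j = 0) ->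
  (\sum_(j < n) (lam j)%:E * y j <=
   (\big[+%E/0]_(0 <= j <oo) y j `^ (aexp p)^-1) `^ aexp p)%E.
Proof.
move=> y0 Ll ln; have [l0 _ _] := Ll.
set N := (\big[+%E/0]_(0 <= j <oo) _)%E.
have ai : 0 < (aexp p)^-1 by rewrite invr_gt0.
have partial m : (\sum_(j < m) y j `^ (aexp p)^-1 <= N)%E.
  rewrite /N (nneseries_split 0 m); last by move=> k _; exact: poweR_ge0.
  rewrite add0n big_mkord leeDl// nneseries_ge0// => k _ _; exact: poweR_ge0.
have N0 : (0 <= N)%E by apply: nneseries_ge0 => k _ _; exact: poweR_ge0.
have [->|Ny] := eqVneq N +oo%E; first by rewrite poweRyr ?gt_eqF// leey.
have yfin j : y j \is a fin_num.
  rewrite ge0_fin_numE// (@lty_poweRy _ _ (aexp p)^-1) ?gt_eqF//.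
  apply: le_lt_trans (_ : N < _)%E; last by rewrite lt_neqAle Ny leey.
  apply: le_trans (partial j.+1); rewrite big_ord_recr/=.
  by rewrite leeDr// sume_ge0// => k _; exact: poweR_ge0.
have yE j : y j = (fine (y j))%:E by rewrite fineK.
have fy0 j : 0 <= fine (y j) by rewrite fine_ge0.
have l1n := Lam_sum hp Ll ln.
apply: le_trans (_ : ((\sum_(j < n) fine (y j) `^ (aexp p)^-1) `^ aexp p)%:E <= _)%E.
  under eq_bigr do rewrite yE -EFinM.
  by rewrite sumEFin lee_fin; exact: (ell_holder (y := fun j => fine (y j))).
rewrite -poweR_EFin; apply: gt0_ler_poweR; rewrite ?in_itv/= ?leey ?andbT//.
- exact: ltW.
- by rewrite lee_fin sumr_ge0// => j _; exact: powR_ge0.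
- by apply: le_trans (partial n); rewrite -sumEFin; apply: lee_sum => j _; rewrite -poweR_EFin -yE.
Qed.

(** Testing with the unit weights bounds each [y j]; then the extremal
    weights for the partial sums bound all of these. *)
Lemma ell_dual_le (y : nat -> \bar R) (B : R) : (forall j, 0 <= y j)%E -> 0 <= B ->
  (forall lam n, Lam p lam -> (forall j, (n <= j)%N -> lam j = 0) ->
    (\sum_(j < n) (lam j)%:E * y j <= B%:E)%E) ->
  ((\big[+%E/0]_(0 <= j <oo) y j `^ (aexp p)^-1) `^ aexp p <= B%:E)%E.
Proof.
move=> y0 B0 hB.
have yB j : (y j <= B%:E)%E.
  pose d i : R := if i == j then 1 else 0.
  have dn i : (j.+1 <= i)%N -> d i = 0 by rewrite /d => ji; rewrite gtn_eqF.
  have d0 (i : 'I_j) : d i = 0 by rewrite /d ltn_eqF.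
  have dj : d j = 1 by rewrite /d eqxx.
  have := hB d j.+1 _ dn; rewrite big_ord_recr/= dj mul1e big1 ?add0e.
    apply; apply: (Lam_intro hp) dn _ => [i|]; first by rewrite /d; case: ifP.
    rewrite big_ord_recr/= dj powR1 big1 ?add0r// => i _.
    by rewrite d0 powR0// gt_eqF.
  by move=> i _; rewrite d0 mul0e.
have yfin j : y j \is a fin_num.
  by rewrite ge0_fin_numE// (le_lt_trans (yB j))// ltry.
have yE j : y j = (fine (y j))%:E by rewrite fineK.
have fy0 j : 0 <= fine (y j) by rewrite fine_ge0.
have partial n : (\sum_(j < n) fine (y j) `^ (aexp p)^-1) `^ aexp p <= B.
  have [S0|] := ltP 0 (\sum_(j < n) fine (y j) `^ (aexp p)^-1).
    have [lam [Ll ln <-]] := ell_norming fy0 S0.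
    rewrite -lee_fin -sumEFin; apply: le_trans (hB _ _ Ll ln).
    by apply: lee_sum => j _; rewrite EFinM -yE.
  move=> S0; have -> : \sum_(j < n) fine (y j) `^ (aexp p)^-1 = 0.
    by apply/eqP; rewrite eq_le S0 sumr_ge0// => j _; exact: powR_ge0.
  by rewrite powR0// gt_eqF.
have partial' n : \sum_(j < n) fine (y j) `^ (aexp p)^-1 <= B `^ (aexp p)^-1.
  have S0 : 0 <= \sum_(j < n) fine (y j) `^ (aexp p)^-1.
    by apply: sumr_ge0 => j _; exact: powR_ge0.
  rewrite -[leLHS]powRr1// -(mulfV (lt0r_neq0 a0)) powRrM.
  by apply: ge0_ler_powR; rewrite ?nnegrE ?powR_ge0 ?invr_ge0 ?(ltW a0).
apply: le_trans (_ : ((B `^ (aexp p)^-1)%:E `^ aexp p <= _)%E); last first.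
  by rewrite poweR_EFin -powRrM mulVf ?gt_eqF// powRr1.
apply: gt0_ler_poweR; rewrite ?in_itv/= ?leey ?andbT//.
- exact: ltW.
- by apply: nneseries_ge0 => k _ _; exact: poweR_ge0.
- by rewrite lee_fin powR_ge0.
apply: lime_le; first by apply: is_cvg_nneseries => k _ _; exact: poweR_ge0.
apply: nearW => n; rewrite big_mkord.
have := partial' n; rewrite -lee_fin -sumEFin; apply: le_trans.
by apply: lee_sum => j _; rewrite {1}yE poweR_EFin.
Qed.

Lemma measurable_cmod h : cmeasurable h -> measurable_fun setT (fun x => cmod (h x)).
Proof.
move=> [h1 h2].
have : measurable_fun setT (fun x => (complex.Re (h x) ^+ 2 + complex.Im (h x) ^+ 2) `^ 2^-1).
  apply: (measurableT_comp (measurable_powR _)); apply: measurable_funD.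
    exact: (measurable_funX 2 h1).
  exact: (measurable_funX 2 h2).
congr measurable_fun; apply/funext => x.
rewrite powR12_sqrt ?addr_ge0 ?sqr_ge0//.
by rewrite -cmod_sqr sqrtr_sqr ger0_norm ?cmod_ge0.
Qed.

Lemma poweR2 (x : \bar R) : (0 <= x)%E -> (x `^ 2 = x ^+ 2)%E.
Proof.
case: x => [x|_|//]; last by rewrite poweRyr ?pnatr_eq0// expe2 mulyy.
by rewrite lee_fin => x0; rewrite poweR_EFin powR_mulrn.
Qed.

Lemma sq_cLnorm2 h : (cLnorm 2 h ^+ 2)%E = (\int[haar]_x (cmod (h x) ^+ 2)%:E)%E.
Proof.
rewrite -poweR2 ?Lnorm_ge0// /cLnorm poweR_Lnorm//.
apply: eq_integral => x _; rewrite -[LHS]/(`|(cmod (h x))%:E| `^ 2)%E.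
by rewrite gee0_abs ?lee_fin ?cmod_ge0// poweR_EFin powR_mulrn ?cmod_ge0.
Qed.


(** As 2 alpha^-1 = t, the squared norm is the l^(1/alpha) norm of the
    squared L^2 norms. *)
Lemma mult_norm_sq X h : (mult_norm p X h ^+ 2)%E =
  ((\big[+%E/0]_(0 <= j <oo) (cLnorm 2 (poly_mul X j h) ^+ 2) `^ (aexp p)^-1) `^ aexp p)%E.
Proof.
rewrite -poweR2 ?Lnorm_ge0// /mult_norm Lnorm_counting// -poweRrM.
have -> : (texp p)^-1 * 2 = aexp p.
  by rewrite -(texp_aexp hp) mulrA mulVf ?mul1r// gt_eqF.
congr ((limn _) `^ _)%E; apply/funext => n; apply: eq_bigr => j _.
rewrite gee0_abs ?Lnorm_ge0// -poweR2 ?Lnorm_ge0// -poweRrM; congr (_ `^ _)%E.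
by rewrite -(texp_aexp hp) mulfK// gt_eqF.
Qed.

Lemma integral_Slam X lam n h : cmeasurable h -> (forall j, 0 <= lam j) ->
  (forall j, (n <= j)%N -> lam j = 0) ->
  (\int[haar]_x (Slam X lam x * cmod (h x) ^+ 2)%:E =
   \sum_(j < n) (lam j)%:E * cLnorm 2 (poly_mul X j h) ^+ 2)%E.
Proof.
move=> mh l0 ln.
have mX j : measurable_fun setT
    (fun x => ((cmod (poly_mul X j h x)) ^+ 2)%:E).
  apply/measurable_EFinP.
  have := measurable_funM (bmeas_horner2 (X j)).1 (measurable_funX 2 (measurable_cmod mh)).
  by congr measurable_fun; apply/funext => x; rewrite /poly_mul /= cmodM exprMn.
under [RHS]eq_bigr do rewrite sq_cLnorm2.
transitivity (\sum_(j < n) \int[haar]_x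
    ((lam j)%:E * (cmod (poly_mul X j h x) ^+ 2)%:E))%E; last first.
  apply: eq_bigr => j _.
  have c0 (x : measurableTypeR R) : setT x -> (0 <= (cmod (poly_mul X j h x) ^+ 2)%:E)%E.
    by move=> _; rewrite lee_fin sqr_ge0.
  have lj : (0 <= (lam j)%:E)%E by rewrite lee_fin.
  by have := ge0_integralZl haar measurableT (mX j) c0 lj.
have mZ (j : 'I_n) : measurable_fun setT
    (fun x => ((lam j)%:E * (cmod (poly_mul X j h x) ^+ 2)%:E)%E).
  by apply: measurable_funeM; exact: mX.
have c0 (j : 'I_n) (x : measurableTypeR R) : setT x ->
    (0 <= (lam j)%:E * (cmod (poly_mul X j h x) ^+ 2)%:E)%E.
  by move=> _; rewrite mule_ge0 ?lee_fin ?sqr_ge0.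
apply: etrans (ge0_integral_sum haar measurableT mZ c0 (index_enum 'I_n)).
apply: eq_integral => x _; rewrite (SlamE _ _ ln) mulr_suml -sumEFin.
by apply: eq_bigr => j _; rewrite -EFinM /poly_mul cmodM exprMn [in RHS]mulrA.
Qed.

Lemma mult_norm_ge X lam h : cmeasurable h -> Lam p lam ->
  (\int[haar]_x (Slam X lam x * cmod (h x) ^+ 2)%:E <= mult_norm p X h ^+ 2)%E.
Proof.
move=> mh Ll; have [n ln] := LamP Ll; have [l0 _ _] := Ll.
rewrite (integral_Slam X mh l0 ln) mult_norm_sq.
apply: (ell_dual_ge (y := fun j => cLnorm 2 (poly_mul X j h) ^+ 2)%E) => // j.
by rewrite sq_cLnorm2 integral_ge0// => x _; rewrite lee_fin sqr_ge0.
Qed.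

Lemma mult_norm_le X h (B : R) : cmeasurable h -> 0 <= B ->
  (forall lam, Lam p lam ->
    (\int[haar]_x (Slam X lam x * cmod (h x) ^+ 2)%:E <= B%:E)%E) ->
  (mult_norm p X h ^+ 2 <= B%:E)%E.
Proof.
move=> mh B0 hB; rewrite mult_norm_sq; apply: ell_dual_le => //.
  by move=> j; rewrite sq_cLnorm2 integral_ge0// => x _; rewrite lee_fin sqr_ge0.
move=> lam n Ll ln; have [l0 _ _] := Ll.
by rewrite -(integral_Slam X mh l0 ln); exact: hB.
Qed.

End duality.

(** * Squares and suprema of extended reals *)

Section extended_squares.
Context {R : realType}.
Implicit Types (x y : \bar R) (B : R) (S : set (\bar R)).

(** The statements concern squares of suprema in the extended reals, where
    no square root is at hand except below finite bounds. *)
Lemma le_sqre x y : (0 <= x)%E -> (x <= y)%E -> (x ^+ 2 <= y ^+ 2)%E.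
Proof. by move=> x0 xy; rewrite !expe2; apply: lee_pmul. Qed.

Lemma sqre_le x B : (0 <= x)%E -> 0 <= B -> (x ^+ 2 <= B%:E)%E ->
  (x <= (Num.sqrt B)%:E)%E.
Proof.
case: x => [x|_ _|//]; last by rewrite expe2 mulyy leye_eq.
rewrite lee_fin => x0 B0; rewrite expe2 -EFinM !lee_fin => xB.
by rewrite -(ger0_norm x0) -sqrtr_sqr; apply: ler_wsqrtr.
Qed.

Lemma sup_sqre_le S B : S !=set0 -> (forall x, S x -> 0 <= x)%E -> 0 <= B ->
  (forall x, S x -> (x ^+ 2 <= B%:E)%E) -> (ereal_sup S ^+ 2 <= B%:E)%E.
Proof.
move=> [x0 Sx0] S0 B0 SB.
apply: (@le_trans _ _ ((Num.sqrt B)%:E ^+ 2)%E); last first.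
  by rewrite expe2 -EFinM -expr2 sqr_sqrtr.
apply: le_sqre; first exact: le_trans (S0 _ Sx0) (ereal_sup_ubound Sx0).
by apply: ge_ereal_sup => x Sx; apply: sqre_le; [exact: S0| |exact: SB].
Qed.

Lemma sup_nonneg_ge0 S : (0 <= sup_nonneg S)%E.
Proof. by apply: ereal_sup_ubound; right. Qed.

Lemma sup_nonneg_ub S x : S x -> (x <= sup_nonneg S)%E.
Proof. by move=> Sx; apply: ereal_sup_ubound; left. Qed.

Lemma sup_nonneg_le S y : (0 <= y)%E -> (forall x, S x -> (x <= y)%E) ->
  (sup_nonneg S <= y)%E.
Proof. by move=> y0 h; apply: ge_ereal_sup => x [/h//|->]. Qed.

End extended_squares.

(** * The classes of Poisson mixtures *)

Section poisson_mixtures.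
Context {R : realType}.

(** Add poles at the origin with weight zero. *)
Lemma poisson_mix_mono K L (Q : R -> R) : (K <= L)%N ->
  poisson_mix K Q -> poisson_mix L Q.
Proof.
move=> /subnKC <-; move: (L - K)%N => m [a [c [a1 c0 c1 ->]]].
pose a' (nu : 'I_(K + m)) := if fintype.split nu is inl i then a i else 0.
pose c' (nu : 'I_(K + m)) := if fintype.split nu is inl i then c i else 0.
have al i : a' (lshift m i) = a i by rewrite /a' (unsplitK (inl i)).
have cl i : c' (lshift m i) = c i by rewrite /c' (unsplitK (inl i)).
have cr i : c' (rshift K i) = 0 by rewrite /c' (unsplitK (inr i)).
exists a', c'; split.
- move=> nu; rewrite /a'; case: (fintype.split nu) => // _.
  by rewrite -[disc _]/(is_true (cmod _ < 1)) cmod0 ltr01.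
- by move=> nu; rewrite /c'; case: (fintype.split nu).
- rewrite big_split_ord/= [X in _ + X]big1 ?addr0// -[RHS]c1.
  by apply: eq_bigr => i _.
- apply/funext => x; rewrite big_split_ord/= [X in _ = _ + X]big1 ?addr0.
    by apply: eq_bigr => i _; rewrite al cl.
  by move=> i _; rewrite cr mul0r.
Qed.

Lemma poisson_mix_nonempty K : (0 < K)%N -> exists Q : R -> R, poisson_mix K Q.
Proof.
move=> K0; exists (poisson 0); apply: (poisson_mix_mono K0).
exists (fun=> 0), (fun=> 1); split => //.
- by move=> _; rewrite -[disc _]/(is_true (cmod _ < 1)) cmod0 ltr01.
- by rewrite big_ord1.
- by apply/funext => x; rewrite big_ord1 mul1r.
Qed.

End poisson_mixtures.

(** * Hoelder's inequality on the circle *)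

Section estimates.
Context {R : realType} (p : R).
Hypothesis hp : 2 < p.
Implicit Types (X : nat -> {poly R[i]}) (lam : nat -> R) (h : R -> R[i]).

Let r0 : 0 < rexp p := rexp_gt0 hp.
Let a0 : 0 < aexp p := aexp_gt0 hp.
Let a1 : aexp p < 1 := aexp_lt1 hp.
Let t0 : 0 < texp p := texp_gt0 hp.

Lemma powR_texp_aexp (x : R) : 0 <= x -> (x `^ texp p) `^ aexp p = x ^+ 2.
Proof. by move=> x0; rewrite -powRrM texp_aexp// powR_mulrn. Qed.

(** Hoelder's inequality for the exponents r and t/2, through Young's
    inequality normalized by [A + e]. Arbitrary [e] > 0 covers the weights
    with [A = 0] as well, for which it says that the integral vanishes. *)
Lemma integral_Slam_le X lam h : Lam p lam -> cmeasurable h ->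
  (cLnorm (texp p) h <= 1)%E ->
  (\int[haar]_x (Slam X lam x * cmod (h x) ^+ 2)%:E <= Alam p X lam)%E.
Proof.
move=> Ll mh h1; have [l0 _ _] := Ll.
have S0 := Slam_ge0 X l0; have bS := bmeas_Slam X Ll.
have mc := measurable_cmod mh.
have ht : (\int[haar]_x (cmod (h x) `^ texp p)%:E <= 1)%E.
  have -> : (\int[haar]_x (cmod (h x) `^ texp p)%:E)%E = (cLnorm (texp p) h `^ texp p)%E.
    rewrite /cLnorm poweR_Lnorm ?gt_eqF//; apply: eq_integral => x _.
    by rewrite /comp gee0_abs ?lee_fin ?cmod_ge0// poweR_EFin.
  rewrite -(poweR1r (texp p)); apply: gt0_ler_poweR; rewrite ?in_itv/= ?leey ?andbT//.
    exact: ltW.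
  exact: Lnorm_ge0.
rewrite AlamE//; apply/lee_addgt0Pr => e e0.
set A := (_ `^ _); have A0 : 0 <= A := powR_ge0 _ _.
have Ae : 0 < A + e by rewrite ltr_wpDl.
have Ar : \int[haar]_x (Slam X lam x `^ rexp p) = A `^ rexp p.
  by rewrite -(Alam_powR hp X Ll) AlamE.
rewrite -EFinD.
have mht : measurable_fun setT (fun x => (cmod (h x) `^ texp p)%:E).
  by apply/measurable_EFinP; exact: measurableT_comp (measurable_powR _) mc.
have bSr := bmeas_Slam_powR hp X Ll.
pose c1 := (A + e) * (1 - aexp p) / (A + e) `^ rexp p.
pose c2 := (A + e) * aexp p.
have c10 : 0 <= c1 by rewrite divr_ge0 ?powR_ge0// mulr_ge0 ?subr_ge0 ?ltW.
have c20 : 0 <= c2 by rewrite mulr_ge0 ?ltW.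
have pw x : Slam X lam x * cmod (h x) ^+ 2 <=
    c1 * Slam X lam x `^ rexp p + c2 * cmod (h x) `^ texp p.
  have a01 : 0 < aexp p < 1 by rewrite a0.
  have := young_powR (powR_ge0 (Slam X lam x / (A + e)) (rexp p))
    (powR_ge0 (cmod (h x)) (texp p)) a01.
  rewrite powR_texp_aexp ?cmod_ge0// -powRrM onem_aexp// mulfV ?gt_eqF//.
  rewrite powRr1 ?divr_ge0 ?(ltW Ae)// -onem_aexp//.
  rewrite powRM ?invr_ge0 ?(ltW Ae)// powRV ?(ltW Ae)//.
  rewrite -(ler_pM2l Ae) mulrA [(A + e) * (_ / _)]mulrC divfK ?gt_eqF//.
  by rewrite mulrDr /c1 /c2 !mulrA [_ * Slam X lam x `^ _ / _]mulrAC.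
apply: le_trans (_ : \int[haar]_x ((c1 * Slam X lam x `^ rexp p)%:E +
   c2%:E * (cmod (h x) `^ texp p)%:E) <= _)%E.
  apply: ge0_le_integral => //.
  - by move=> x _; rewrite lee_fin mulr_ge0 ?sqr_ge0.
  - by apply/measurable_EFinP; apply: measurable_funM bS.1 (measurable_funX 2 mc).
  - apply: emeasurable_funD; last exact: measurable_funeM.
    by apply/measurable_EFinP; exact: (bmeasZ c1 bSr).1.
  - by move=> x _; rewrite -EFinM -EFinD lee_fin; exact: pw.
have f0 (x : measurableTypeR R) : setT x -> (0 <= (cmod (h x) `^ texp p)%:E)%E.
  by move=> _; rewrite lee_fin powR_ge0.
have c20' : (0 <= c2%:E)%E by rewrite lee_fin.
have E2 := ge0_integralZl haar measurableT mht f0 c20'.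
have bZ := bmeasZ c1 bSr.
have mZ : measurable_fun setT (fun x => (c1 * Slam X lam x `^ rexp p)%:E).
  by apply/measurable_EFinP; exact: bZ.1.
have g0 (x : measurableTypeR R) : setT x -> (0 <= (c1 * Slam X lam x `^ rexp p)%:E)%E.
  by move=> _; rewrite lee_fin mulr_ge0 ?powR_ge0.
have k0 (x : measurableTypeR R) : setT x -> (0 <= c2%:E * (cmod (h x) `^ texp p)%:E)%E.
  by move=> _; rewrite mule_ge0 ?lee_fin ?powR_ge0.
have mk : measurable_fun setT (fun x => (c2%:E * (cmod (h x) `^ texp p)%:E)%E).
  exact: measurable_funeM.
rewrite (ge0_integralD haar measurableT g0 mZ k0 mk).
rewrite E2 haar_EFin// haarZ// Ar.
apply: le_trans (_ : ((c1 * A `^ rexp p)%:E + c2%:E * 1%:E <= _)%E).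
  by apply: leeD2l; apply: lee_wpmul2l.
rewrite -EFinM -EFinD lee_fin mulr1 /c1 /c2.
have : A `^ rexp p / (A + e) `^ rexp p <= 1.
  rewrite ler_pdivrMr ?powR_gt0// mul1r; apply: ge0_ler_powR.
  - exact: ltW.
  - by rewrite nnegrE.
  - by rewrite nnegrE ltW.
  - by rewrite lerDl ltW.
have k : 0 <= (A + e) * (1 - aexp p) by rewrite mulr_ge0 ?subr_ge0 ?ltW.
move=> /(ler_wpM2l k) hk.
apply: le_trans (_ : (A + e) * (1 - aexp p) * 1 + (A + e) * aexp p <= _).
  by rewrite lerD2r; apply: le_trans hk; rewrite mulrAC !mulrA.
by rewrite mulr1 -mulrDr subrK mulr1.
Qed.

End estimates.

(** * Estimates for a fixed weight *)

Section deficits.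
Context {R : realType} (p : R).
Hypothesis hp : 2 < p.
Implicit Types (X : nat -> {poly R[i]}) (lam : nat -> R) (h : R -> R[i]).

Let a0 : 0 < aexp p := aexp_gt0 hp.
Let a1 : aexp p < 1 := aexp_lt1 hp.
Let t0 : 0 < texp p := texp_gt0 hp.

Section fixed_weight.
Variables (X : nat -> {poly R[i]}) (lam : nat -> R).
Hypotheses (Ll : Lam p lam) (A0 : (0 < Alam p X lam)%E).

Local Notation W := (Wlam p X lam).
Let dist (Q : R -> R) := \int[haar]_x `|W x - Q x|.
Let aff (Q : R -> R) := \int[haar]_x (W x `^ (1 - aexp p) * Q x `^ aexp p).

Let bW : bmeas W := bmeas_Wlam hp X Ll.
Let W0 : forall x, 0 <= W x := Wlam_ge0 p X lam.
Let W1 : \int[haar]_x W x = 1 := haar_Wlam hp Ll A0.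

Lemma bmeas_aff K Q : poisson_mix K Q ->
  bmeas (fun x => W x `^ (1 - aexp p) * Q x `^ aexp p).
Proof.
move=> PQ; apply: bmeasM; apply: bmeas_powR; rewrite ?subr_ge0 ?ltW//.
  by move=> x; rewrite ltW// (poisson_mix_gt0 PQ).
exact: bmeas_poisson_mix PQ.
Qed.

Let aff_le1 K Q : poisson_mix K Q -> aff Q <= 1.
Proof.
move=> PQ; apply: affinity_le1 => //; first exact: bmeas_poisson_mix PQ.
  by move=> x; rewrite ltW// (poisson_mix_gt0 PQ).
exact: haar_poisson_mix PQ.
Qed.

(** The supremum as a real number together with its universal property, so
    that the estimates take place in [R]. *)
Lemma gammaK_real K : (0 < K)%N -> exists gm, [/\ gammaK p X K lam = gm%:E,
  0 <= gm <= 1, (forall Q, poisson_mix K Q -> aff Q <= gm) &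
  (forall B, (forall Q, poisson_mix K Q -> aff Q <= B) -> gm <= B)].
Proof.
move=> K0; have [Q0 PQ0] := poisson_mix_nonempty (R := R) K0.
have affE Q : poisson_mix K Q ->
    (\int[haar]_x (W x `^ (1 - aexp p) * Q x `^ aexp p)%:E = (aff Q)%:E)%E.
  by move=> PQ; rewrite haar_EFin//; exact: bmeas_aff PQ.
have ub Q : poisson_mix K Q -> ((aff Q)%:E <= gammaK p X K lam)%E.
  by move=> PQ; apply: ereal_sup_ubound; exists Q => //; exact: affE.
have lub B : (forall Q, poisson_mix K Q -> aff Q <= B) -> (gammaK p X K lam <= B%:E)%E.
  by move=> h; apply: ge_ereal_sup => _ [Q PQ <-]; rewrite affE// lee_fin h.
have g1 : (gammaK p X K lam <= 1%:E)%E by apply: lub => Q; exact: aff_le1.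
have g0 : (0%:E <= gammaK p X K lam)%E.
  apply: le_trans (ub _ PQ0); rewrite lee_fin; exact: affinity_ge0.
have gfin : gammaK p X K lam = (fine (gammaK p X K lam))%:E.
  by rewrite fineK// ge0_fin_numE// (le_lt_trans g1)// ltry.
exists (fine (gammaK p X K lam)); split => //.
- by rewrite -!lee_fin -gfin g0.
- by move=> Q PQ; rewrite -lee_fin -gfin ub.
- by move=> B h; rewrite -lee_fin -gfin lub.
Qed.

Lemma deltaK_real K : (0 < K)%N -> exists d, [/\ deltaK p X K lam = d%:E,
  0 <= d, (forall Q, poisson_mix K Q -> d <= dist Q) &
  (forall B, (forall Q, poisson_mix K Q -> B <= dist Q) -> B <= d)].
Proof.
move=> K0; have [Q0 PQ0] := poisson_mix_nonempty (R := R) K0.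
have distE Q : poisson_mix K Q ->
    ('N[haar]_1[EFin \o (W \- Q)%R] = (dist Q)%:E)%E.
  move=> PQ; rewrite Lnorm1 -haar_EFin//.
  by apply: bmeas_norm; apply: bmeasB => //; exact: bmeas_poisson_mix PQ.
have dist0 Q : 0 <= dist Q by apply: Rintegral_ge0.
have lb Q : poisson_mix K Q -> (deltaK p X K lam <= (dist Q)%:E)%E.
  by move=> PQ; apply: ereal_inf_lbound; exists Q => //; exact: distE.
have glb B : (forall Q, poisson_mix K Q -> B <= dist Q) -> (B%:E <= deltaK p X K lam)%E.
  by move=> h; apply: le_ereal_inf_tmp => _ [Q PQ <-]; rewrite distE// lee_fin h.
have d0 : (0%:E <= deltaK p X K lam)%E by apply: glb => Q _; exact: dist0.
have dfin : deltaK p X K lam = (fine (deltaK p X K lam))%:E.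
  by rewrite fineK// ge0_fin_numE// (le_lt_trans (lb _ PQ0))// ltry.
exists (fine (deltaK p X K lam)); split => //.
- by rewrite -lee_fin -dfin.
- by move=> Q PQ; rewrite -lee_fin -dfin lb.
- by move=> B h; rewrite -lee_fin -dfin glb.
Qed.

Let Q0 K Q : poisson_mix K Q -> forall x : R, 0 <= Q x.
Proof. by move=> PQ x; rewrite ltW// (poisson_mix_gt0 PQ). Qed.

(** Both inequalities hold for each mixture [Q] separately and pass to the
    supremum and the infimum. *)
Lemma delta_gamma_bounds K : (0 < K)%N ->
  ((Num.min (aexp p) (1 - aexp p) / 4)%:E * deltaK p X K lam ^+ 2
    <= 1 - gammaK p X K lam)%E /\
  (1 - gammaK p X K lam <= deltaK p X K lam `^ aexp p)%E.
Proof.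
move=> K0; have [d [-> d0 dlb dglb]] := deltaK_real K0.
have [gm [-> /andP[g0 g1] gub glub]] := gammaK_real K0.
split.
  rewrite expe2 -!EFinM -EFinB lee_fin -expr2 lerBrDr addrC -lerBrDr.
  apply: glub => Q PQ; rewrite lerBrDr addrC -lerBrDr.
  apply: (le_trans _ (dist_le_affinity a0 a1 bW (bmeas_poisson_mix PQ) W0 (Q0 PQ)
    W1 (haar_poisson_mix PQ))).
  rewrite ler_wpM2l ?divr_ge0//.
    by rewrite le_min ltW//= subr_ge0 ltW.
  by rewrite lerXn2r ?nnegrE ?dlb// (le_trans d0)// dlb.
rewrite -EFinB poweR_EFin lee_fin; apply: powR_gt0_le; rewrite ?subr_ge0//.
apply: dglb => Q PQ; apply/ler_addgt0Pr => e e0.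
have De : dist Q < dist Q + e by rewrite ltrDl.
have := affinity_le_dist a0 a1 bW (bmeas_poisson_mix PQ) W0 (Q0 PQ) W1 De.
have De0 : 0 <= dist Q + e by rewrite addr_ge0 ?(ltW e0)//; apply: Rintegral_ge0.
move=> h; have {}h : 1 - gm <= (dist Q + e) `^ aexp p.
  by apply: le_trans h; rewrite lerB// gub.
have -> : dist Q + e = ((dist Q + e) `^ aexp p) `^ (aexp p)^-1.
  by rewrite -powRrM mulfV ?gt_eqF// powRr1.
by apply: ge0_ler_powR; rewrite ?nnegrE ?powR_ge0 ?subr_ge0 ?invr_ge0 ?(ltW a0).
Qed.

(** A mixture that is uniformly close to [W] is close to it in L^1, and
    [affinity_le_dist] applies. *)
Lemma gammaK_to1 (e : R) : 0 < e -> exists K, exists2 Q, poisson_mix K.+1 Q &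
  1 - e <= aff Q.
Proof.
move=> e0; have [L L0 WL] := Wlam_lip hp X Ll.
pose d := e `^ (aexp p)^-1; have d0 : 0 < d by rewrite powR_gt0.
have d20 : 0 < d / 2 by rewrite divr_gt0.
have [K [Q PQ WQ]] := poisson_mix_approx bW W0 W1 L0 WL d20.
exists K, Q => //; rewrite lerBlDr addrC -lerBlDr.
have Dd : dist Q < d.
  apply: (@le_lt_trans _ _ (d / 2)); last by rewrite ltr_pdivrMr// ltr_pMr// ltr1n.
  rewrite -[leRHS]haar_cst; apply: haar_le => //; last exact: bmeas_cst.
  by apply: bmeas_norm; apply: bmeasB => //; exact: bmeas_poisson_mix PQ.
have := affinity_le_dist a0 a1 bW (bmeas_poisson_mix PQ) W0 (Q0 PQ) W1 Dd.
by rewrite /d -powRrM mulVf ?gt_eqF// powRr1// ltW.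
Qed.

Lemma haar_SlamQ K Q : poisson_mix K Q ->
  \int[haar]_x (Slam X lam x * Q x `^ aexp p) = fine (Alam p X lam) * aff Q.
Proof.
move=> PQ; rewrite -haarZ; last exact: bmeas_aff PQ.
by apply: eq_Rintegral => x _; rewrite mulrA -SlamW.
Qed.

End fixed_weight.

Lemma bmeas_SlamQ X lam K Q : Lam p lam -> poisson_mix K Q ->
  bmeas (fun x => Slam X lam x * Q x `^ aexp p).
Proof.
move=> Ll PQ; apply: bmeasM; first exact: bmeas_Slam Ll.
apply: bmeas_powR; [|exact: ltW|exact: bmeas_poisson_mix PQ].
by move=> x; rewrite ltW// (poisson_mix_gt0 PQ).
Qed.

(** The integral depends on [h] only through [Q], even though [h] need not
    be bounded everywhere. *)
Lemma integral_Slam_mix X lam h K Q : Lam p lam -> cmeasurable h -> poisson_mix K Q ->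
  {ae haar, forall x, cmod (h x) `^ texp p = Q x} ->
  (\int[haar]_x (Slam X lam x * cmod (h x) ^+ 2)%:E =
   (\int[haar]_x (Slam X lam x * Q x `^ aexp p))%:E)%E.
Proof.
move=> Ll mh PQ hQ; rewrite -haar_EFin; last exact: bmeas_SlamQ Ll PQ.
apply: ae_eq_integral => //.
- apply/measurable_EFinP; apply: measurable_funM (bmeas_Slam X Ll).1 _.
  exact: measurable_funX 2 (measurable_cmod mh).
- by apply/measurable_EFinP; exact: (bmeas_SlamQ X Ll PQ).1.
- apply: (@filterS _ _ (ae_filter_ringOfSetsType haar) _ _ _ hQ) => x hx _; rewrite -hx powR_texp_aexp//.
  exact: cmod_ge0.
Qed.

Lemma cLnorm_mix h K Q : cmeasurable h -> poisson_mix K Q ->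
  {ae haar, forall x, cmod (h x) `^ texp p = Q x} -> cLnorm (texp p) h = 1%E.
Proof.
move=> mh PQ hQ; rewrite /cLnorm unlock.
rewrite (_ : (\int[haar]_x _)%E = 1%E) ?poweR1r//.
rewrite -[RHS]/((1 : R)%:E) -(haar_poisson_mix PQ) -haar_EFin; last exact: bmeas_poisson_mix PQ.
have E x : (`|(EFin \o (cmod \o h)) x| `^ texp p = (cmod (h x) `^ texp p)%:E)%E.
  by rewrite /comp gee0_abs ?lee_fin ?cmod_ge0// poweR_EFin.
under eq_integral do rewrite E.
apply: ae_eq_integral => //.
- apply/measurable_EFinP.
  exact: measurableT_comp (measurable_powR _) (measurable_cmod mh).
- by apply/measurable_EFinP; exact: (bmeas_poisson_mix PQ).1.
- by apply: (@filterS _ _ (ae_filter_ringOfSetsType haar) _ _ _ hQ) => x hx _; rewrite hx.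
Qed.

End deficits.

(** * The suprema over the two classes of functions *)

Section suprema.
Context {R : realType} (p : R).
Hypothesis hp : 2 < p.
Implicit Types (X : nat -> {poly R[i]}) (lam : nat -> R) (h : R -> R[i]).

Let a0 : 0 < aexp p := aexp_gt0 hp.
Let t0 : 0 < texp p := texp_gt0 hp.

Lemma mult_norm_ge0 X h : (0 <= mult_norm p X h)%E.
Proof. exact: Lnorm_ge0. Qed.

Lemma outer_mix_ball K h : outer_mix p K h ->
  hardy (texp p) h /\ (cLnorm (texp p) h <= 1)%E.
Proof.
move=> [hh _ [Q PQ hQ]]; split => //; have [mh _ _] := hh.
by rewrite (cLnorm_mix mh PQ hQ).
Qed.

Lemma outer_mix_nonempty K : (0 < K)%N -> outer_mix p K !=set0.
Proof.
move=> K0; have [Q PQ] := poisson_mix_nonempty (R := R) K0.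
have [h [hh oh _ hQ]] := outer_of_poisson_mix t0 PQ.
by exists h; split => //; exists Q => //; apply/aeW.
Qed.

Lemma outer_mix_mono K L : (K <= L)%N -> outer_mix p K `<=` outer_mix p L.
Proof.
move=> KL h [hh oh [Q PQ hQ]]; split => //; exists Q => //.
exact: poisson_mix_mono PQ.
Qed.

Lemma CK_mono X K L : (K <= L)%N -> (CK p X K <= CK p X L)%E.
Proof.
move=> KL; apply: ge_ereal_sup => _ [h hK <-]; apply: ereal_sup_ubound.
by exists h => //; exact: outer_mix_mono hK.
Qed.

(** A mixture of Poisson kernels has integral one, so its outer functions
    lie in the unit ball. *)
Lemma CK_le_Coo X K : (CK p X K <= Coo p X)%E.
Proof.
apply: ge_ereal_sup => _ [h hK <-]; apply: ereal_sup_ubound.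
by exists h => //; exact: outer_mix_ball hK.
Qed.

Lemma CK_ge0 X K : (0 < K)%N -> (0 <= CK p X K)%E.
Proof.
move=> /outer_mix_nonempty[h hK]; apply: le_trans (mult_norm_ge0 X h) _.
by apply: ereal_sup_ubound; exists h.
Qed.

Lemma Coo_ge0 X : (0 <= Coo p X)%E.
Proof. exact: le_trans (CK_ge0 X (ltn0Sn 0)) (CK_le_Coo X 1). Qed.

(** Uses the existence of an outer function for every mixture. *)
Lemma Alam_gamma_le X K lam : (0 < K)%N -> Lam p lam -> (0 < Alam p X lam)%E ->
  (Alam p X lam * gammaK p X K lam <= CK p X K ^+ 2)%E.
Proof.
move=> K0 Ll A0; have [gm [-> /andP[g0 g1] gub glub]] := gammaK_real hp Ll A0 K0.
have Afin : Alam p X lam = (fine (Alam p X lam))%:E by rewrite AlamE.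
have a0' := fine_Alam_gt0 hp Ll A0.
have key Q : poisson_mix K Q ->
    ((\int[haar]_x (Slam X lam x * Q x `^ aexp p))%:E <= CK p X K ^+ 2)%E.
  move=> PQ; have [h [hh oh bh hQ]] := outer_of_poisson_mix t0 PQ.
  have [mh _ _] := hh.
  have hQ' : {ae haar, forall x, cmod (h x) `^ texp p = Q x} by exact/aeW.
  rewrite -(integral_Slam_mix hp X Ll mh PQ hQ').
  apply: le_trans (mult_norm_ge hp X mh Ll) _.
  apply: le_sqre; first exact: mult_norm_ge0.
  by apply: ereal_sup_ubound; exists h => //; split => //; exists Q.
have C0 : (0 <= CK p X K ^+ 2)%E by rewrite expe_ge0// CK_ge0.
have [->|Cy] := eqVneq (CK p X K ^+ 2)%E +oo%E; first exact: leey.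
have Cfin : (CK p X K ^+ 2)%E = (fine (CK p X K ^+ 2)%E)%:E.
  by rewrite fineK// ge0_fin_numE// lt_neqAle Cy leey.
rewrite Afin Cfin -EFinM lee_fin -ler_pdivlMl//; apply: glub => Q PQ.
rewrite ler_pdivlMl// -(haar_SlamQ hp Ll A0 PQ) -lee_fin -Cfin.
exact: key.
Qed.

(** Weights with [A = 0], absent from the supremum on the right, contribute
    nothing on the left by [integral_Slam_le]. *)
Lemma CK_sq X K : (0 < K)%N -> (CK p X K ^+ 2 =
  sup_nonneg [set Alam p X lam * gammaK p X K lam |
    lam in [set lam | Lam p lam /\ 0 < Alam p X lam]])%E.
Proof.
move=> K0; apply: le_anti; apply/andP; split; last first.
  apply: sup_nonneg_le; first by rewrite expe_ge0// CK_ge0.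
  by move=> _ [lam [Ll A0] <-]; exact: Alam_gamma_le.
set s := sup_nonneg _; have s0 : (0 <= s)%E := sup_nonneg_ge0 _.
have [->|sy] := eqVneq s +oo%E; first exact: leey.
have sfin : s = (fine s)%:E by rewrite fineK// ge0_fin_numE// lt_neqAle sy leey.
rewrite sfin; apply: sup_sqre_le.
- by have [h hK] := outer_mix_nonempty K0; exists (mult_norm p X h), h.
- by move=> _ [h _ <-]; exact: mult_norm_ge0.
- exact: fine_ge0.
move=> _ [h hK <-]; have [hh h1] := outer_mix_ball hK; have [mh _ _] := hh.
have [_ _ [Q PQ hQ]] := hK.
apply: mult_norm_le => //; first exact: fine_ge0.
move=> lam Ll; rewrite -sfin.
have [A0|] := ltP 0%E (Alam p X lam); last first.
  by move=> A0; apply: le_trans (integral_Slam_le hp X Ll mh h1) (le_trans A0 s0).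
rewrite (integral_Slam_mix hp X Ll mh PQ hQ) (haar_SlamQ hp Ll A0 PQ).
apply: (@le_trans _ _ (Alam p X lam * gammaK p X K lam)%E); last first.
  by apply: sup_nonneg_ub; exists lam.
have [gm [-> _ gub _]] := gammaK_real hp Ll A0 K0.
have Afin : Alam p X lam = (fine (Alam p X lam))%:E by rewrite AlamE.
rewrite [X in (_ <= X * _)%E]Afin -EFinM lee_fin.
by apply: ler_wpM2l; [exact: ltW (fine_Alam_gt0 hp Ll A0)|exact: gub].
Qed.

(** The affinities tend to [1], so [A] is the supremum of the [A * gamma_K]. *)
Lemma Alam_le_sup X lam (B : R) : Lam p lam -> (0 < Alam p X lam)%E ->
  (forall K, (0 < K)%N -> (Alam p X lam * gammaK p X K lam <= B%:E)%E) ->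
  (Alam p X lam <= B%:E)%E.
Proof.
move=> Ll A0 hB; have a0' := fine_Alam_gt0 hp Ll A0.
have Afin : Alam p X lam = (fine (Alam p X lam))%:E by rewrite AlamE.
rewrite Afin lee_fin; apply/ler_addgt0Pr => e e0.
have ea : 0 < e / fine (Alam p X lam) by rewrite divr_gt0.
have [K [Q PQ hQ]] := gammaK_to1 hp Ll A0 ea.
have [gm [gE _ gub _]] := gammaK_real hp Ll A0 (ltn0Sn K).
have := hB K.+1 isT; rewrite gE {1}Afin -EFinM lee_fin => h.
rewrite -lerBlDr; apply: le_trans h.
apply: le_trans (_ : fine (Alam p X lam) * (1 - e / fine (Alam p X lam)) <= _).
  by rewrite mulrBr mulr1 mulrCA mulfV ?mulr1// gt_eqF.
by rewrite ler_wpM2l ?(ltW a0')//; exact: le_trans hQ (gub _ PQ).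
Qed.

(** The lower bound comes from the classes of mixtures: it needs no outer
    function with modulus prescribed by [W], which may vanish on the circle. *)
Lemma Coo_sq X : (Coo p X ^+ 2 = sup_nonneg [set Alam p X lam |
     lam in [set lam | Lam p lam /\ 0 < Alam p X lam]])%E.
Proof.
apply: le_anti; apply/andP; split; last first.
  apply: sup_nonneg_le; first by rewrite expe_ge0// Coo_ge0.
  move=> _ [lam [Ll A0] <-].
  have [->|Cy] := eqVneq (Coo p X ^+ 2)%E +oo%E; first exact: leey.
  have C0 : (0 <= Coo p X ^+ 2)%E by rewrite expe_ge0// Coo_ge0.
  have Cfin : (Coo p X ^+ 2)%E = (fine (Coo p X ^+ 2)%E)%:E.
    by rewrite fineK// ge0_fin_numE// lt_neqAle Cy leey.
  rewrite Cfin; apply: Alam_le_sup => // K K0; rewrite -Cfin.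
  apply: le_trans (Alam_gamma_le K0 Ll A0) _.
  by apply: le_sqre; [exact: CK_ge0|exact: CK_le_Coo].
set s := sup_nonneg _; have s0 : (0 <= s)%E := sup_nonneg_ge0 _.
have [->|sy] := eqVneq s +oo%E; first exact: leey.
have sfin : s = (fine s)%:E by rewrite fineK// ge0_fin_numE// lt_neqAle sy leey.
rewrite sfin; apply: sup_sqre_le.
- have [h hK] := outer_mix_nonempty (ltn0Sn 0); exists (mult_norm p X h), h => //.
  exact: outer_mix_ball hK.
- by move=> _ [h _ <-]; exact: mult_norm_ge0.
- exact: fine_ge0.
move=> _ [h [hh h1] <-]; have [mh _ _] := hh.
apply: mult_norm_le => //; first exact: fine_ge0.
move=> lam Ll; rewrite -sfin; apply: le_trans (integral_Slam_le hp X Ll mh h1) _.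
have [A0|A0] := ltP 0%E (Alam p X lam); last exact: le_trans A0 s0.
by apply: sup_nonneg_ub; exists lam.
Qed.

(** Any upper bound of the [CK] bounds all the A, hence [Coo]. The sequence
    is shifted by one because there is no mixture with [K = 0]. *)
Lemma CK_cvg X : CK p X K @[K --> \oo] --> Coo p X.
Proof.
have nd : {homo (fun n => CK p X n.+1) : n m / (n <= m)%N >-> (n <= m)%E}.
  by move=> n m nm; exact: CK_mono.
have := ereal_nondecreasing_cvgn nd; rewrite (cvg_shiftS (CK p X)).
suff -> : ereal_sup (range (fun n => CK p X n.+1)) = Coo p X by [].
apply: le_anti; apply/andP; split.
  by apply: ge_ereal_sup => _ [n _ <-]; exact: CK_le_Coo.
set s := ereal_sup _.
have CKs K : (0 < K)%N -> (CK p X K <= s)%E.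
  by case: K => // K _; apply: ereal_sup_ubound; exists K.
have s0 : (0 <= s)%E := le_trans (CK_ge0 X (ltn0Sn 0)) (CKs 1%N isT).
have [->|sy] := eqVneq s +oo%E; first exact: leey.
have sfin : s = (fine s)%:E by rewrite fineK// ge0_fin_numE// lt_neqAle sy leey.
have fs0 : 0 <= fine s by exact: fine_ge0.
rewrite sfin -[fine s in leRHS](ger0_norm fs0) -sqrtr_sqr.
apply: sqre_le; [exact: Coo_ge0|exact: sqr_ge0|].
rewrite Coo_sq; apply: sup_nonneg_le; first by rewrite lee_fin sqr_ge0.
move=> _ [lam [Ll A0] <-]; apply: Alam_le_sup => // K K0.
apply: le_trans (Alam_gamma_le K0 Ll A0) _.
have -> : ((fine s ^+ 2)%:E = s ^+ 2)%E by rewrite [in RHS]sfin expe2 -EFinM expr2.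
by apply: le_sqre; [exact: CK_ge0|exact: CKs].
Qed.

End suprema.

Local Close Scope complex_scope.

Theorem theorem7p1 (R : realType) (p : R) (hp : 2 < p) :
  exists2 cp : R, 0 < cp &
  forall X Y : nat -> {poly R[i]},
    (Y = X \/ exists N : nat, Y = coord_tail X N) ->
  (forall K : nat, (1 <= K)%N ->
     (CK p Y K ^+ 2 =
      sup_nonneg [set Alam p Y lam * gammaK p Y K lam |
        lam in [set lam | Lam p lam /\ 0 < Alam p Y lam]])%E) /\
  (Coo p Y ^+ 2 =
   sup_nonneg [set Alam p Y lam |
     lam in [set lam | Lam p lam /\ 0 < Alam p Y lam]])%E /\
  (forall (K : nat) (lam : nat -> R), (1 <= K)%N -> Lam p lam ->
     (0 < Alam p Y lam)%E ->
     (cp%:E * deltaK p Y K lam ^+ 2 <= 1 - gammaK p Y K lam)%E /\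
     (1 - gammaK p Y K lam <= deltaK p Y K lam `^ aexp p)%E) /\
  (forall K L : nat, (1 <= K)%N -> (K <= L)%N -> (CK p Y K <= CK p Y L)%E) /\
  (CK p Y K @[K --> \oo] --> Coo p Y).
Proof.
exists (Num.min (aexp p) (1 - aexp p) / 4).
  by rewrite divr_gt0// lt_min aexp_gt0//= subr_gt0 aexp_lt1.
move=> X Y _; split; first by move=> K; exact: CK_sq.
split; first exact: Coo_sq.
split; first by move=> K lam K1 Ll A0; exact: delta_gamma_bounds.
split; first by move=> K L _; exact: CK_mono.
exact: CK_cvg.
Qed.
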